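(* Let $p\ge 1$ be a fixed number of covariates. Then the balance $B$ of the allocation produced by the greedy pair-switching algorithm on $2n$ individuals with $p$ covariates satisfies $$B=O_p\left(n^{-(1+2/p)}\right)\quad\text{as } n\to\infty .$$
   Context: The covariate vectors of the $2n$ individuals are independent, identically distributed random vectors in $\mathbb{R}^p$ with a uniformly continuous joint density and finite variances. After the covariates of the $2n$ individuals are observed, each covariate $j$ is standardized (shifted and scaled) so that its sum over all $2n$ individuals is $0$ and its sum of squares over all $2n$ individuals is $2n-1$. An allocation assigns $n$ of the $2n$ individuals to treatment and the other $n$ to control. With $x_{T,i,j}$ denoting the standardized value of covariate $j$ for the $i$-th treated individual, the balance of an allocation is $$B=\frac{2}{n}\sum_{j=1}^p\left|\sum_{i=1}^n x_{T,i,j}\right|,$$ which equals the sum over the covariates of the absolute standardized difference of the group averages. Greedy pair-switching algorithm: (1) choose an initial allocation uniformly at random among all $\binom{2n}{n}$ allocations (independently of the covariate values); (2) among all $n^2$ possible switches of one individual currently in treatment with one individual currently in control, find the one whose resulting allocation has the smallest $B$; (3) if that value of $B$ is strictly less than the current one, make the switch and return to (2); otherwise stop and output the current allocation. $Z_n=O_p(a_n)$ means that $Z_n/a_n$ is bounded in probability. *)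

(* Defs.v *)
From HB Require Import structures.
From mathcomp Require Import all_boot all_order all_algebra.
From mathcomp Require Import all_classical all_reals all_analysis.

Set Implicit Arguments.
Unset Strict Implicit.
Unset Printing Implicit Defensive.

Import Order.TTheory GRing.Theory Num.Theory.
Import numFieldNormedType.Exports.

Local Open Scope classical_set_scope.
Local Open Scope ring_scope.

(* Lebesgue measure on R^p, carried by [p.-tuple R] because the library puts
   the product sigma-algebra on tuples: dirac at the empty tuple for p = 0, and
   the image of the product measure by [cons] for p + 1. *)
Section lebesgue_tuple_step.
Context (R : realType) (p : nat).
Variable mu : {sigma_finite_measure set (p.-tuple R) -> \bar R}.

(* [measurableTypeR R] is [R] under the display for which the library states
   [lebesgue_measure]; both carry the Borel sigma-algebra. *)
Definition pair_cons (xt : measurableTypeR R * p.-tuple R) : p.+1.-tuple R :=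
  [tuple of (xt.1 : R) :: xt.2].

Lemma measurable_pair_cons :
  measurable_fun [set: measurableTypeR R * p.-tuple R] pair_cons.
Proof.
apply: (@measurable_cons _ _ _ R (fun xt => xt.1 : R) _ snd) => //.
exact: (@measurable_fst _ _ (measurableTypeR R)).
Qed.

HB.instance Definition _ := @isMeasurableFun.Build _ _ _ _ pair_cons
  measurable_pair_cons.

Definition lebesgue_tuple_succ : set (p.+1.-tuple R) -> \bar R :=
  pushforward (@lebesgue_measure R \x mu)%E pair_cons.

Let lebesgue_tuple_succ0 : lebesgue_tuple_succ set0 = 0%E.
Proof. by rewrite /lebesgue_tuple_succ /pushforward preimage_set0 measure0. Qed.

Let lebesgue_tuple_succ_ge0 A : (0 <= lebesgue_tuple_succ A)%E.
Proof. exact: measure_ge0. Qed.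

Let lebesgue_tuple_succ_additive : semi_sigma_additive lebesgue_tuple_succ.
Proof.
exact: (@measure_semi_sigma_additive _ _ _
  (measure_function_pushforward__canonical__measure_function_Measure _
    measurable_pair_cons)).
Qed.

HB.instance Definition _ := isMeasure.Build _ _ _ lebesgue_tuple_succ
  lebesgue_tuple_succ0 lebesgue_tuple_succ_ge0 lebesgue_tuple_succ_additive.

Let lebesgue_tuple_succ_sigma_finite :
  sigma_finite [set: p.+1.-tuple R] lebesgue_tuple_succ.
Proof.
have /sigma_finiteP[F [FT ndF Foo]] := sigma_finiteT (@lebesgue_measure R).
have /sigma_finiteP[G [GT ndG Goo]] := sigma_finiteT mu.
pose H k := [set t : p.+1.-tuple R | F k (thead t) /\ G k [tuple of behead t]].
exists H.
  apply/seteqP; split => // t _.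
  have [i _ Fi] : (\bigcup_k F k) (thead t) by rewrite -FT.
  have [j _ Gj] : (\bigcup_k G k) [tuple of behead t] by rewrite -GT.
  exists (maxn i j) => //; split.
    by move: Fi; exact/subsetPset/ndF/leq_maxl.
  by move: Gj; exact/subsetPset/ndG/leq_maxr.
move=> k; have [mF Fk] := Foo k; have [mG Gk] := Goo k; split.
  apply: measurableI.
    rewrite -[X in measurable X]setTI.
    exact: (@measurable_tnth _ R p.+1 ord0 measurableT (F k)).
  rewrite -[X in measurable X]setTI.
  exact: (@measurable_behead _ R p measurableT (G k)).
rewrite /lebesgue_tuple_succ /pushforward.
rewrite (_ : pair_cons @^-1` H k = F k `*` G k); last first.
  apply/seteqP; split => -[x t]; rewrite /H/= theadE;
    by rewrite (_ : [tuple of behead (pair_cons (x, t))] = t)//; exact: val_inj.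
by rewrite product_measure1E// lte_mul_pinfty// ge0_fin_numE.
Qed.

HB.instance Definition _ := @Measure_isSigmaFinite.Build _ _ _ lebesgue_tuple_succ
  lebesgue_tuple_succ_sigma_finite.

End lebesgue_tuple_step.

Fixpoint lebesgue_tuple (R : realType) (p : nat) :
    {sigma_finite_measure set (p.-tuple R) -> \bar R} :=
  if p is q.+1 then lebesgue_tuple_succ (lebesgue_tuple R q)
  else \d_([tuple] : 0.-tuple R).

Section probability_notions.
Context d (T : measurableType d) (R : realType) (P : probability T R).

(* [f] takes row vectors rather than tuples because the library's topology on
   R^p is the one on matrices. *)
Definition has_joint_density p (X : T -> p.-tuple R) (f : 'rV[R]_p -> R) :=
  forall A : set (p.-tuple R), measurable A ->
    P (X @^-1` A) =
      (\int[lebesgue_tuple R p]_(t in A) (f (\row_j tnth t j))%:E)%E.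

Definition mutually_independent d' (U : measurableType d') (I : finType)
    (X : I -> T -> U) :=
  forall (J : {set I}) (E : I -> set U), (forall i, measurable (E i)) ->
    P (\bigcap_(i in [set` J]) X i @^-1` E i) =
      (\prod_(i in J) P (X i @^-1` E i))%E.

(* [S] is measurable for the discrete sigma-algebra of the finite type [F]. *)
Definition fin_measurable (F : finType) (S : T -> F) :=
  forall s : F, measurable (S @^-1` [set s]).

Definition independent_of d' (U : measurableType d') n (X : 'I_n -> T -> U)
    (F : finType) (S : T -> F) :=
  forall (s : F) (E : set T), g_sigma_preimage X E ->
    P (S @^-1` [set s] `&` E) = (P (S @^-1` [set s]) * P E)%E.

Definition bigO_in_probability (Z : nat -> T -> R) (a : nat -> R) :=
  forall e : R, 0 < e -> exists2 M : R, 0 < M &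
    \forall n \near \oo, (P [set w | (M < `|Z n w / a n|)%R] <= e%:E)%E.

End probability_notions.

(* An allocation of [m] individuals is its set of treated individuals. *)
Section balance.
Context (R : realType) (m p : nat).
Implicit Types (x : 'I_m -> p.-tuple R) (j : 'I_p).

Definition sample_mean x j : R := (\sum_i tnth (x i) j) / m%:R.

Definition sample_sd x j : R :=
  Num.sqrt ((\sum_i (tnth (x i) j - sample_mean x j) ^+ 2) / m.-1%:R).

(* Over the [m] individuals, the sum is 0 and the sum of squares is [m - 1]
   as soon as covariate [j] is not constant (almost surely the case when it has
   a density); when it is constant the quotient is 0. *)
Definition standardized x (i : 'I_m) j : R :=
  (tnth (x i) j - sample_mean x j) / sample_sd x j.

End balance.

Definition balance (R : realType) (n p : nat) (x : 'I_(2 * n) -> p.-tuple R)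
    (A : {set 'I_(2 * n)}) : R :=
  2 / n%:R * \sum_(j < p) `|\sum_(i in A) standardized x i j|.

Section greedy.
Context (R : realType) (I : finType) (B : {set I} -> R).

Definition switch (A A' : {set I}) :=
  exists i k, [/\ i \in A, k \notin A & A' = k |: (A :\ i)].

Definition best_switch (A A' : {set I}) :=
  switch A A' /\ forall A'', switch A A'' -> B A' <= B A''.

(* [greedy A C]: started from [A], the algorithm may output [C]. This is a
   relation because best switches may be tied; no tie-breaking rule is fixed. *)
Inductive greedy : {set I} -> {set I} -> Prop :=
| greedy_stop A : (forall A', best_switch A A' -> ~ (B A' < B A)) -> greedy A A
| greedy_step A A' C :
    best_switch A A' -> B A' < B A -> greedy A' C -> greedy A C.

Lemma greedy_total A : exists C, greedy A C.
Proof.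
have [k] := ubnP #|[pred A' | B A' < B A]|.
elim: k A => // k IH A Ak.
have [[A' [bA' lt]]|no] := pselect (exists A', best_switch A A' /\ B A' < B A).
  have [|C gC] := IH A'; last by exists C; exact: greedy_step gC.
  rewrite ltnS in Ak; apply: leq_trans Ak; apply: proper_card; apply/properP; split.
    by apply/fintype.subsetP => D; rewrite !inE => /lt_trans; apply.
  by exists A'; rewrite !inE ?ltxx.
by exists A; apply: greedy_stop => A' bA' lt; apply: no; exists A'.
Qed.

End greedy.

(* Main.v *)
Require Import Defs.
From mathcomp Require Import all_boot all_order all_algebra.
From mathcomp Require Import all_classical all_reals all_analysis.
From mathcomp Require Import measurable_realfun.
From mathcomp Require Import lra ring zify.

(* Up to the factor 2/n, the balance of an allocation A is the weighted l1 norm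
   Phi of the vector s(A) of centred sums over the treated individuals, and
   switching i with k adds x_k - x_i to s. Fix a cube W on which the density is
   bounded and bounded away from 0.
   While s is not small, every best switch gains a constant and leaves the
   individuals of W alone: a switched one could be replaced by a neighbour whose
   covariates are shifted against the remaining imbalance. By the law of large
   numbers Phi starts at o(n), so this phase is short enough for the cube to stay
   populated.
   From a constant size, s reaches the scale n^(-13/(8p)) in three switches,
   because second moments show that every difference vector of a fine enough mesh
   is realized by a pair of W avoiding any eight given individuals. At this scale
   no individual of W has two close neighbours, so a later switch which touches
   the pair needed at some step exchanges exactly that pair; as each switch
   divides Phi by at least 4, this pair would be too short for an earlier step.
   Hence the descent only stops below M n^(-2/p): the probability that some dyadic
   shell above this size lacks a suitable pair is O(1/M). *)

Set Implicit Arguments.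
Unset Strict Implicit.
Unset Printing Implicit Defensive.

Import Order.TTheory GRing.Theory Num.Theory.
Import numFieldNormedType.Exports.

Local Open Scope ring_scope.

(** * The greedy descent *)

(** After the first switch the allocation depends on all the covariates, so no fresh randomness is
    left for later steps. Every probabilistic statement is therefore about the covariates and the
    initial allocation alone, uniformly over the vectors to be cancelled and over the few
    individuals already moved.

    This uniformity dictates the exponents. Let [u] be n^(-1/(8p)). A covering of the size u^a by a
    mesh u^b costs a factor u^(-(b-a)p), while second moments bound a single miss by about
    u^((16-b)p) + u^(8p), the last term coming from pairs that share an individual. With integer
    exponents, one jump from constant size reaches at most u^7, the next ones u^11 and u^13.
    Conversely, triples of individuals within distance r number about n^3 r^(2p), which vanishes
    only for r well below u^12. So 13 is the first integer exponent at which isolation can replace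
    the count of moved individuals, a count that would grow with the logarithmically many later
    steps. From there on the mesh is a fixed fraction of the current size and a covering has
    boundedly many vectors. *)

Section greedy_facts.
Context (R : realType) (I : finType).
Implicit Types (B : {set I} -> R) (A C : {set I}).

(** The relation only compares values of the objective, so a descent for the balance is a descent
    for the potential, which differs from it by the factor [2 / n]. *)
Lemma greedy_scale B B' (c : R) A C : 0 < c -> (forall D, B' D = c * B D) ->
  greedy B' A C -> greedy B A C.
Proof.
move=> c0 BB'; elim=> [{}A stop|{}A A' {}C [sA bA] lt _ gC].
  apply: greedy_stop => A' [sA' bA'] lt; apply: (stop A').
    by split=> // A'' /bA'; rewrite !BB' ler_pM2l.
  by rewrite !BB' ltr_pM2l.
apply: greedy_step gC.
  by split=> // A'' /bA; rewrite !BB' ler_pM2l.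
by move: lt; rewrite !BB' ltr_pM2l.
Qed.

Lemma best_switch_exists B A A1 : switch A A1 ->
  exists A', best_switch B A A' /\ B A' <= B A1.
Proof.
move=> sA1; pose Q A' := `[< switch A A' >].
have Q1 : Q A1 by apply/asboolP.
case: (arg_minP B Q1) => A' /asboolP sA' minA'.
by exists A'; split; [split=> // A'' sA''; apply: minA'; apply/asboolP|apply: minA'].
Qed.

Lemma greedy_le B A C : greedy B A C -> B C <= B A.
Proof. by elim=> // {}A A' {}C _ /ltW lt _ le; exact: le_trans lt. Qed.

(** An improving switch refutes [greedy_stop], and the switch actually taken is at least as good. A
    step of the descent is thus analysed by exhibiting one good switch. *)
Lemma greedy_progress B A A1 C : greedy B A C -> switch A A1 -> B A1 < B A ->
  exists A', [/\ best_switch B A A', B A' <= B A1 & greedy B A' C].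
Proof.
move=> gC; case: gC A1 => [{}A stop|{}A A' {}C [sA bA] lt gC] A1 sA1 lt1.
  have [A' [bA' le]] := best_switch_exists B sA1.
  by case: (stop A' bA'); apply: le_lt_trans lt1.
by exists A'; split=> //; exact: bA.
Qed.

End greedy_facts.

(** * Deterministic conditions on the covariates under which the descent ends low *)

Section greedy_descent.
Context (R : realType) (I : finType) (p : nat).
Variables (x : I -> 'I_p -> R) (mean w : 'I_p -> R) (wl K : R).
Hypotheses (wl0 : 0 < wl) (w_ge : forall j, wl <= w j) (w_sum : \sum_j w j <= K).
Implicit Types (A C D : {set I}) (s v : 'I_p -> R).

Definition imbalance A j : R := \sum_(i in A) (x i j - mean j).
(** The weights stand for the inverse sample standard deviations. They enter only through [wl] and
    [K], which confines the randomness of the standardization to two constants. *)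
Definition wnorm v : R := \sum_j w j * `|v j|.
Definition potential A : R := wnorm (imbalance A).

Let w0 j : 0 <= w j. Proof. exact: le_trans (ltW wl0) (w_ge j). Qed.

Lemma imbalance_switch A i k j : i \in A -> k \notin A ->
  imbalance (k |: (A :\ i)) j = imbalance A j + (x k j - x i j).
Proof.
move=> iA kA; rewrite /imbalance (big_setD1 i iA)/= big_setU1/=; last first.
  by rewrite !inE (negbTE kA) andbF.
ring.
Qed.

Lemma wnorm_ge0 v : 0 <= wnorm v.
Proof. by apply: sumr_ge0 => j _; rewrite mulr_ge0. Qed.

Lemma wnorm_le v e : 0 <= e -> (forall j, `|v j| <= e) -> wnorm v <= K * e.
Proof.
move=> e0 ve; apply: (@le_trans _ _ (\sum_j w j * e)).
  by apply: ler_sum => j _; rewrite ler_wpM2l.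
by rewrite -mulr_suml ler_wpM2r.
Qed.

Lemma wnorm_ge v j : wl * `|v j| <= wnorm v.
Proof.
rewrite /wnorm (bigD1 j)//= -[leLHS]addr0 lerD ?ler_wpM2r//.
by apply: sumr_ge0 => k _; rewrite mulr_ge0.
Qed.

Lemma wnorm_triangle u v : wnorm (fun j => u j + v j) <= wnorm u + wnorm v.
Proof.
rewrite /wnorm -big_split/=; apply: ler_sum => j _.
by rewrite -mulrDr ler_wpM2l// ler_normD.
Qed.

Lemma eq_wnorm u v : u =1 v -> wnorm u = wnorm v.
Proof. by move=> uv; apply: eq_bigr => j _; rewrite uv. Qed.

Variables (a : 'I_p -> R) (l : R) (S0 : {set I}).

Definition in_window (b : R) (y : 'I_p -> R) := forall j, `|y j - a j| <= b.

Definition close_to (e : R) (y z : 'I_p -> R) := forall j, `|y j - z j| <= e.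

(** Targets range over the doubled window because they are points of the window displaced by at most
    [l]. More than [L] witnesses are asked for so that one is left after [L] switches. *)
Definition dense_points (S : {set I}) (e : R) (L : nat) :=
  forall y, in_window (2 * l) y -> (L < #|[set i in S | `[< close_to e (x i) y >]]|)%N.

(* At most two individuals of the window are altered by the first phase and two
   by each of the three jumps, whence the 8. *)
Definition matching_pairs (r e : R) :=
  forall v D, (#|D| <= 8)%N -> (forall j, `|v j| <= r) ->
    exists i k, [/\ i \in S0 :\: D, k \notin S0 :|: D,
      in_window l (x i), in_window l (x k) & close_to e (fun j => x k j - x i j) v].

Definition isolated_pairs (r : R) :=
  forall i k k', in_window l (x i) -> close_to r (x k) (x i) -> close_to r (x k') (x i) ->
    i != k -> i != k' -> k = k'.

(** Only individuals of the window count: the first phase may move many others, whereas the pairs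
    given by [matching_pairs] lie in the window. *)
Definition altered A := [set i | `[< in_window l (x i) >] && ((i \in A) != (i \in S0))].

Lemma altered_switch A i k : i \in A -> k \notin A ->
  altered (k |: (A :\ i)) \subset altered A :|: [set i; k].
Proof.
move=> iA kA; apply/fintype.subsetP => b; rewrite !inE.
have [->|bi] := eqVneq b i; first by rewrite orbT.
have [->|bk] := eqVneq b k; first by rewrite !orbT.
by rewrite !orbF !andTb.
Qed.

Lemma card_altered_switch A A' : switch A A' -> (#|altered A'| <= #|altered A| + 2)%N.
Proof.
move=> [i [k [iA kA ->]]].
apply: leq_trans (subset_leq_card (altered_switch iA kA)) _.
apply: leq_trans (leq_card_setU _ _).1 _.
by rewrite leq_add2l cards2; case: eqP.
Qed.

Lemma unaltered_in A i : in_window l (x i) -> i \notin altered A ->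
  (i \in A) = (i \in S0).
Proof.
move=> Wi; rewrite !inE negb_and negbK => /orP[/asboolPn//|/eqP//].
Qed.

(** Applied to minus the imbalance and to the altered individuals, [matching_pairs] yields a pair
    still on its initial sides. Its switch is therefore available and cancels the imbalance up to
    [e] in each covariate. *)
Lemma jump r e A C : 0 <= e -> matching_pairs r e -> greedy potential A C ->
  (#|altered A| <= 8)%N -> (forall j, `|imbalance A j| <= r) ->
  exists A', [/\ greedy potential A' C, potential A' <= K * e
     & (#|altered A'| <= #|altered A| + 2)%N].
Proof.
move=> e0 mp gC alt rA.
(* Below the target there may be no improving switch; the descent is then left where it is. *)
have [small|big] := leP (potential A) (K * e).
  by exists A; split=> //; exact: leq_addr.
have [|i [k [iS kS Wi Wk ik]]] := mp (fun j => - imbalance A j) _ alt.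
  by move=> j; rewrite normrN.
move: iS kS; rewrite !inE negb_or => /andP[ia iS] /andP[kS ka].
have iA : i \in A by rewrite (unaltered_in Wi)// !inE.
have kA : k \notin A by rewrite (unaltered_in Wk)// !inE.
have sA1 : switch A (k |: (A :\ i)) by exists i, k.
have le1 : potential (k |: (A :\ i)) <= K * e.
  apply: wnorm_le => // j; rewrite imbalance_switch//.
  by have := ik j; rewrite opprK addrC.
have [A' [bA' le' gA']] := greedy_progress gC sA1 (le_lt_trans le1 big).
exists A'; split=> //; first exact: le_trans le1.
by apply: card_altered_switch; case: bA'.
Qed.

(** * Last phase: repeated division of the potential by 4 *)

Section final_phase.
Variables (As : {set I}) (rmin rmax g : R).
Hypotheses (As_alt : (#|altered As| <= 8)%N) (rmin0 : 0 < rmin) (g0 : 0 <= g)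
  (gsmall : 4 * (K * g) <= wl)
  (mp : forall r, rmin <= r <= rmax -> matching_pairs r (g * r))
  (iso : isolated_pairs (3 * rmax)).

(** [As] is the allocation reached by the jumps. The threshold [3 * potential A] shrinks along the
    descent, so each step has to protect only shorter pairs than the step before. *)
Definition intact A := forall i k, i \in As -> k \notin As ->
  in_window l (x i) -> in_window l (x k) ->
  close_to (3 * rmax) (x k) (x i) ->
  wnorm (fun j => x k j - x i j) < 3 * potential A -> i \in A /\ k \notin A.

Lemma potential_bound A r j : potential A <= wl * r -> `|imbalance A j| <= r.
Proof. by move=> Ar; rewrite -(ler_pM2l wl0); exact: le_trans (wnorm_ge _ j) Ar. Qed.

Lemma wnorm_bound v r j : wnorm v <= wl * r -> `|v j| <= r.
Proof. by move=> Ar; rewrite -(ler_pM2l wl0); exact: le_trans (wnorm_ge _ j) Ar. Qed.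

Lemma close_toC e y z : close_to e y z -> close_to e z y.
Proof. by move=> yz j; rewrite distrC. Qed.

(* The first time an intact pair is hit, it is switched as a whole because no
   other point is close to it; but a switch dividing the potential by 4 moves the
   imbalance by at least 3 times the new potential. *)
Lemma intact_step A A' : potential A <= wl * rmax -> intact A ->
  switch A A' -> 4 * potential A' <= potential A -> intact A'.
Proof.
move=> Ar iA [i' [k' [i'A k'A A'E]]] dec i k iAs kAs Wi Wk nr small.
have PA' : 0 <= potential A' by exact: wnorm_ge0.
have [i_A k_A] : i \in A /\ k \notin A by apply: iA => //; lra.
have sE j : imbalance A' j = imbalance A j + (x k' j - x i' j).
  by rewrite A'E imbalance_switch.
(* The displacement is a difference of two imbalances of size at most [rmax], so the two switched
   individuals are themselves close and fall under [iso]. *)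
have nr' : close_to (3 * rmax) (x k') (x i').
  move=> j; have -> : x k' j - x i' j = imbalance A' j - imbalance A j.
    rewrite sE; ring.
  apply: le_trans (ler_normB _ _) _.
  have h1 := @potential_bound A rmax j Ar.
  have h2 := @potential_bound A' rmax j (le_trans _ Ar).
  have := h2 _; have : 0 <= rmax by apply: le_trans h1.
  by move=> ? /(_ ltac:(lra)); lra.
suff : (i' != i) && (k' != k).
  move=> /andP[ii' kk']; rewrite A'E !inE i_A [i == i']eq_sym ii' orbT; split=> //.
  by rewrite negb_or [k == k']eq_sym kk' negb_and k_A orbT.
have ik' : i != k' by apply: contraNneq k'A => <-.
have ik : i != k by apply: contraNneq k_A => <-.
have i'k : i' != k by apply: contraNneq k_A => <-.
have i'k' : i' != k' by apply: contraNneq k'A => <-.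
have notboth : ~ (i' = i /\ k' = k).
  move=> [ii' kk']; move: small; rewrite -ii' -kk' => small.
  have : potential A <= potential A' + wnorm (fun j => x k' j - x i' j).
    rewrite /potential (_ : wnorm (fun j => x k' j - x i' j) =
       wnorm (fun j => - (x k' j - x i' j))); last first.
      by apply: eq_bigr => j _; rewrite normrN.
    apply: le_trans (wnorm_triangle _ _).
    by rewrite le_eqVlt; apply/orP; left; apply/eqP; apply: eq_wnorm => j; rewrite sE; ring.
  by lra.
apply/andP; split; apply/eqP => E.
  apply: notboth; split=> //; apply/esym.
  by apply: (iso Wi) => //; rewrite -E.
apply: notboth; split=> //; apply/esym.
apply: (iso Wk); rewrite 1?eq_sym//.
  exact: close_toC.
by apply: close_toC; rewrite -E.
Qed.

(** A pair matching minus the imbalance up to [g * r] leaves a potential of at most [K * g * r], a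
    quarter of the current one by [gsmall]. Such a pair has norm at most 5/4 of the potential, below
    the factor 3 of [intact], hence it is still in place. *)
Lemma final_switch A : wl * rmin < potential A -> potential A <= wl * rmax ->
  intact A -> exists A1, switch A A1 /\ 4 * potential A1 <= potential A.
Proof.
move=> big Ar iA; pose r := potential A / wl.
have rE : potential A = wl * r by rewrite /r mulrCA divff ?mulr1// gt_eqF.
have rr : rmin <= r <= rmax.
  by move: big Ar; rewrite rE ltr_pM2l// ler_pM2l// => /ltW -> ->.
have sr j : `|imbalance A j| <= r by apply: potential_bound; rewrite rE.
(* The pair avoids only what was altered up to [As]; what happened since then is controlled by
   [intact]. *)
have [|i [k [iS kS Wi Wk ik]]] := mp rr (v := fun j => - imbalance A j) As_alt.
  by move=> j; rewrite normrN.
move: iS kS; rewrite finset.in_setD finset.in_setU negb_or => /andP[ia iS] /andP[kS ka].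
have iAs : i \in As by rewrite (unaltered_in Wi).
have kAs : k \notin As by rewrite (unaltered_in Wk).
have r0 : 0 < r by case/andP: rr => h _; exact: lt_le_trans h.
have small : 4 * wnorm (fun j => imbalance A j + (x k j - x i j)) <= potential A.
  apply: le_trans (_ : 4 * (K * (g * r)) <= _).
    rewrite ler_pM2l//; apply: wnorm_le => [|j]; first by rewrite mulr_ge0// ltW.
    by have := ik j; rewrite opprK addrC.
  have : 4 * (K * g) * r <= wl * r by rewrite ler_pM2r.
  by rewrite rE; lra.
have dsmall : wnorm (fun j => x k j - x i j) <= 5/4 * potential A.
  have -> : wnorm (fun j => x k j - x i j) = wnorm (fun j =>
      (imbalance A j + (x k j - x i j)) + - imbalance A j).
    by apply: eq_wnorm => j; ring.
  apply: le_trans (wnorm_triangle _ _) _.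
  have -> : wnorm (fun j => - imbalance A j) = potential A.
    by apply: eq_bigr => j _; rewrite normrN.
  lra.
have PA : 0 < potential A by rewrite rE mulr_gt0.
have [i_A k_A] : i \in A /\ k \notin A.
  apply: iA => //; last by lra.
  move=> j; apply: (@wnorm_bound (fun j => x k j - x i j)).
  apply: le_trans dsmall _; lra.
exists (k |: (A :\ i)); split; first by exists i, k.
rewrite /potential (_ : wnorm (imbalance _) = 
  wnorm (fun j => imbalance A j + (x k j - x i j)))//.
by apply: eq_wnorm => j; rewrite imbalance_switch.
Qed.

Lemma final_phase A C : greedy potential A C -> potential A <= wl * rmax ->
  intact A -> potential C <= wl * rmin.
Proof.
elim=> {A C} [A stop|A A' C bA lt gC IH] Ar iA.
  rewrite leNgt; apply/negP => big.
  have [A1 [sA1 le1]] := final_switch big Ar iA.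
  have [A' [bA' le']] := best_switch_exists potential sA1.
  have : 0 < potential A by apply: lt_trans big; rewrite mulr_gt0.
  by move=> ?; apply: (stop A' bA'); lra.
have [big|small] := ltP (wl * rmin) (potential A); last first.
  by apply: le_trans (greedy_le gC) _; lra.
have [A1 [sA1 le1]] := final_switch big Ar iA.
have PA : 0 <= potential A' by exact: wnorm_ge0.
have le' : potential A' <= potential A1 by case: bA => _; apply.
apply: IH; first by lra.
by apply: intact_step iA _ _ => //; [case: bA|lra].
Qed.

End final_phase.

(** * First phase: constant gains while the imbalance is large *)

Section first_phase.
Variables (eta e : R) (L : nat).
Hypotheses (eta0 : 0 < eta) (eta_l : eta <= l) (e0 : 0 < e)
  (e_small : 4 * (K * (2 * e)) <= wl * eta)
  (denseS : dense_points S0 e L) (denseC : dense_points (~: S0) e L).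

Local Notation gain := (wl * eta / 4).

Definition axis_shift (j : 'I_p) (h : R) (j' : 'I_p) : R := if j' == j then h else 0.

(** Moving coordinate [j] by [eta / 2] towards 0 does not cross 0 and gains at least [wl * eta / 2].
    An error of [2 * e] per coordinate costs at most [K * (2 * e)], which [e_small] bounds by half
    of that gain. *)
Lemma shift_gain s v j : eta <= `|s j| ->
  (forall j', `|v j' + axis_shift j (Num.sg (s j) * eta / 2) j'| <= 2 * e) ->
  wnorm (fun j' => s j' + v j') <= wnorm s - gain.
Proof.
move=> sj vj.
have key : wnorm (fun j' => s j' - axis_shift j (Num.sg (s j) * eta / 2) j') =
    wnorm s - w j * (eta / 2).
  rewrite /wnorm (bigD1 j)//= [in RHS](bigD1 j)//= [\sum_(i | i != j) _](eq_bigr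
    (fun i => w i * `|s i|)); last first.
    by move=> i /negbTE ij; rewrite /axis_shift ij subr0.
  rewrite /axis_shift eqxx.
  have -> : `|s j - Num.sg (s j) * eta / 2| = `|s j| - eta / 2.
    have s0 : 0 < `|s j| by exact: lt_le_trans sj.
    have -> : s j - Num.sg (s j) * eta / 2 = Num.sg (s j) * (`|s j| - eta / 2).
      by rewrite {1}[s j]numEsg; ring.
    rewrite normrM normr_sg.
    rewrite -normr_gt0 s0 mul1r ger0_norm//; lra.
  ring.
have : wnorm (fun j' => s j' + v j') <=
   wnorm (fun j' => s j' - axis_shift j (Num.sg (s j) * eta / 2) j') +
   wnorm (fun j' => v j' + axis_shift j (Num.sg (s j) * eta / 2) j').
  apply: le_trans (wnorm_triangle _ _).
  by rewrite le_eqVlt; apply/orP; left; apply/eqP; apply: eq_wnorm => j'; ring.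
have e20 : 0 <= 2 * e by rewrite mulr_ge0// ltW.
have es := e_small.
have := wnorm_le e20 vj; have := w_ge j; rewrite key => h1 h2 h3.
have : wl * eta / 2 <= w j * (eta / 2) by rewrite -mulrA ler_pM2r//; exact: divr_gt0.
by move=> h4; lra.
Qed.

Lemma axis_shift_norm j h j' : `|axis_shift j h j'| <= `|h|.
Proof. by rewrite /axis_shift; case: ifP => //; rewrite normr0. Qed.

Lemma sg_half_le (z : R) : `|Num.sg z * eta / 2| <= l.
Proof.
rewrite -mulrA normrM normr_sg [`|eta / 2|]gtr0_norm ?divr_gt0//.
have h1 := eta0; have h2 := eta_l; case: (z != 0); rewrite ?mul1r ?mul0r; lra.
Qed.

Lemma dense_pick S A y : dense_points S e L -> (#|S :\: A| <= L)%N ->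
  in_window (2 * l) y -> exists i, [/\ i \in S, i \in A & close_to e (x i) y].
Proof.
move=> dS SA Wy; have lt := leq_ltn_trans SA (dS y Wy).
suff : ~~ ([set i in S | `[< close_to e (x i) y >]] \subset S :\: A).
  move=> /subsetPn[i]; rewrite !inE => /andP[iS /asboolP wi].
  by rewrite iS andbT negbK => iA; exists i.
by apply: contraTN lt => /subset_leq_card; rewrite -leqNgt.
Qed.

(** [t] counts the switches made so far. The first two clauses say that the clusters of
    [dense_points] have lost at most [t] members; the third, with a nonnegative potential, limits
    [t]. *)
Definition phase1_state A t := [/\ (#|S0 :\: A| <= t)%N, (#|A :\: S0| <= t)%N,
  potential A + t%:R * gain <= potential S0 & altered A = finset.set0].

Let l0 : 0 < l. Proof. exact: lt_le_trans eta_l. Qed.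

(** An individual near the centre of the window is exchanged with one near the centre shifted
    against the imbalance in covariate [j]. *)
Lemma phase1_gain A t j : (t <= L)%N -> phase1_state A t -> eta <= `|imbalance A j| ->
  exists A1, switch A A1 /\ potential A1 <= potential A - gain.
Proof.
have h0 := e0; have h1 := eta0; have h2 := eta_l; have h3 := l0; move=> tL [SA AS _ _] sj.
have [i [_ iA wi]] : exists i, [/\ i \in S0, i \in A & close_to e (x i) a].
  apply: dense_pick => //; first exact: leq_trans tL.
  by move=> j'; rewrite subrr normr0; lra.
pose h := Num.sg (imbalance A j) * eta / 2.
have [k [_ kA wk]] : exists k, [/\ k \in ~: S0, k \in ~: A &
    close_to e (x k) (fun j' => a j' - axis_shift j h j')].
  apply: dense_pick => //.
    rewrite (_ : ~: S0 :\: ~: A = A :\: S0); first exact: leq_trans tL.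
    by apply/setP => b; rewrite !inE negbK andbC.
  move=> j'; rewrite addrAC subrr add0r normrN.
  apply: le_trans (axis_shift_norm _ _ _) _.
  by apply: le_trans (sg_half_le _) _; lra.
rewrite inE in kA.
exists (k |: (A :\ i)); split; first by exists i, k.
rewrite /potential (eq_wnorm (v := fun j' => imbalance A j' + (x k j' - x i j'))); last first.
  by move=> j'; rewrite imbalance_switch.
apply: (shift_gain sj) => j'.
have -> : x k j' - x i j' + axis_shift j (Num.sg (imbalance A j) * eta / 2) j' =
   (x k j' - (a j' - axis_shift j h j')) - (x i j' - a j') by rewrite /h; ring.
apply: le_trans (ler_normB _ _) _.
by have := wk j'; have := wi j'; lra.
Qed.

Lemma gain_gt0 : 0 < gain. Proof. by rewrite divr_gt0// mulr_gt0. Qed.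

(* If the best switch still leaves a large imbalance, exchanging a switched
   individual of the window for a nearby one would have done better. *)
Lemma phase1_outside A A' t i k : (t <= L)%N -> phase1_state A t ->
  best_switch potential A A' -> i \in A -> k \notin A -> A' = k |: (A :\ i) ->
  (exists j, eta <= `|imbalance A' j|) -> ~ in_window l (x i) /\ ~ in_window l (x k).
Proof.
have h0 := e0; have h1 := eta0; have h2 := eta_l; have h3 := l0; move=> tL [SA AS _ _] [_ best] iA kA A'E [j sj].
pose h := Num.sg (imbalance A' j) * eta / 2.
split=> Wx.
  (* A removed individual counts negatively, so its substitute is sought at [+ h], while the
     substitute of the added one is sought at [- h]. *)
  have [i' [_ i'A wi]] : exists i', [/\ i' \in S0, i' \in A &
      close_to e (x i') (fun j' => x i j' + axis_shift j h j')].
    apply: dense_pick => //; first exact: leq_trans tL.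
    move=> j'; rewrite addrAC; apply: le_trans (ler_normD _ _) _.
    have := Wx j'; have := axis_shift_norm j h j'; have := sg_half_le (imbalance A' j).
    by rewrite /h; lra.
  have : switch A (k |: (A :\ i')) by exists i', k.
  move=> /best; rewrite leNgt => /negP; apply.
  rewrite /potential (eq_wnorm (v := fun j' => imbalance A' j' + (x i j' - x i' j'))); last first.
    by move=> j'; rewrite A'E !imbalance_switch//; ring.
  apply: (@le_lt_trans _ _ (wnorm (imbalance A') - gain)); last by have := gain_gt0; lra.
  apply: (shift_gain sj) => j'.
  have := wi j'; rewrite distrC addrAC.
  by rewrite /h; lra.
have [k' [_ k'A wk]] : exists k', [/\ k' \in ~: S0, k' \in ~: A &
    close_to e (x k') (fun j' => x k j' - axis_shift j h j')].
  apply: dense_pick => //.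
    rewrite (_ : ~: S0 :\: ~: A = A :\: S0); first exact: leq_trans tL.
    by apply/setP => b; rewrite !inE negbK andbC.
  move=> j'; rewrite addrAC; apply: le_trans (ler_normB _ _) _.
  have := Wx j'; have := axis_shift_norm j h j'; have := sg_half_le (imbalance A' j).
  by rewrite /h; lra.
rewrite inE in k'A.
have : switch A (k' |: (A :\ i)) by exists i, k'.
move=> /best; rewrite leNgt => /negP; apply.
rewrite /potential (eq_wnorm (v := fun j' => imbalance A' j' + (x k' j' - x k j'))); last first.
  by move=> j'; rewrite A'E !imbalance_switch//; ring.
apply: (@le_lt_trans _ _ (wnorm (imbalance A') - gain)); last by have := gain_gt0; lra.
apply: (shift_gain sj) => j'.
have := wk j'.
rewrite (_ : x k' j' - _ = x k' j' - x k j' + axis_shift j h j'); last by ring.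
by rewrite /h; lra.
Qed.

(** Every switch whose outcome is still large stays out of the window by [phase1_outside]. Only the
    last one, which makes the imbalance small, can alter the window, and it alters at most two
    individuals. *)
Lemma first_phase A C t : potential S0 <= L%:R * gain -> greedy potential A C ->
  phase1_state A t ->
  exists A1, [/\ greedy potential A1 C, forall j, `|imbalance A1 j| <= eta
    & (#|altered A1| <= 2)%N].
Proof.
move=> P0 gC; elim: gC t => {A C} [A stop|A A' C bA lt gC IH] t st.
(* Each switch has used up one [gain] of a potential that started below [L] gains. *)
all: have tL : (t <= L)%N by
  have [_ _ h _] := st; have := wnorm_ge0 (imbalance A); rewrite -/(potential A) => h1;
  rewrite -(ler_nat R) -(ler_pM2r gain_gt0); lra.
all: have [_ _ _ alt0] := st.
all: have [[j sj]|small] := pselect (exists j, eta <= `|imbalance A j|); last first.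
all: try by exists A; split=> //; rewrite ?alt0 ?cards0//;
  [exact: greedy_stop || exact: greedy_step gC
  |move=> j; rewrite leNgt; apply/negP => h; apply: small; exists j; exact: ltW].
  have [A1 [sA1 le1]] := phase1_gain tL st sj.
  have [A' [bA' le']] := best_switch_exists potential sA1.
  by case: (stop A' bA'); have := gain_gt0; lra.
have [A1 [sA1 le1]] := phase1_gain tL st sj.
have le' : potential A' <= potential A1 by case: bA => _; apply.
have [big|small] := pselect (exists j, eta <= `|imbalance A' j|); last first.
  exists A'; split=> //.
    by move=> j'; rewrite leNgt; apply/negP => h; apply: small; exists j'; exact: ltW.
  have [sA' _] := bA; have := card_altered_switch sA'.
  by rewrite alt0 cards0 add0n.
have [[i [k [iA kA A'E]]] _] := bA.
have [Wi Wk] := phase1_outside tL st bA iA kA A'E big.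
have [SA AS le _] := st.
apply: (IH t.+1); split.
- apply: (@leq_trans #|i |: (S0 :\: A)|); last first.
    by rewrite cardsU1; case: (_ \notin _); rewrite ?add1n ?add0n ?ltnS// leqW.
  apply: subset_leq_card; apply/fintype.subsetP => b; rewrite A'E !inE.
  by case: (b == k); case: (b == i); case: (b \in A); case: (b \in S0).
- apply: (@leq_trans #|k |: (A :\: S0)|); last first.
    by rewrite cardsU1; case: (_ \notin _); rewrite ?add1n ?add0n ?ltnS// leqW.
  apply: subset_leq_card; apply/fintype.subsetP => b; rewrite A'E !inE.
  by case: (b == k); case: (b == i); case: (b \in A); case: (b \in S0).
- by rewrite -natr1; lra.
- apply/eqP; rewrite -finset.subset0; apply/fintype.subsetP => b bA'.
  have Wb : in_window l (x b) by move: bA'; rewrite inE => /andP[/asboolP].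
  have := fintype.subsetP (altered_switch iA kA) b; rewrite -A'E alt0 => /(_ bA').
  by rewrite !inE /= => /orP[/eqP bi|/eqP bk]; [case: Wi; rewrite -bi|case: Wk; rewrite -bk].
Qed.

End first_phase.

(** A potential of at most [K * c] bounds each coordinate by [K / wl * c], which is the size at
    which the next jump starts. The altered individuals number at most 2, 4, 6 and 8 after the first
    phase and the three jumps. *)
Theorem greedy_potential_le (eta e e1 e2 e3 rmin : R) (L : nat) C :
  0 < K -> 0 <= e1 -> 0 <= e2 -> 0 <= e3 ->
  0 < eta -> eta <= l -> 0 < e ->
  4 * (K * (2 * e)) <= wl * eta ->
  dense_points S0 e L -> dense_points (~: S0) e L ->
  potential S0 <= L%:R * (wl * eta / 4) ->
  matching_pairs eta e1 ->
  matching_pairs (K / wl * e1) e2 ->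
  matching_pairs (K / wl * e2) e3 ->
  0 < rmin ->
  (forall r, rmin <= r <= K / wl * e3 ->
     matching_pairs r (wl / (4 * (K)) * r)) ->
  isolated_pairs (3 * (K / wl * e3)) ->
  greedy potential S0 C -> potential C <= wl * rmin.
Proof.
move=> K0 e10 e20 e30 eta0 etal e0 esmall dS dC P0 m1 m2 m3 rmin0 mf iso gC.
have [|A1 [gA1 sA1 altA1]] := first_phase (t := 0) eta0 etal e0 esmall dS dC P0 gC.
  split; rewrite ?finset.setDv ?cards0//; first by rewrite mul0r addr0.
  by apply/setP => b; rewrite !inE eqxx andbF.
have [A2 [gA2 sA2 altA2]] := jump e10 m1 gA1 (leq_trans altA1 (isT : (2 <= 8)%N)) sA1.
have KE c : wl * (K / wl * c) = K * c by field; rewrite gt_eqF.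
have small A' c : potential A' <= K * c ->
    forall j, `|imbalance A' j| <= K / wl * c.
  by move=> le j; apply: potential_bound; rewrite KE.
have alt2 : (#|altered A2| <= 4)%N := leq_trans altA2 (leq_add altA1 (leqnn 2)).
have [A3 [gA3 sA3 altA3]] :=
  jump e20 m2 gA2 (leq_trans alt2 (isT : (4 <= 8)%N)) (small _ _ sA2).
have alt3 : (#|altered A3| <= 6)%N := leq_trans altA3 (leq_add alt2 (leqnn 2)).
have [A4 [gA4 sA4 altA4]] :=
  jump e30 m3 gA3 (leq_trans alt3 (isT : (6 <= 8)%N)) (small _ _ sA3).
have alt4 : (#|altered A4| <= 8)%N := leq_trans altA4 (leq_add alt3 (leqnn 2)).
(* The ratio [wl / (4 * K)] is the largest for which a matched pair is sure to divide the potential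
   by 4. *)
apply: (@final_phase A4 rmin (K / wl * e3) (wl / (4 * (K)))) gA4 _ _ => //.
- by rewrite divr_ge0 ?ltW// mulr_gt0.
- have -> : 4 * (K * (wl / (4 * K))) = wl by field; rewrite gt_eqF.
  by [].
- by rewrite KE.
Qed.

End greedy_descent.

(** * Grids and samples *)

Ltac pos_gt0 := repeat first [done | apply: addr_gt0 | apply: mulr_gt0 | apply: divr_gt0 |
  apply: exprn_gt0 | rewrite invr_gt0 | rewrite ltr0n].
Ltac pos_ge0 := repeat first [done | rewrite ler0n | by apply: ltW | apply: addr_ge0 | apply: mulr_ge0 |
  apply: divr_ge0 | apply: exprn_ge0 | rewrite invr_ge0].

Lemma leq_ninth n : (9 <= n)%N -> (n <= 18 * (n %/ 9))%N.
Proof. lia. Qed.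

Lemma leq_slice n (g : 'I_9) : (g.+1 * (n %/ 9) <= n)%N.
Proof.
apply: leq_trans (leq_trunc_div n 9); rewrite [X in (_ <= X)%N]mulnC.
by rewrite leq_mul2r ltn_ord orbT.
Qed.

(** * Disjoint slices of the two groups *)

Section groups.
Context (I : finType).

Definition slice (S : {set I}) (N g : nat) : {set I} :=
  [set i | i \in take N (drop (g * N) (enum S))].

Lemma slice_sub (S : {set I}) N g i : i \in slice S N g -> i \in S.
Proof. by rewrite inE => /mem_take/mem_drop; rewrite mem_enum. Qed.

Lemma card_slice (S : {set I}) N g : (g.+1 * N <= #|S|)%N -> #|slice S N g| = N.
Proof.
move=> h; rewrite /slice cardsE; have /card_uniqP -> : uniq (take N (drop (g * N) (enum S))).
  by rewrite take_uniq// drop_uniq// enum_uniq.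
rewrite size_takel// size_drop -cardE leq_subRL; first by rewrite addnC -mulSn.
by apply: leq_trans h; rewrite leq_mul2r leqnSn orbT.
Qed.

Lemma index_slice (S : {set I}) N g i : i \in slice S N g -> (index i (enum S) %/ N)%N = g.
Proof.
rewrite inE => iS; have := iS; move=> /(nthP i)[k]; rewrite size_take size_drop => kN.
have kN' : (k < N)%N by apply: leq_trans kN _; case: ifP => // /negbT; rewrite -leqNgt.
have ks : (g * N + k < size (enum S))%N.
  by rewrite -ltn_subRL; apply: leq_trans kN _; case: ifP => // /ltnW.
rewrite nth_take// nth_drop => <-.
by rewrite index_uniq ?enum_uniq// divnMDl ?divn_small ?addn0//; apply: leq_ltn_trans kN'.
Qed.

(** Pigeonhole: eight individuals meet at most eight of nine slices. A union bound over nine slices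
    thus handles all sets [D] at once, instead of one over the roughly n^8 possible sets. *)
Lemma untouched_slice (S : {set I}) N (D : {set I}) : (#|D| <= 8)%N ->
  exists g : 'I_9, forall i, i \in slice S N g \/ i \in slice (~: S) N g -> i \notin D.
Proof.
(* Individuals beyond the ninth slice get the default value of [inord]; this is harmless, since only
   the size of the image of [D] matters. *)
move=> D8; pose h i : 'I_9 := inord (if i \in S then index i (enum S) %/ N
  else index i (enum (~: S)) %/ N)%N.
have /subsetPn[g _ gD] : ~~ ([set: 'I_9] \subset h @: D).
  apply/negP => /subset_leq_card; rewrite cardsT card_ord leqNgt => /negP; apply.
  by apply: leq_ltn_trans (leq_imset_card _ _) _.
exists g => i iS; apply: contra gD => iD; apply/imsetP; exists i => //.
apply: val_inj; rewrite /h; case: iS => ig.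
  by rewrite (slice_sub ig) (index_slice ig) inord_val.
have := slice_sub ig; rewrite inE => /negbTE ->.
by rewrite (index_slice ig) inord_val.
Qed.

End groups.

(** * Cells of a regular grid on the line *)

Section truncation.
Context (R : realType).

Lemma grid_index (b d t : R) : 0 < d -> b <= t ->
  b + (Num.truncn ((t - b) / d))%:R * d <= t < b + (Num.truncn ((t - b) / d))%:R * d + d.
Proof.
move=> d0 bt; have h : 0 <= (t - b) / d by rewrite divr_ge0 ?subr_ge0 ?(ltW d0).
have /andP[h1 h2] := truncn_itv h.
move: h1 h2; set k := Num.truncn _; rewrite ler_pdivlMr// ltr_pdivrMr// -natr1 mulrDl mul1r => h1 h2.
by apply/andP; split; lra.
Qed.

Lemma grid_index_lt (b d t r : R) : 0 < d -> t - b <= r ->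
  (Num.truncn ((t - b) / d) < (Num.truncn (r / d)).+1)%N.
Proof.
move=> d0 tr; rewrite ltnS; apply: le_truncn.
by rewrite ler_pM2r ?invr_gt0.
Qed.

Lemma grid_size (d r : R) : 0 < d -> 0 <= r -> (Num.truncn (r / d)).+1%:R <= r / d + 1.
Proof.
move=> d0 r0; have h : 0 <= r / d by rewrite divr_ge0 ?(ltW d0).
by rewrite -natr1 lerD2r; have /andP[] := truncn_itv h.
Qed.

Lemma grid_unique (b d t : R) (k k' : nat) : 0 < d -> b + k%:R * d <= t < b + k%:R * d + d ->
  b + k'%:R * d <= t < b + k'%:R * d + d -> k = k'.
Proof.
move=> d0 /andP[h1 h2] /andP[h3 h4].
have e1 : k%:R < k'.+1%:R :> R by rewrite -(ltr_pM2r d0) -natr1; lra.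
have e2 : k'%:R < k.+1%:R :> R by rewrite -(ltr_pM2r d0) -natr1; lra.
by move: e1 e2; rewrite !ltr_nat; lia.
Qed.

End truncation.

Definition hits (I : finType) (T U : Type) (X : I -> T -> U) (S : {set I}) (D : set U) (w : T) : nat :=
  #|[set i in S | `[< D (X i w) >]]|.

(** * Comparing the sums of two groups through slab counts *)

Section slabs.
Context (R : realType) (I : finType) (z : I -> R) (h : R) (N : nat).
Hypotheses (h0 : 0 < h) (N0 : (0 < N)%N).

Let base := - (N%:R * h).

Definition in_slab (k : nat) (t : R) := base + k%:R * h <= t < base + k%:R * h + h.

(** The lower end of the slab containing [t], and 0 when [t] is in no slab. Written as a sum of
    indicators, it makes a sum of roundings a linear combination of slab counts, to which the law of
    large numbers applies. *)
Definition rounding (t : R) : R := \sum_(k < 2 * N) (base + k%:R * h) * (in_slab k t)%:R.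

(** Outside the slabs the error is [t] itself, and there [|t|] is at least [N * h], so it is at most
    [t ^+ 2 / (N * h)]. Truncation is paid with a second moment, the only moment at hand. *)
Lemma rounding_error t : `|t - rounding t| <= h + t ^+ 2 / (N%:R * h).
Proof.
have Nh : 0 < N%:R * h by rewrite mulr_gt0// ltr0n.
have q0 : 0 <= t ^+ 2 / (N%:R * h) by rewrite divr_ge0 ?sqr_ge0// ltW.
have h0' := h0.
have [[k kt]|no] := pselect (exists k : 'I_(2 * N), in_slab k t).
  have -> : rounding t = base + k%:R * h.
    rewrite /rounding (bigD1 k)//= kt mulr1 big1 ?addr0// => k' kk'.
    rewrite (_ : in_slab k' t = false) ?mulr0//; apply/negbTE; apply: contra kk' => k't.
    by apply/eqP/val_inj; exact: grid_unique h0 k't kt.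
  by move: kt => /andP[? ?]; rewrite ler_norml; apply/andP; split; lra.
have -> : rounding t = 0.
  rewrite /rounding big1// => k _; case: (boolP (in_slab k t)) => [kt|_]; last by rewrite mulr0.
  by case: no; exists k.
rewrite subr0; apply: (@le_trans _ _ (t ^+ 2 / (N%:R * h))); last by lra.
rewrite ler_pdivlMr// -[t ^+ 2]real_normK ?num_real// expr2 ler_wpM2l//.
rewrite leNgt; apply/negP; rewrite ltr_norml => /andP[t1 t2].
have bt : base <= t by rewrite /base ltW.
have kb : (Num.truncn ((t - base) / h) < 2 * N)%N.
  rewrite truncn_lt_nat; last by rewrite divr_ge0 ?(ltW h0)// subr_ge0.
  by rewrite ltr_pdivrMr// natrM /base; lra.
by apply: no; exists (Ordinal kb); exact: grid_index.
Qed.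

Lemma sum_rounding (S : {set I}) :
  \sum_(i in S) rounding (z i) =
  \sum_(k < 2 * N) (base + k%:R * h) * #|[set i in S | in_slab k (z i)]|%:R.
Proof.
rewrite /rounding exchange_big/=; apply: eq_bigr => k _.
rewrite -mulr_sumr -sum1_card natr_sum; congr (_ * _).
rewrite [RHS](eq_bigl (fun i => (i \in S) && in_slab k (z i))); last by move=> i; rewrite !inE.
rewrite [RHS]big_mkcondr/=; apply: eq_bigr => i _.
by case: (in_slab k (z i)).
Qed.

Lemma slab_imbalance (S : {set I}) (n : nat) (M t : R) : #|S| = n -> #|~: S| = n ->
  0 <= t -> \sum_i z i ^+ 2 <= M ->
  (forall k : 'I_(2 * N), `|(#|[set i in S | in_slab k (z i)]|%:R : R) -
     #|[set i in ~: S | in_slab k (z i)]|%:R| <= t) ->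
  `|\sum_(i in S) z i - \sum_(i in ~: S) z i| <=
    2 * N%:R ^+ 2 * h * t + 2 * n%:R * h + M / (N%:R * h).
Proof.
move=> Sn Cn t0 zM St.
have Nh : 0 < N%:R * h by rewrite mulr_gt0// ltr0n.
have err (S' : {set I}) : `|\sum_(i in S') z i - \sum_(i in S') rounding (z i)| <=
   \sum_(i in S') (h + z i ^+ 2 / (N%:R * h)).
  rewrite -sumrB; apply: le_trans (ler_norm_sum _ _ _) _.
  by apply: ler_sum => i _; exact: rounding_error.
have split2 (g : I -> R) : \sum_i g i = \sum_(i in S) g i + \sum_(i in ~: S) g i.
  rewrite (bigID (mem S))/=; congr (_ + _); apply: eq_bigl => i; by rewrite ?inE.
have tot : \sum_(i in S) (h + z i ^+ 2 / (N%:R * h)) +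
    \sum_(i in ~: S) (h + z i ^+ 2 / (N%:R * h)) <= 2 * n%:R * h + M / (N%:R * h).
  rewrite -split2 big_split/= -mulr_suml; apply: lerD; last first.
    by rewrite ler_pM2r ?invr_gt0.
  by rewrite split2 !sumr_const Sn Cn -[h *+ n]mulr_natl; lra.
have rnd : `|\sum_(i in S) rounding (z i) - \sum_(i in ~: S) rounding (z i)| <=
    2 * N%:R ^+ 2 * h * t.
  rewrite !sum_rounding -sumrB; apply: le_trans (ler_norm_sum _ _ _) _.
  apply: (@le_trans _ _ (\sum_(k < 2 * N) (N%:R * h) * t)); last first.
    by rewrite sumr_const card_ord -[leLHS]mulr_natl natrM; lra.
  apply: ler_sum => k _; rewrite -mulrBr normrM; apply: ler_pM => //.
  have kN : k%:R * h <= 2 * N%:R * h.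
    by rewrite ler_pM2r// -natrM ler_nat ltnW.
  have k0 : 0 <= k%:R * h by rewrite mulr_ge0// ltW.
  by rewrite /base ler_norml; apply/andP; split; lra.
have := err S; have := err (~: S); move: tot rnd.
set a := \sum_(i in S) z i; set b := \sum_(i in ~: S) z i.
set a' := \sum_(i in S) rounding _; set b' := \sum_(i in ~: S) rounding _.
set c := \sum_(i in S) _; set d := \sum_(i in ~: S) _ => tot rnd e1 e2.
have -> : a - b = (a - a') - (b - b') + (a' - b') by ring.
apply: le_trans (ler_normD _ _) _; have := ler_normB (a - a') (b - b'); lra.
Qed.

End slabs.

(** * Sample means and sample standard deviations *)

Section sample.
Context (R : realType) (m p : nat) (x : 'I_m -> p.-tuple R).

(** Both groups have [n] members, so any constant may replace the random sample mean. With a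
    deterministic [c] the summands become independent. *)
Lemma imbalance_half (S : {set 'I_m}) (n : nat) (c : R) j : m = (2 * n)%N -> (0 < n)%N ->
  #|S| = n -> #|~: S| = n ->
  imbalance (fun i j => tnth (x i) j) (sample_mean x) S j =
  (\sum_(i in S) (tnth (x i) j - c) - \sum_(i in ~: S) (tnth (x i) j - c)) / 2.
Proof.
move=> mE n0 Sn Cn; rewrite /imbalance /sample_mean !sumrB !sumr_const Sn Cn.
have -> : \sum_i tnth (x i) j = \sum_(i in S) tnth (x i) j + \sum_(i in ~: S) tnth (x i) j.
  by rewrite (bigID (mem S))/=; congr (_ + _); apply: eq_bigl => i; rewrite ?inE.
have nR : n%:R != 0 :> R by rewrite pnatr_eq0 -lt0n.
have mR : m%:R = 2 * n%:R :> R by rewrite mE natrM.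
rewrite mR; move: (\sum_(i in S) _) (\sum_(i in ~: S) _) => A B.
rewrite -[_ / _ *+ n]mulr_natl -[c *+ n]mulr_natl; field.
by rewrite nR.
Qed.

Definition sum_dev (c : R) j := \sum_i (tnth (x i) j - c) ^+ 2.

Lemma sum_dev_mean_le c j : (0 < m)%N -> sum_dev (sample_mean x j) j <= sum_dev c j.
Proof.
move=> m0; set u := sample_mean x j.
have mR : m%:R != 0 :> R by rewrite pnatr_eq0 -lt0n.
have s0 : \sum_i (tnth (x i) j - u) = 0.
  by rewrite sumrB sumr_const card_ord /u /sample_mean -[_ / _ *+ m]mulr_natr divfK ?subrr.
have -> : sum_dev c j = sum_dev u j + m%:R * (u - c) ^+ 2.
  rewrite /sum_dev (eq_bigr (fun i => (tnth (x i) j - u) ^+ 2 +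
     (2 * (u - c) * (tnth (x i) j - u) + (u - c) ^+ 2))); last by move=> i _; ring.
  by rewrite !big_split/= -mulr_sumr s0 mulr0 add0r sumr_const card_ord mulr_natl.
by rewrite lerDl mulr_ge0 ?sqr_ge0.
Qed.

Lemma sample_sd_le (n : nat) (M c : R) j : m = (2 * n)%N -> (0 < n)%N -> 0 <= M ->
  sum_dev c j <= M * n%:R -> sample_sd x j <= Num.sqrt M.
Proof.
move=> mE n0 M0 cM; rewrite /sample_sd ler_sqrt//.
have m1 : (n <= m.-1)%N by rewrite mE; lia.
have m1R : 0 < m.-1%:R :> R by rewrite ltr0n (leq_trans n0).
rewrite ler_pdivrMr//; apply: le_trans (le_trans (sum_dev_mean_le c j _) cM) _.
  by rewrite mE muln_gt0.
by rewrite ler_wpM2l// ler_nat.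
Qed.

(** There are clusters near [a j - l] and near [a j + l], and one of them is at distance at least
    [l / 2] from the mean. It has at least [k * n] members, and dividing [k * n * (l / 2) ^+ 2] by
    at most [2 * n] gives [k * l ^+ 2 / 8]. *)
Lemma sample_sd_ge (n : nat) (S : {set 'I_m}) (a : 'I_p -> R) (l k : R) (L : nat) j :
  m = (2 * n)%N -> (0 < n)%N -> 0 < l -> 0 <= k -> k * n%:R <= L.+1%:R ->
  dense_points (fun i j => tnth (x i) j) a l S (l / 2) L ->
  Num.sqrt (k * l ^+ 2 / 8) <= sample_sd x j.
Proof.
move=> mE n0 l0 k0 kL dS; set u := sample_mean x j.
have m0 : (0 < m)%N by rewrite mE muln_gt0.
have m1R : 0 < m.-1%:R :> R by rewrite ltr0n mE; lia.
have key (s : R) : `|s| = l -> (forall t, `|t - (a j + s)| <= l / 2 -> l / 2 <= `|t - u|) ->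
    k * n%:R * (l / 2) ^+ 2 <= sum_dev u j.
  move=> sl faru; have /dS card : in_window a (2 * l) (fun j => a j + s).
    by move=> j'; rewrite addrAC subrr add0r sl; lra.
  set A := [set i in S | _] in card.
  apply: (@le_trans _ _ (\sum_(i in A) (l / 2) ^+ 2)).
    rewrite sumr_const -[leRHS]mulr_natl ler_wpM2r ?sqr_ge0//.
    by apply: le_trans kL _; rewrite ler_nat.
  rewrite /sum_dev [leRHS](bigID (mem A))/= -[leLHS]addr0; apply: lerD; last first.
    by apply: sumr_ge0 => i _; exact: sqr_ge0.
  apply: ler_sum => i; rewrite inE => /andP[_ /asboolP xi].
  rewrite -[leRHS]real_normK ?num_real// lerXn2r ?nnegrE//; last exact: faru (xi j).
  by rewrite divr_ge0// ltW.
have dev : k * n%:R * (l / 2) ^+ 2 <= sum_dev u j.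
  have [ua|au] := leP u (a j).
    apply: (key l) => [|t]; first by rewrite ger0_norm// ltW.
    by rewrite ler_norml => /andP[? _]; rewrite ger0_norm; lra.
  apply: (key (- l)) => [|t]; first by rewrite normrN ger0_norm// ltW.
  by rewrite ler_norml => /andP[_ ?]; rewrite ler0_norm; lra.
rewrite /sample_sd ler_sqrt; last first.
  by rewrite divr_ge0// ?(ltW m1R)//; apply: sumr_ge0 => i _; exact: sqr_ge0.
rewrite ler_pdivlMr//; apply: le_trans dev.
have mn : m.-1%:R <= 2 * n%:R :> R by rewrite -natrM -mE ler_nat leq_pred.
have : k * l ^+ 2 / 8 * m.-1%:R <= k * l ^+ 2 / 8 * (2 * n%:R).
  by rewrite ler_wpM2l// divr_ge0// mulr_ge0// sqr_ge0.
lra.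
Qed.

End sample.

(** The exponents left over when the size of a covering is multiplied by each of the two terms of
    the miss probability; the hypotheses say exactly that both stay positive. *)
Lemma jump_exponents a b : (a <= b)%N -> (2 * b + 1 <= 16 + a)%N -> (b <= a + 7)%N ->
  [/\ (16 + a - 2 * b + (b - a) + b = 16)%N, (8 + a - b + (b - a) = 8)%N,
      (0 < 16 + a - 2 * b)%N & (0 < 8 + a - b)%N].
Proof. by move=> h1 h2 h3; split; lia. Qed.

(* [u] stands for n^(-1/(8p)). With mesh [u ^+ b], a given difference vector is
   realized by about n^2 u^(bp) = u^(-(16 - b)p) pairs, and a region of size
   [u ^+ a] contains u^(-(b - a)p) vectors of the mesh; the jumps from a = 0, 7, 11
   to b = 7, 11, 13 keep the probability of a miss below O(u), and b = 16 is the
   size of the final imbalance. *)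
Section scales.
Context (R : realType) (p n : nat) (u : R).
Hypotheses (p0 : (0 < p)%N) (u0 : 0 < u) (u1 : u <= 1) (nu : n%:R * u ^+ (8 * p) = 1).

Let v := u ^+ p.

Let v0 : 0 < v. Proof. exact: exprn_gt0. Qed.

Let v_le : v <= u.
Proof. by rewrite /v -[leRHS]expr1; apply: ler_wiXn2l => //; exact: ltW. Qed.

Let vk k : (0 < k)%N -> v ^+ k <= u.
Proof.
move=> k0; apply: le_trans v_le; rewrite -[leRHS]expr1; apply: ler_wiXn2l => //; first exact: ltW.
exact: le_trans v_le u1.
Qed.

Let nE : n%:R = (v ^+ 8)^-1.
Proof.
have v8 : v ^+ 8 != 0 by rewrite expf_neq0// gt_eqF.
by apply: (mulIf v8); rewrite mulVf// /v -exprM mulnC.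
Qed.

Let vE k : (u ^+ k) ^+ p = v ^+ k.
Proof. by rewrite /v -!exprM mulnC. Qed.

Lemma scale_inv : n%:R^-1 <= u.
Proof. by rewrite nE invrK vk. Qed.

(** The number of mesh vectors is absorbed by both terms of the miss probability with a factor [u]
    to spare. The mesh is [u ^+ b / 2] because cells of side [h] only match a vector up to
    [2 * h]. *)
Lemma scale_jump (a b : nat) (rho C : R) : 0 <= rho -> 0 <= C ->
  (a <= b)%N -> (2 * b + 1 <= 16 + a)%N -> (b <= a + 7)%N ->
  (2 * (rho * u ^+ a) / (u ^+ b / 2) + 1) ^+ p *
    (C * ((n%:R ^+ 2 * (u ^+ b / 2) ^+ p)^-1 + n%:R^-1)) <=
  (4 * rho + 1) ^+ p * (C * (2 ^+ p + 1)) * u.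
Proof.
move=> rho0 C0 ab b16 b7; have [ex1 ex2 ex3 ex4] := jump_exponents ab b16 b7.
have ub : 0 < u ^+ b by exact: exprn_gt0.
have uba : 0 < u ^+ (b - a) by exact: exprn_gt0.
have uba1 : u ^+ (b - a) <= 1 by apply: exprn_ile1 => //; exact: ltW.
have ub_split : u ^+ b = u ^+ (b - a) * u ^+ a by rewrite -exprD subnK.
have ua : 0 < u ^+ a by exact: exprn_gt0.
have E1 : 2 * (rho * u ^+ a) / (u ^+ b / 2) + 1 <= (4 * rho + 1) / u ^+ (b - a).
  have -> : 2 * (rho * u ^+ a) / (u ^+ b / 2) + 1 = (4 * rho + u ^+ (b - a)) / u ^+ (b - a).
    by rewrite ub_split; field; rewrite !gt_eqF.
  by rewrite ler_pM2r ?invr_gt0// lerD2l.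
have E1p : (2 * (rho * u ^+ a) / (u ^+ b / 2) + 1) ^+ p <= (4 * rho + 1) ^+ p / v ^+ (b - a).
  rewrite -vE -expr_div_n lerXn2r ?nnegrE//.
    by rewrite addr_ge0// divr_ge0 ?mulr_ge0 ?divr_ge0 ?(ltW ub) ?(ltW ua).
  by rewrite divr_ge0 ?addr_ge0 ?mulr_ge0 ?(ltW uba).
have vba : 0 < v ^+ (b - a) by exact: exprn_gt0.
have E2 : (n%:R ^+ 2 * (u ^+ b / 2) ^+ p)^-1 + n%:R^-1 <= (2 ^+ p + 1) * u * v ^+ (b - a).
  have vb : 0 < v ^+ b by exact: exprn_gt0.
  rewrite nE invrK expr_div_n vE.
  have -> : ((v ^+ 8)^-1 ^+ 2 * (v ^+ b / 2 ^+ p))^-1 = 2 ^+ p * (v ^+ 16 / v ^+ b).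
    have -> : v ^+ 16 = v ^+ 8 * v ^+ 8 by rewrite -exprD.
    have : 0 < v ^+ 8 by exact: exprn_gt0.
    have : 0 < 2 ^+ p :> R by exact: exprn_gt0.
    move: vb; move: (v ^+ b) (v ^+ 8) (2 ^+ p) => x y z x0 z0 y0.
    by field; rewrite !gt_eqF.
  have -> : v ^+ 16 / v ^+ b = v ^+ (16 + a - 2 * b) * v ^+ (b - a).
    rewrite -exprD; apply: (mulIf (lt0r_neq0 vb)); rewrite divfK ?gt_eqF//.
    by rewrite -exprD ex1.
  have -> : v ^+ 8 = v ^+ (8 + a - b) * v ^+ (b - a).
    by rewrite -exprD ex2.
  rewrite mulrA -mulrDl ler_pM2r// mulrDl mul1r; apply: lerD.
    by rewrite ler_wpM2l ?exprn_ge0// vk.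
  exact: vk.
have E0 : 0 <= (4 * rho + 1) ^+ p / v ^+ (b - a).
  by rewrite divr_ge0 ?(ltW vba)// exprn_ge0// addr_ge0// mulr_ge0.
apply: (@le_trans _ _ ((4 * rho + 1) ^+ p / v ^+ (b - a) * (C * ((2 ^+ p + 1) * u * v ^+ (b - a))))).
  apply: ler_pM => //.
  - by rewrite exprn_ge0// addr_ge0// divr_ge0 ?mulr_ge0 ?divr_ge0 ?(ltW ub) ?(ltW ua).
  - rewrite mulr_ge0// addr_ge0// invr_ge0// mulr_ge0 ?sqr_ge0// exprn_ge0// divr_ge0 ?(ltW ub)//.
  - by rewrite ler_wpM2l.
by rewrite le_eqVlt; apply/orP; left; apply/eqP; field; rewrite gt_eqF.
Qed.

(** About r^(-p) cells, n^3 triples and probability r^(3p) for each, with r of order u^13, give n^3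
    r^(2p) = u^((26 - 24) p). *)
Lemma scale_isolated (rho l F : R) : 0 < rho -> 0 < l -> 0 < F -> rho * u ^+ 13 <= l ->
  (2 * l / (rho * u ^+ 13) + 1) ^+ p * (2 * n)%:R ^+ 3 * (F * (3 * (rho * u ^+ 13)) ^+ p) ^+ 3 <=
  8 * F ^+ 3 * (81 * l * rho ^+ 2) ^+ p * u.
Proof.
move=> rho0 l0 F0 rl; pose r := rho * u ^+ 13; rewrite -/r.
have r0 : 0 < r by rewrite mulr_gt0// exprn_gt0.
have E1 : 2 * l / r + 1 <= 3 * l / r.
  by rewrite -[X in _ + X](divff (lt0r_neq0 r0)) -mulrDl ler_pM2r ?invr_gt0//; rewrite -/r in rl; lra.
have E1p : (2 * l / r + 1) ^+ p <= (3 * l / r) ^+ p.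
  have q0 : 0 <= 2 * l / r + 1 by rewrite addr_ge0// divr_ge0 ?(ltW r0)// mulr_ge0// ltW.
  by rewrite lerXn2r// nnegrE// (le_trans q0).
have F3 : 0 <= (F * (3 * r) ^+ p) ^+ 3.
  by rewrite exprn_ge0// mulr_ge0 ?(ltW F0)// exprn_ge0//; exact: (mulr_ge0 (ler0n _ 3) (ltW r0)).
have n3 : 0 <= (2 * n)%:R ^+ 3 :> R by exact: exprn_ge0.
apply: (@le_trans _ _ ((3 * l / r) ^+ p * (2 * n)%:R ^+ 3 * (F * (3 * r) ^+ p) ^+ 3)).
  by apply: ler_wpM2r => //; apply: ler_wpM2r.
have rp0 : 0 < r ^+ p by exact: exprn_gt0.
have rE : r ^+ p = rho ^+ p * v ^+ 13 by rewrite /r exprMn vE.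
clearbody r.
rewrite natrM nE expr_div_n !exprMn.
(* One factor [3 ^+ p] comes from the number of cells and three come from the enlarged boxes. *)
have e81 : 81 ^+ p = (3 ^+ p) ^+ 4 :> R.
  by rewrite -exprM mulnC exprM; congr (_ ^+ _); ring.
apply: (@le_trans _ _ (8 * F ^+ 3 * (81 ^+ p * l ^+ p * (rho ^+ p * rho ^+ p)) * v ^+ 2)).
  rewrite rE e81; have := exprn_gt0 p rho0; move: v0.
  move: (rho ^+ p) (l ^+ p) (3 ^+ p) v => x y z t t0 x0.
  rewrite le_eqVlt; apply/orP; left; apply/eqP; field.
  by rewrite !gt_eqF.
apply: ler_wpM2l; last exact: vk.
apply: mulr_ge0; first by rewrite mulr_ge0// exprn_ge0// ltW.
by rewrite !mulr_ge0// exprn_ge0// ltW.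
Qed.

Lemma scale_level (Lam g Mf C : R) (k : nat) : 0 < g -> 4 * (g * Lam) = 1 -> 0 < Mf -> 2 <= g * Mf -> 0 <= C ->
  Mf * u ^+ 16 * 2 ^+ k <= Lam * u ^+ 13 ->
  let r := Mf * u ^+ 16 * 2 ^+ k.+1 in let h := g * (Mf * u ^+ 16 * 2 ^+ k) / 2 in
  (2 * r / h + 1) ^+ p * (C * ((n%:R ^+ 2 * h ^+ p)^-1 + n%:R^-1)) <=
  (8 / g + 1) ^+ p * C * (4 / (g * Mf)) * 2^-1 ^+ k.
Proof.
move=> g0 gL Mf0 gM C0 rk /=; set rk0 := Mf * u ^+ 16 * 2 ^+ k.
have u16 : 0 < u ^+ 16 by exact: exprn_gt0.
have t0 : 0 < 2 ^+ k :> R by exact: exprn_gt0.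
have rk00 : 0 < rk0 by rewrite !mulr_gt0.
have -> : 2 * (Mf * u ^+ 16 * 2 ^+ k.+1) / (g * rk0 / 2) + 1 = 8 / g + 1.
  rewrite (exprS 2 k) /rk0; move: u16 t0; move: (u ^+ 16) (2 ^+ k) => x y x0 y0.
  by field; rewrite !gt_eqF.
set h := g * rk0 / 2.
have h0 : 0 < h by rewrite divr_gt0// mulr_gt0.
have u13 : 0 < u ^+ 13 by exact: exprn_gt0.
have hu : h <= u ^+ 8.
  apply: (@le_trans _ _ (u ^+ 13)).
    rewrite /h; have : g * rk0 <= g * (Lam * u ^+ 13) by rewrite ler_pM2l.
    have -> : g * (Lam * u ^+ 13) = 4 * (g * Lam) * u ^+ 13 / 4 by field.
    by rewrite gL; lra.
  by apply: ler_wiXn2l => //; exact: ltW.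
have hp : h ^+ p <= v ^+ 8 by rewrite -vE lerXn2r ?nnegrE ?(ltW h0) ?exprn_ge0 ?(ltW u0).
have hp0 : 0 < h ^+ p by exact: exprn_gt0.
have n0 : 0 < n%:R :> R by rewrite nE invr_gt0 exprn_gt0.
have E1 : (n%:R ^+ 2 * h ^+ p)^-1 + n%:R^-1 <= 2 * (n%:R ^+ 2 * h ^+ p)^-1.
  have : n%:R^-1 <= (n%:R ^+ 2 * h ^+ p)^-1.
    rewrite lef_pV2 ?posrE ?mulr_gt0 ?exprn_gt0// expr2 -mulrA ler_piMr ?(ltW n0)//.
    by rewrite nE mulrC ler_pdivrMr ?exprn_gt0// mul1r.
  lra.
have E2 : (n%:R ^+ 2 * h ^+ p)^-1 <= 2 / (g * Mf) * 2^-1 ^+ k.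
  have -> : n%:R ^+ 2 * h ^+ p = (g * Mf / 2 * 2 ^+ k) ^+ p.
    have -> : h = (g * Mf / 2 * 2 ^+ k) * u ^+ 16.
      by rewrite /h /rk0; move: (u ^+ 16) (2 ^+ k) => x y; field.
    rewrite exprMn vE nE -[v ^+ 16]/(v ^+ (8 * 2)) exprM; field.
    by rewrite expf_neq0// gt_eqF.
  have -> : 2 / (g * Mf) * 2^-1 ^+ k = (g * Mf / 2 * 2 ^+ k)^-1.
    by rewrite exprVn; move: t0; move: (2 ^+ k) => y y0; field; rewrite !gt_eqF.
  have t1 : 1 <= 2 ^+ k :> R by apply: exprn_ege1; lra.
  have b1 : 1 <= g * Mf / 2 * 2 ^+ k by rewrite mulr_ege1//; lra.
  rewrite lef_pV2 ?posrE ?exprn_gt0 ?(lt_le_trans _ b1)//.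
  by rewrite -[leLHS]expr1; apply: ler_weXn2l.
have G0 : 0 <= (8 / g + 1) ^+ p by rewrite exprn_ge0// addr_ge0// divr_ge0// ltW.
have -> : (8 / g + 1) ^+ p * C * (4 / (g * Mf)) * 2^-1 ^+ k =
    (8 / g + 1) ^+ p * (C * (2 * (2 / (g * Mf) * 2^-1 ^+ k))).
  by move: ((8 / g + 1) ^+ p) (2^-1 ^+ k) (g * Mf)^-1 => x y z; ring.
apply: ler_wpM2l => //; apply: ler_wpM2l => //.
by apply: le_trans E1 _; rewrite ler_pM2l.
Qed.

Lemma half_sum (N : nat) : \sum_(k < N) 2^-1 ^+ k <= 2 :> R.
Proof.
suff -> : \sum_(k < N) 2^-1 ^+ k = 2 - 2 * 2^-1 ^+ N :> R.
  by rewrite lerBlDr lerDl mulr_ge0// exprn_ge0// invr_ge0.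
elim: N => [|N IH]; first by rewrite big_ord0 expr0 mulr1 subrr.
by rewrite big_ord_recr/= IH exprS; field.
Qed.

(** The bound on [k] is crude: it only makes the family of shells finite, their failure
    probabilities being summable anyway. *)
Lemma dyadic (r0 r : R) : 0 < r0 -> r0 <= r ->
  exists2 k : nat, (k < (Num.truncn (r / r0)).+1)%N & r0 * 2 ^+ k <= r < r0 * 2 ^+ k.+1.
Proof.
move=> r00 r0r.
have q1 : 1 <= r / r0 by rewrite ler_pdivlMr// mul1r.
have q0 : 0 <= r / r0 by apply: le_trans q1.
pose t := Num.truncn (r / r0).
have t0 : (0 < t)%N by rewrite truncn_gt0.
have /andP[t1 t2] := truncn_itv q0.
pose k := trunc_log 2 t.
have /andP[k1 k2] := trunc_log_bounds (isT : (1 < 2)%N) t0.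
exists k; first by rewrite ltnS; apply: leq_trans k1; rewrite -/k ltnW// ltn_expl.
apply/andP; split.
  rewrite mulrC -ler_pdivlMr//; apply: le_trans t1; by rewrite -natrX ler_nat.
rewrite mulrC -ltr_pdivrMr//; apply: lt_le_trans t2 _; by rewrite -natrX ler_nat.
Qed.

End scales.

(** * From the potential to the balance *)

Section balance_bound.
Context (R : realType) (n p : nat) (x : 'I_(2 * n) -> p.-tuple R).

Lemma balance_potential (S : {set 'I_(2 * n)}) : (forall j, 0 < sample_sd x j) ->
  balance x S = 2 / n%:R *
    potential (fun i j => tnth (x i) j) (sample_mean x) (fun j => (sample_sd x j)^-1) S.
Proof.
move=> sd0; rewrite /balance /potential /wnorm; congr (_ * _); apply: eq_bigr => j _.
rewrite /standardized /imbalance -mulr_suml normrM mulrC; congr (_ * _).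
by rewrite ger0_norm// invr_ge0 ltW.
Qed.

(** The second moments bound the sample standard deviations by [Num.sqrt M] and the clusters bound
    them below by [s], which gives the weight bounds [wl] and [K]. *)
Lemma greedy_balance_le (a c : 'I_p -> R) (l M k s : R) (S C : {set 'I_(2 * n)}) (L1 L : nat)
    (eta e theta e1 e2 e3 rmin : R) :
  let X i j := tnth (x i) j in
  let wl := (Num.sqrt M)^-1 in
  let K := p%:R / s in
  (0 < p)%N -> (0 < n)%N -> #|S| = n -> 0 < l -> 0 < M -> 0 < k ->
  s = Num.sqrt (k * l ^+ 2 / 8) ->
  (forall j, sum_dev x (c j) j <= M * n%:R) ->
  dense_points X a l S (l / 2) L1 -> k * n%:R <= L1.+1%:R ->
  (forall j, `|imbalance X (sample_mean x) S j| <= theta * n%:R) ->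
  0 <= theta -> K * (theta * n%:R) <= L%:R * (wl * eta / 4) ->
  0 <= e1 -> 0 <= e2 -> 0 <= e3 ->
  0 < eta -> eta <= l -> 0 < e ->
  4 * (K * (2 * e)) <= wl * eta ->
  dense_points X a l S e L -> dense_points X a l (~: S) e L ->
  matching_pairs X a l S eta e1 ->
  matching_pairs X a l S (K / wl * e1) e2 ->
  matching_pairs X a l S (K / wl * e2) e3 ->
  0 < rmin ->
  (forall r, rmin <= r <= K / wl * e3 ->
     matching_pairs X a l S r (wl / (4 * K) * r)) ->
  isolated_pairs X a l (3 * (K / wl * e3)) ->
  greedy (balance x) S C -> balance x C <= 2 / n%:R * (wl * rmin).
Proof.
move=> X wl K p0 n0 Sn l0 M0 k0 sE dev d1 kL imb th0 KL e10 e20 e30 eta0 etal e0 Ke dS dC m1 m2 m3 rm0 mr iso gC.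
have s0 : 0 < s.
  by rewrite sE sqrtr_gt0 divr_gt0// mulr_gt0// exprn_gt0.
have sd_ge j : s <= sample_sd x j.
  by rewrite sE; apply: (sample_sd_ge j erefl n0 l0 (ltW k0) kL d1).
have sd_le j : sample_sd x j <= Num.sqrt M.
  exact: (sample_sd_le erefl n0 (ltW M0) (dev j)).
have sd0 j : 0 < sample_sd x j by apply: lt_le_trans (sd_ge j).
have M0' : 0 < Num.sqrt M by rewrite sqrtr_gt0.
have wl0 : 0 < wl by rewrite invr_gt0.
have K0 : 0 < K by rewrite divr_gt0// ltr0n.
have w_ge j : wl <= (sample_sd x j)^-1 by rewrite lef_pV2 ?posrE.
have w_sum : \sum_j (sample_sd x j)^-1 <= K.
  apply: (@le_trans _ _ (\sum_(j < p) s^-1)).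
    by apply: ler_sum => j _; rewrite lef_pV2 ?posrE.
  by rewrite sumr_const card_ord /K mulr_natl.
have n2 : 0 < 2 / n%:R :> R by rewrite divr_gt0// ltr0n.
rewrite balance_potential// ler_pM2l//.
apply: (greedy_potential_le wl0 w_ge w_sum K0 e10 e20 e30 eta0 etal e0 Ke dS dC _ m1 m2 m3 rm0 mr iso).
  apply: le_trans KL; apply: (wnorm_le wl0 w_ge w_sum); last exact: imb.
  by rewrite mulr_ge0.
by apply: (greedy_scale n2 _ gC) => D; rewrite balance_potential.
Qed.

End balance_bound.

Local Open Scope classical_set_scope.

(** * Events and boxes *)

Section algebra_of_sets.
Context (T : Type).

(** Needed for two instances: the measurable sets, and the sigma-algebra generated by the
    covariates, to which bad events must belong in order to be independent of the initial
    allocation. Finite operations suffice for both. *)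
Definition algebra_of_sets (G : set (set T)) := [/\ G set0,
  forall A, G A -> G (~` A) & forall A B, G A -> G B -> G (A `|` B)].

Variables (G : set (set T)) (aG : algebra_of_sets G).

Lemma algebraT : G setT.
Proof. by case: aG => G0 GC _; rewrite -setC0; exact: GC. Qed.

Lemma algebraI A B : G A -> G B -> G (A `&` B).
Proof. by case: aG => _ GC GU GA GB; rewrite -(setCK (A `&` B)) setCI; apply/GC/GU; exact: GC. Qed.

Lemma algebra_cst (Q : Prop) : G [set _ | Q].
Proof.
have [q|q] := pselect Q.
  by rewrite (_ : [set _ | Q] = setT); [exact: algebraT|apply/seteqP; split].
rewrite (_ : [set _ | Q] = set0); last by apply/seteqP; split.
by case: aG.
Qed.

Lemma algebra_imply (Q : Prop) A : G A -> G [set w | Q -> A w].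
Proof.
move=> GA; have [q|q] := pselect Q.
  rewrite (_ : [set w | Q -> A w] = A)//.
  apply/seteqP; split => w /=; last by [].
  by apply.
rewrite (_ : [set w | Q -> A w] = setT); first exact: algebraT.
by apply/seteqP; split => // w _ /= /q.
Qed.

Lemma algebra_exists (F : finType) (A : F -> set T) :
  (forall i, G (A i)) -> G [set w | exists i, A i w].
Proof.
case: aG => G0 GC GU GA.
rewrite (_ : [set w | _] = \big[setU/set0]_(i <- enum F) A i).
  by elim/big_ind : _.
apply/seteqP; split => w.
  move=> [i Ai]; have : i \in enum F by rewrite mem_enum.
  elim: (enum F) => // b s IH; rewrite in_cons big_cons => /orP[/eqP <-|/IH]; by [left|right].
elim: (enum F) => [|b s IH]; first by rewrite big_nil.
by rewrite big_cons => -[Ab|/IH//]; exists b.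
Qed.

Lemma algebra_forall (F : finType) (A : F -> set T) :
  (forall i, G (A i)) -> G [set w | forall i, A i w].
Proof.
case: aG => G0 GC GU GA.
rewrite (_ : [set w | _] = ~` [set w | exists i, (~` A i) w]).
  by apply/GC/algebra_exists => i; exact: GC.
apply/seteqP; split => w /=; first by move=> h [i]; apply; exact: h.
by move=> h i; apply: contrapT => Ai; apply: h; exists i.
Qed.

(** A property of which events occur is a finite union of atoms. This covers all statements about
    counts. *)
Lemma algebra_boolean (J : finType) (E : J -> set T) (Q : {ffun J -> bool} -> Prop) :
  (forall a, G (E a)) -> G [set w | Q [ffun a => `[< E a w >]]].
Proof.
move=> GE; have [G0 GC GU] := aG.
have GEb a b : G [set w | `[< E a w >] = b].
  case: b.
    by rewrite (_ : [set w | _] = E a)//; apply/seteqP; split => w /asboolP.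
  rewrite (_ : [set w | _] = ~` E a); first exact: GC.
  by apply/seteqP; split => w; [move=> /asboolPn|move=> h; apply/asboolPn].
rewrite (_ : [set w | _] = [set w | exists c : {ffun J -> bool},
    ([set _ | Q c] `&` [set w | forall a, `[< E a w >] = c a]) w]).
  apply: algebra_exists => c; apply: algebraI; first exact: algebra_cst.
  by apply: algebra_forall => a; exact: GEb.
apply/seteqP; split => w; first by exists [ffun a => `[< E a w >]]; split => // a; rewrite ffunE.
by move=> [c [Qc cw]] /=; rewrite (_ : [ffun a => _] = c)//; apply/ffunP => a; rewrite ffunE.
Qed.

End algebra_of_sets.

Lemma algebra_measurable d (T : measurableType d) : algebra_of_sets (@measurable d T).
Proof. by split => [|A|A B]; [exact: measurable0|exact: measurableC|exact: measurableU]. Qed.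

Lemma algebra_g_sigma_preimage d (rT : semiRingOfSetsType d) (aT : Type)
    (n : nat) (f : 'I_n -> aT -> rT) : algebra_of_sets (g_sigma_preimage f).
Proof.
split => [|A mA|A B mA mB].
- exact: sigma_algebra0.
- rewrite -setTD; exact: sigma_algebraCD.
- rewrite -bigcup2E; apply: sigma_algebra_bigcup => -[//|[//|i]] /=; exact: sigma_algebra0.
Qed.

Lemma g_sigma_preimage_preimage d (rT : semiRingOfSetsType d) (aT : Type)
    (n : nat) (f : 'I_n -> aT -> rT) i A : measurable A -> g_sigma_preimage f (f i @^-1` A).
Proof.
move=> mA; apply: sub_sigma_algebra; rewrite (bigD1 i)//=; left; exists A => //.
by rewrite setTI.
Qed.

(** * Boxes, their Lebesgue measure and their probability *)

Section boxes.
Context (R : realType).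

Definition box p (y : 'I_p -> R) (h : R) : set (p.-tuple R) :=
  [set t | forall j, y j <= tnth t j < y j + h].

Lemma measurable_tnth_itv p (j : 'I_p) (i : interval R) :
  measurable [set t : p.-tuple R | tnth t j \in i].
Proof.
rewrite -[X in measurable X]setTI.
exact: (@measurable_tnth _ R p j measurableT [set` i]).
Qed.

Lemma measurable_box p (y : 'I_p -> R) h : measurable (box y h).
Proof.
apply: (algebra_forall (algebra_measurable _)) => j.
have := @measurable_tnth_itv p j `[y j, y j + h[%R.
congr measurable; apply/seteqP; split => t /=; rewrite in_itv//=.
Qed.

Lemma lebesgue_tuple_box p (y : 'I_p -> R) h : 0 <= h ->
  lebesgue_tuple R p (box y h) = (h ^+ p)%:E.
Proof.
move=> h0; elim: p y => [|p IH] y.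
  rewrite /= expr0 diracE (_ : _ \in _ = true)//.
  by apply/mem_set => -[].
rewrite /= /lebesgue_tuple_succ /pushforward.
rewrite (_ : _ @^-1` _ = `[y ord0, y ord0 + h[ `*` box (fun j => y (lift ord0 j)) h); last first.
  apply/seteqP; split => -[r t] /=.
    move=> yt; split; first by have := yt ord0; rewrite in_itv/= tnth0.
    by move=> j; have := yt (lift ord0 j); rewrite tnthS.
  rewrite in_itv/= => -[y0 yt] j; have [->|[j' ->]] : j = ord0 \/ exists j', j = lift ord0 j'.
    by case: (unliftP ord0 j) => [j' ->|->]; [right; exists j'|left].
  - by rewrite tnth0.
  - by rewrite tnthS; exact: yt.
rewrite product_measure1E//; last exact: measurable_box.
have L : @lebesgue_measure R `[y ord0, y ord0 + h[ = h%:E.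
  rewrite lebesgue_measure_itv/= lte_fin; case: ifPn => [_|].
    by rewrite -EFinD addrAC subrr add0r.
  by rewrite -leNgt => yh; have -> : h = 0 by lra.
by rewrite IH exprS EFinM; congr (_ * _)%E; exact: L.
Qed.

(** The integral of a nonnegative function is a supremum over the simple functions below it, and
    this supremum is monotone. It lets the density, read on tuples through [\row_j], be compared
    directly with constants. *)
Lemma ge0_le_integral_nomeas d (T : measurableType d) (mu : {measure set T -> \bar R})
  (D : set T) (f1 f2 : T -> \bar R) :
  (forall x, D x -> 0 <= f1 x)%E -> (forall x, D x -> f1 x <= f2 x)%E ->
  (\int[mu]_(x in D) f1 x <= \int[mu]_(x in D) f2 x)%E.
Proof.
move=> f10 f12.
have f20 x : D x -> (0 <= f2 x)%E by move=> Dx; apply: le_trans (f12 _ Dx); exact: f10.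
rewrite !ge0_integralE//; apply: ereal_sup_le.
move=> _ [h /= hf <-]; exists h => //= x.
apply: le_trans (hf x) _; rewrite /patch; case: ifPn => // xD.
by apply: f12; exact: set_mem.
Qed.

Lemma box_prob d (T : measurableType d) (P : probability T R) p (X : T -> p.-tuple R)
    (f : 'rV[R]_p -> R) (y : 'I_p -> R) (h c0 F : R) :
  has_joint_density P X f -> 0 <= h -> 0 <= c0 ->
  (forall t, box y h t -> c0 <= f (\row_j tnth t j) <= F) ->
  c0 * h ^+ p <= fine (P (X @^-1` box y h)) <= F * h ^+ p.
Proof.
move=> Xf h0 c00 cf; rewrite Xf; last exact: measurable_box.
have E (c : R) : (\int[lebesgue_tuple R p]_(t in box y h) (cst c%:E) t)%E = (c * h ^+ p)%:E.
  rewrite integral_cst; last exact: measurable_box.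
  by rewrite EFinM -(@lebesgue_tuple_box _ y).
have F0 : (0 <= \int[lebesgue_tuple R p]_(t in box y h) (f (\row_j tnth t j))%:E)%E.
  apply: integral_ge0 => t /cf /andP[? _]; rewrite lee_fin; exact: le_trans c00 _.
have lo : ((c0 * h ^+ p)%:E <= \int[lebesgue_tuple R p]_(t in box y h) (f (\row_j tnth t j))%:E)%E.
  rewrite -E; apply: ge0_le_integral_nomeas => t; first by rewrite lee_fin.
  by move=> /cf /andP[? _]; rewrite lee_fin.
have hi : (\int[lebesgue_tuple R p]_(t in box y h) (f (\row_j tnth t j))%:E <= (F * h ^+ p)%:E)%E.
  rewrite -E; apply: ge0_le_integral_nomeas => t /cf /andP[? ?]; rewrite lee_fin//.
  exact: le_trans c00 _.
by case: (integral _ _ _) lo hi => //= r; rewrite !lee_fin => -> ->.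
Qed.

End boxes.

(** * Finite probability *)

Section finite_probability.
Context d (T : measurableType d) (R : realType) (P : probability T R).
Implicit Types A B : set T.

(** Real valued, so that field arithmetic and its tactics apply. *)
Definition pr A : R := fine (P A).

Lemma prE A : measurable A -> P A = (pr A)%:E.
Proof. by move=> mA; rewrite /pr fineK// fin_num_measure. Qed.

Lemma pr_ge0 A : 0 <= pr A.
Proof. by rewrite /pr fine_ge0. Qed.

Lemma le_pr A B : measurable A -> measurable B -> A `<=` B -> pr A <= pr B.
Proof. by move=> mA mB AB; rewrite -lee_fin -!prE// le_measure// inE. Qed.

Lemma pr0 : pr set0 = 0. Proof. by rewrite /pr measure0. Qed.

Lemma prT : pr setT = 1. Proof. by rewrite /pr probability_setT. Qed.

Lemma pr_le1 A : measurable A -> pr A <= 1.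
Proof. by move=> mA; rewrite -prT; exact: le_pr. Qed.

Lemma pr_partition (F : finType) (At : F -> set T) A :
  measurable A -> (forall c, measurable (At c)) ->
  (forall c c' w, At c w -> At c' w -> c = c') -> (forall w, exists c, At c w) ->
  pr A = \sum_c pr (A `&` At c).
Proof.
move=> mA mAt disj cov; apply: EFin_inj; rewrite -prE// -sumEFin.
rewrite (eq_bigr (fun c => P (A `&` At c))); last first.
  by move=> c _; rewrite prE//; exact: measurableI.
rewrite {1}(_ : A = \bigcup_(c in [set: F]) (A `&` At c)); last first.
  apply/seteqP; split => w; last by case=> c _ [].
  by have [c cw] := cov w; exists c.
rewrite measure_fin_bigcup//.
- have -> : [set: F] = [set` enum F].
    by apply/seteqP; split => c //= _; rewrite mem_enum.
  by rewrite -fsbig_seq ?enum_uniq// big_enum.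
- exact: finite_finset.
- by move=> c c' _ _ [w [[_ cw] [_ c'w]]]; exact: disj cw c'w.
- by move=> c _; exact: measurableI.
Qed.

Lemma pr_exists_le (F : finType) (A : F -> set T) : (forall i, measurable (A i)) ->
  pr [set w | exists i, A i w] <= \sum_i pr (A i).
Proof.
move=> mA; pose B (s : seq F) := [set w | exists2 i, i \in s & A i w].
have mB s : measurable (B s).
  rewrite (_ : B s = [set w | exists i, ([set w | i \in s] `&` A i) w]).
    apply: (algebra_exists (algebra_measurable _)) => i; apply: measurableI => //.
    exact: (algebra_cst (algebra_measurable _)).
  by apply/seteqP; split => w [i]; [move=> ? ?; exists i|move=> [? ?]; exists i].
rewrite (_ : [set w | _] = B (enum F)); last first.
  by apply/seteqP; split => w [i]; [exists i => //; rewrite mem_enum|exists i].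
rewrite -big_enum/=; elim: (enum F) => [|i s IH].
  by rewrite (_ : B [::] = set0) ?pr0 ?big_nil//; apply/seteqP; split => w [].
rewrite big_cons; apply: le_trans (_ : pr (A i) + pr (B s) <= _); last by rewrite lerD2l.
rewrite (_ : B (i :: s) = A i `|` B s); last first.
  apply/seteqP; split => w.
    by move=> [k]; rewrite in_cons => /orP[/eqP ->|ks Ak]; [left|right; exists k].
  by move=> [Ai|[k ks Ak]]; [exists i|exists k] => //; rewrite in_cons ?eqxx ?ks ?orbT.
rewrite -lee_fin EFinD -!prE//; last exact: measurableU.
exact: measureU2.
Qed.

Lemma pr_setU_le A B : measurable A -> measurable B -> pr (A `|` B) <= pr A + pr B.
Proof.
move=> mA mB; rewrite -lee_fin EFinD -!prE//; last exact: measurableU.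
exact: measureU2.
Qed.

Lemma measurable_event_sum (J : finType) (E : J -> set T) (v : J -> R) (t mu : R) :
  (forall a, measurable (E a)) ->
  measurable [set w | t <= `|\sum_a v a * (`[< E a w >])%:R - mu|].
Proof.
move=> mE; pose Q (c : {ffun J -> bool}) := is_true (t <= `|\sum_a v a * (c a)%:R - mu|).
rewrite (_ : [set w | _] = [set w | Q [ffun a => `[< E a w >]]]).
  exact: (algebra_boolean (algebra_measurable _) Q mE).
have eqs w : \sum_a v a * ([ffun a => `[< E a w >]] a)%:R = \sum_a v a * `[< E a w >]%:R.
  by apply: eq_bigr => a _; rewrite ffunE.
by apply/seteqP; split => w; rewrite /Q/= eqs.
Qed.

(* The expansion over the atoms of the finite algebra generated by the events
   turns Chebyshev's inequality into one about finite sums. *)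
Lemma chebyshev_events (J : finType) (E : J -> set T) (v : J -> R) (t mu : R) :
  (forall a, measurable (E a)) -> 0 <= t ->
  mu = \sum_a v a * pr (E a) ->
  pr [set w | t <= `|\sum_a v a * (`[< E a w >])%:R - mu|] * t ^+ 2 <=
  \sum_a \sum_b v a * v b * pr (E a `&` E b) - mu ^+ 2.
Proof.
move=> mE t0 muE; pose At (c : {ffun J -> bool}) := [set w | forall a, `[< E a w >] = c a].
have mAt c : measurable (At c).
  rewrite (_ : At c = [set w | [ffun a => `[< E a w >]] = c]).
    exact: (algebra_boolean (algebra_measurable _) (fun c' => c' = c) mE).
  apply/seteqP; split => w cw; first by apply/ffunP => a; rewrite ffunE.
  by move=> a; rewrite -cw ffunE.
have disj c c' w : At c w -> At c' w -> c = c'.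
  by move=> h h'; apply/ffunP => a; rewrite -h -h'.
have cov w : exists c, At c w by exists [ffun a => `[< E a w >]] => a; rewrite ffunE.
pose q c := pr (At c).
have q1 : \sum_c q c = 1.
  rewrite -prT (pr_partition measurableT mAt disj cov).
  by apply: eq_bigr => c _; rewrite setTI.
have prAt A (Q : pred {ffun J -> bool}) : measurable A ->
    (forall c w, At c w -> A w <-> Q c) -> pr A = \sum_c (Q c)%:R * q c.
  move=> mA AQ; rewrite (pr_partition mA mAt disj cov); apply: eq_bigr => c _.
  have [Qc|nQc] := boolP (Q c).
    rewrite mul1r; congr pr; apply/seteqP; split => w; first by case.
    by move=> cw; split=> //; apply/(AQ c w cw).
  rewrite mul0r (_ : _ `&` _ = set0) ?pr0//; apply/seteqP; split => w // [Aw cw].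
  by have := (AQ c w cw).1 Aw; rewrite (negbTE nQc).
pose g (c : {ffun J -> bool}) := \sum_a v a * (c a)%:R - mu.
have prEa a : pr (E a) = \sum_(c : {ffun J -> bool}) (c a)%:R * q c.
  by apply: (prAt _ (fun c : {ffun J -> bool} => c a)) => // c w <-; split => /asboolP.
have prEab a b : pr (E a `&` E b) = \sum_(c : {ffun J -> bool}) (c a && c b)%:R * q c.
  apply: (prAt _ (fun c : {ffun J -> bool} => c a && c b)) => [|c w cw]; first exact: measurableI.
  by rewrite -!cw; split => [[Ea Eb]|/andP[/asboolP ? /asboolP]//]; apply/andP; split; apply/asboolP.
have expand : \sum_c q c * g c ^+ 2 =
    \sum_a \sum_b v a * v b * pr (E a `&` E b) - mu ^+ 2.
  have s1 : \sum_(c : {ffun J -> bool}) q c * (\sum_a v a * (c a)%:R) = mu.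
    rewrite muE; under eq_bigr do rewrite mulr_sumr.
    rewrite exchange_big/=; apply: eq_bigr => a _; rewrite prEa mulr_sumr.
    by apply: eq_bigr => c _; ring.
  have s2 : \sum_(c : {ffun J -> bool}) q c * (\sum_a v a * (c a)%:R) ^+ 2 =
      \sum_a \sum_b v a * v b * pr (E a `&` E b).
    under eq_bigr => c _ do rewrite expr2 mulr_suml mulr_sumr.
    rewrite exchange_big/=; apply: eq_bigr => a _.
    under eq_bigr => c _ do rewrite mulr_sumr mulr_sumr.
    rewrite exchange_big/=; apply: eq_bigr => b _; rewrite prEab mulr_sumr.
    by apply: eq_bigr => c _; case: (c a); case: (c b) => /=; rewrite ?mulr1 ?mulr0 ?mul0r ?mul1r ?mulr0//; ring.
  rewrite (eq_bigr (fun c : {ffun J -> bool} => q c * (\sum_a v a * (c a)%:R) ^+ 2 +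
     (- (2 * mu) * (q c * (\sum_a v a * (c a)%:R)) + mu ^+ 2 * q c))); last first.
    by move=> c _; rewrite /g; ring.
  rewrite !big_split/= -!mulr_sumr s1 s2 q1; ring.
rewrite -expand.
set bad := [set w | _].
have badQ c w : At c w -> bad w <-> (t <= `|g c|).
  move=> cw; rewrite /bad /= (_ : \sum_a v a * (`[< E a w >])%:R = \sum_a v a * (c a)%:R)//.
  by apply: eq_bigr => a _; rewrite cw.
have mbad : measurable bad by exact: measurable_event_sum.
rewrite (prAt _ (fun c => t <= `|g c|) mbad badQ) mulr_suml; apply: ler_sum => c _.
have [tg|_] := boolP (t <= `|g c|); last first.
  by rewrite !mul0r mulr_ge0 ?sqr_ge0 ?pr_ge0.
rewrite mul1r ler_wpM2l ?pr_ge0// -[leRHS]real_normK ?num_real//.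
by rewrite ler_sqr ?nnegrE.
Qed.

End finite_probability.

(** * Second moment bounds for independent observations *)

Section independent_events.
Context d (T : measurableType d) (R : realType) (P : probability T R).

Lemma chebyshev_cov (J : finType) (E : J -> set T) (v : J -> R) (t : R) :
  (forall a, measurable (E a)) -> 0 <= t ->
  pr P [set w | t <= `|\sum_a v a * (`[< E a w >])%:R - \sum_a v a * pr P (E a)|] * t ^+ 2 <=
  \sum_a \sum_b v a * v b * (pr P (E a `&` E b) - pr P (E a) * pr P (E b)).
Proof.
move=> mE t0.
have h := @chebyshev_events d T R P J E v t _ mE t0 erefl.
apply: (le_trans h).
rewrite expr2 mulr_suml -sumrB; apply: ler_sum => a _.
rewrite mulr_sumr -sumrB; apply: ler_sum => b _.
by rewrite le_eqVlt; apply/orP; left; apply/eqP; ring.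
Qed.

Context d' (U : measurableType d') (I : finType) (X : I -> T -> U).
Hypothesis mX : forall i, measurable_fun setT (X i).
Hypothesis X_indep : mutually_independent P X.

Lemma measurable_event i D : measurable D -> measurable (X i @^-1` D).
Proof. by move=> mD; rewrite -[X in measurable X]setTI; exact: mX. Qed.

Lemma pr_indep (s : seq I) (E : I -> set U) : uniq s -> (forall i, measurable (E i)) ->
  pr P [set w | forall i, i \in s -> E i (X i w)] = \prod_(i <- s) pr P (X i @^-1` E i).
Proof.
move=> us mE; apply: EFin_inj; rewrite -prE; last first.
  apply: (algebra_forall (algebra_measurable _)) => i.
  apply: (algebra_imply (algebra_measurable _)); exact: measurable_event.
have := X_indep [set i in s]%SET mE.
rewrite (_ : \bigcap_(i in _) _ = [set w | forall i, i \in s -> E i (X i w)]); last first.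
  by apply/seteqP; split => w h i; have := h i; rewrite /= inE.
move=> ->; rewrite (eq_bigl (fun i => i \in s)); last by move=> i; rewrite inE.
rewrite -big_uniq//= (big_morph _ (@EFinM R) erefl).
by apply: eq_bigr => i _; rewrite prE//; exact: measurable_event.
Qed.

Lemma pr_indep2 i k A B : i != k -> measurable A -> measurable B ->
  pr P (X i @^-1` A `&` X k @^-1` B) = pr P (X i @^-1` A) * pr P (X k @^-1` B).
Proof.
move=> ik mA mB.
have := @pr_indep [:: i; k] (fun b => if b == i then A else B) _ _.
rewrite !big_cons big_nil eqxx eq_sym (negbTE ik) mulr1 => <-; last 2 first.
- by rewrite /= inE ik.
- by move=> b; case: ifP.
congr pr; apply/seteqP; split => w.
  move=> [Ai Bk] b; rewrite !inE => /orP[/eqP ->|/eqP ->]; rewrite ?eqxx//.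
  by rewrite eq_sym (negbTE ik).
move=> h; have := h i; have := h k; rewrite !inE !eqxx orbT eq_sym (negbTE ik).
by move=> /(_ isT) ? /(_ isT) ?.
Qed.

Lemma pr_indep3 i k k' A B C : i != k -> i != k' -> k != k' ->
  measurable A -> measurable B -> measurable C ->
  pr P (X i @^-1` A `&` (X k @^-1` B `&` X k' @^-1` C)) =
  pr P (X i @^-1` A) * (pr P (X k @^-1` B) * pr P (X k' @^-1` C)).
Proof.
move=> ik ik' kk' mA mB mC.
have := @pr_indep [:: i; k; k'] (fun b => if b == i then A else if b == k then B else C) _ _.
rewrite !big_cons big_nil !eqxx ![_ == i]eq_sym (negbTE ik) (negbTE ik').
rewrite [_ == k]eq_sym (negbTE kk') mulr1 => <-; last 2 first.
- by rewrite /= !inE negb_or ik ik' kk'.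
- by move=> b; case: ifP => // _; case: ifP.
congr pr; apply/seteqP; split => w.
  move=> [Ai [Bk Ck']] b; rewrite !inE => /or3P[/eqP ->|/eqP ->|/eqP ->]; rewrite ?eqxx//.
    by rewrite eq_sym (negbTE ik).
  by rewrite ![k' == _]eq_sym (negbTE ik') (negbTE kk').
move=> h; have := h i; have := h k; have := h k'; rewrite !inE !eqxx !orbT.
rewrite ![_ == i]eq_sym (negbTE ik) (negbTE ik') [_ == k]eq_sym (negbTE kk').
by move=> /(_ isT) ? /(_ isT) ? /(_ isT) ?.
Qed.

Lemma pr_indep4 i k i' k' A B A' B' : uniq [:: i; k; i'; k'] ->
  measurable A -> measurable B -> measurable A' -> measurable B' ->
  pr P ((X i @^-1` A `&` X k @^-1` B) `&` (X i' @^-1` A' `&` X k' @^-1` B')) =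
  pr P (X i @^-1` A `&` X k @^-1` B) * pr P (X i' @^-1` A' `&` X k' @^-1` B').
Proof.
move=> us mA mB mA' mB'; have := us; rewrite /= !inE !negb_or.
move=> /and4P[/and3P[ik ii' ik'] /andP[ki' kk'] i'k' _].
rewrite !pr_indep2//.
have := @pr_indep [:: i; k; i'; k'] (fun b => if b == i then A else if b == k then B
  else if b == i' then A' else B') us _.
rewrite !big_cons big_nil !eqxx ![_ == i]eq_sym (negbTE ik) (negbTE ik') (negbTE ii').
rewrite ![_ == k]eq_sym (negbTE kk') (negbTE ki') ![_ == i']eq_sym (negbTE i'k') mulr1 !mulrA => <-; last first.
  by move=> b; do 3 (case: ifP => // _).
congr pr; apply/seteqP; split => w.
  move=> [[Ai Bk] [Ai' Bk']] b; rewrite !inE => /or4P[]/eqP ->; rewrite ?eqxx//.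
  - by rewrite eq_sym (negbTE ik).
  - by rewrite ![i' == _]eq_sym (negbTE ii') (negbTE ki').
  - by rewrite ![k' == _]eq_sym (negbTE ik') (negbTE kk') (negbTE i'k').
move=> h; have := h i; have := h k; have := h i'; have := h k'; rewrite !inE !eqxx !orbT.
rewrite ![_ == i]eq_sym (negbTE ik) (negbTE ik') (negbTE ii').
rewrite ![_ == k]eq_sym (negbTE kk') (negbTE ki') ![_ == i']eq_sym (negbTE i'k').
by move=> /(_ isT) ? /(_ isT) ? /(_ isT) ? /(_ isT) ?.
Qed.

Lemma hitsE (S : {set I}) D w : (hits X S D w)%:R =
  \sum_i (i \in S)%:R * (`[< D (X i w) >])%:R :> R.
Proof.
rewrite /hits -sum1_card natr_sum big_mkcond/=; apply: eq_bigr => i _.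
by rewrite !inE; case: (i \in S); case: `[< _ >]; rewrite ?mulr1 ?mulr0.
Qed.

Lemma sum_in (S : {set I}) (c : R) : \sum_i (i \in S)%:R * c = #|S|%:R * c.
Proof.
rewrite -sum1_card natr_sum mulr_suml [RHS]big_mkcond/=; apply: eq_bigr => i _.
by case: (i \in S); rewrite ?mul1r ?mul0r.
Qed.

(** Off-diagonal covariances vanish by independence, and each diagonal one is [q - q ^+ 2], at most
    1. *)
Lemma lln (S : {set I}) (D : set U) (q t : R) : measurable D ->
  (forall i, pr P (X i @^-1` D) = q) -> 0 <= t ->
  pr P [set w | t <= `|(hits X S D w)%:R - #|S|%:R * q|] * t ^+ 2 <= #|S|%:R.
Proof.
move=> mD Dq t0; have mE i := measurable_event i mD.
have h := @chebyshev_cov I _ (fun i => (i \in S)%:R) t mE t0.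
rewrite (_ : [set w | _ <= `|_ - _ * q|] = [set w | t <= `|
  \sum_a (a \in S)%:R * `[< (X a @^-1` D) w >]%:R -
  \sum_a (a \in S)%:R * pr P (X a @^-1` D)|]); last first.
  have -> : \sum_a (a \in S)%:R * pr P (X a @^-1` D) = #|S|%:R * q.
    by rewrite -sum_in; apply: eq_bigr => a _; rewrite Dq.
  by apply/seteqP; split => w /=; rewrite hitsE.
apply: (le_trans h).
rewrite -[leRHS]mulr1 -sum_in; apply: ler_sum => a _.
rewrite (bigD1 a)//= big1 ?addr0; last first.
  move=> b ba; rewrite pr_indep2 1?eq_sym//; ring.
rewrite setIid Dq; case: (a \in S); rewrite /= ?mulr1n ?mulr0n ?mul0r ?mul1r//.
have : 0 <= q by rewrite -(Dq a) pr_ge0.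
have : q <= 1 by rewrite -(Dq a) pr_le1.
by move=> q1 q0; nra.
Qed.

(* The covariance of two pair events vanishes unless they share an individual,
   and then it is at most the probability that both hold, which forces the same cell. *)
Lemma pair_exists (Z : finType) (C C' : Z -> set U) (S1 S2 : {set I}) (q Q : R) (N : nat) :
  (forall z, measurable (C z)) -> (forall z, measurable (C' z)) ->
  (forall z z' u, C z u -> C z' u -> z = z') ->
  (forall z z' u, C' z u -> C' z' u -> z = z') ->
  0 < q ->
  (forall i z, q <= pr P (X i @^-1` C z) <= Q) ->
  (forall i z, q <= pr P (X i @^-1` C' z) <= Q) ->
  [disjoint S1 & S2]%B -> #|S1| = N -> #|S2| = N -> (0 < N)%N -> (0 < #|Z|)%N ->
  pr P [set w | forall i k z, i \in S1 -> k \in S2 -> ~ (C z (X i w) /\ C' z (X k w))] <=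
  (N%:R ^+ 2 * #|Z|%:R * q ^+ 2)^-1 + 2 * Q ^+ 3 / (N%:R * #|Z|%:R * q ^+ 4).
Proof.
move=> mC mC' dC dC' q0 CQ C'Q dis S1N S2N N0 Z0.
pose J := (I * I * Z)%type.
pose E (a : J) := X a.1.1 @^-1` C a.2 `&` X a.1.2 @^-1` C' a.2.
pose v (a : J) : R := (a.1.1 \in S1)%:R * (a.1.2 \in S2)%:R.
have mE a : measurable (E a) by apply: measurableI; apply: measurable_event.
pose mu := \sum_a v a * pr P (E a).
have dis2 i k : i \in S1 -> k \in S2 -> i != k.
  by move=> iS kS; apply: contraTneq kS => <-; rewrite (disjointFr dis iS).
have prE a : v a != 0 -> pr P (E a) = pr P (X a.1.1 @^-1` C a.2) * pr P (X a.1.2 @^-1` C' a.2).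
  rewrite mulf_eq0 negb_or !pnatr_eq0 !eqb0 !negbK => /andP[iS kS].
  by rewrite pr_indep2// dis2.
have Q0 : 0 <= Q.
  have [z _] := card_gt0P Z0; have [i _] : exists i, i \in S1 by apply/card_gt0P; rewrite S1N.
  by have /andP[h1 h2] := CQ i z; lra.
have sumv : \sum_(a : J) v a = N%:R ^+ 2 * #|Z|%:R.
  rewrite -(pair_bigA _ (fun ik z => v (ik, z)))/=.
  rewrite (eq_bigr (fun ik : I * I => (ik.1 \in S1)%:R * ((ik.2 \in S2)%:R * #|Z|%:R))); last first.
    by move=> ik _; rewrite /v/= sumr_const mulrA [RHS]mulr_natr; congr (_ *+ _); exact: eq_card.
  rewrite -(pair_bigA _ (fun i k => (i \in S1)%:R * ((k \in S2)%:R * #|Z|%:R)))/=.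
  under eq_bigr do rewrite -mulr_sumr sum_in.
  by rewrite sum_in S1N S2N; ring.
have mu_ge : N%:R ^+ 2 * #|Z|%:R * q ^+ 2 <= mu.
  rewrite -sumv mulr_suml; apply: ler_sum => a _.
  have [->|va] := eqVneq (v a) 0; first by rewrite !mul0r.
  rewrite ler_wpM2l ?prE// ?mulr_ge0//.
  have /andP[h1 _] := CQ a.1.1 a.2; have /andP[h2 _] := C'Q a.1.2 a.2.
  by rewrite expr2; apply: ler_pM => //; exact: ltW.
pose n : R := N%:R; pose zz : R := #|Z|%:R.
have n0 : 0 < n by rewrite ltr0n.
have zz0 : 0 < zz by rewrite ltr0n.
have low0 : 0 < n ^+ 2 * zz * q ^+ 2 by rewrite !mulr_gt0// exprn_gt0.
have mu0 : 0 < mu by apply: lt_le_trans mu_ge.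
have v0 a : 0 <= v a by rewrite mulr_ge0.
have v1 a : v a <= 1.
  by rewrite /v; case: (_ \in _); case: (_ \in _); rewrite ?mulr0 ?mulr1.
(* Without a suitable pair the count is 0, a deviation by the full mean; hence the threshold
   [mu]. *)
have h := @chebyshev_cov J E v mu mE (ltW mu0).
(* The diagonal sums to [mu]. Two events sharing one individual and the cell involve three distinct
   individuals, whence [Q ^+ 3]; the indicators add up to [2 * N] for each [a]. *)
have cov a b : v a * v b * (pr P (E a `&` E b) - pr P (E a) * pr P (E b)) <=
   (b == a)%:R * (v a * pr P (E a)) +
   (((b.1.1 == a.1.1) && (b.2 == a.2))%:R * (b.1.2 \in S2)%:R +
    ((b.1.2 == a.1.2) && (b.2 == a.2))%:R * (b.1.1 \in S1)%:R) * (v a * Q ^+ 3).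
  have [va|va] := eqVneq (v a) 0; first by rewrite va !mul0r !mulr0 add0r.
  have [vb|vb] := eqVneq (v b) 0.
    rewrite vb mulr0 mul0r; repeat (apply: mulr_ge0 || apply: addr_ge0) => //;
      by [exact: pr_ge0|exact: exprn_ge0].
  have [[iS1 kS2] [jS1 lS2]] : ((a.1.1 \in S1) /\ (a.1.2 \in S2)) /\ ((b.1.1 \in S1) /\ (b.1.2 \in S2)).
    move: va vb; rewrite !mulf_eq0 !negb_or !pnatr_eq0 !eqb0 !negbK.
    by move=> /andP[-> ->] /andP[-> ->].
  have vE1 c : v c != 0 -> v c = 1.
    rewrite mulf_eq0 negb_or !pnatr_eq0 !eqb0 !negbK /v.
    by move=> /andP[-> ->]; rewrite mulr1.
  rewrite jS1 lS2 (vE1 a va) (vE1 b vb) !mul1r !mulr1.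
  have pp : 0 <= pr P (E a) * pr P (E b) by rewrite mulr_ge0 ?pr_ge0.
  have Q30 : 0 <= Q ^+ 3 by rewrite exprn_ge0.
  have c30 x y (u : bool) : 0 <= (x%:R + y%:R) * Q ^+ 3 :> R /\ 0 <= u%:R * pr P (E a).
    by rewrite !mulr_ge0 ?addr_ge0 ?pr_ge0.
  have [share|] := boolP ((b.1.1 == a.1.1) || (b.1.2 == a.1.2)); last first.
    rewrite negb_or => /andP[ij kl].
    rewrite /E pr_indep4 ?subrr//.
      by rewrite addr_ge0//; [exact: (c30 0 0 _).2|exact: (c30 _ _ true).1].
    rewrite /= !inE !negb_or ![a.1.1 == _]eq_sym ij eq_sym dis2//= eq_sym dis2//=.
    by rewrite ![a.1.2 == _]eq_sym kl dis2//= dis2.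
  have [zE|nz] := eqVneq b.2 a.2; last first.
    have -> : E a `&` E b = set0.
      apply/seteqP; split => w // [[Ca C'a] [Cb C'b]]; case/eqP: nz.
      case/orP: share => /eqP sh; first by apply: dC Cb _; rewrite sh.
      by apply: dC' C'b _; rewrite sh.
    rewrite pr0 sub0r; apply: (@le_trans _ _ 0); first by rewrite oppr_le0.
    by rewrite addr_ge0//; [exact: (c30 0 0 _).2|exact: (c30 _ _ true).1].
  rewrite !andbT.
  have mI := measurableI _ _ (mE a) (mE b).
  have [ij|ij] := eqVneq b.1.1 a.1.1; have [kl|kl] := eqVneq b.1.2 a.1.2.
  - have ba : b = a by move: (a) (b) ij kl zE => [[? ?] ?] [[? ?] ?] /= -> -> ->.
    move: pp; rewrite ba eqxx mul1r setIid /= => pp.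
    by have := (c30 1 1 true).1; rewrite !mulr1n; lra.
  - have le : pr P (E a `&` E b) <= Q ^+ 3.
      apply: (@le_trans _ _ (pr P (X a.1.1 @^-1` C a.2 `&`
         (X a.1.2 @^-1` C' a.2 `&` X b.1.2 @^-1` C' a.2)))).
        apply: le_pr => //; first by do 2 (apply: measurableI; first exact: measurable_event); exact: measurable_event.
        by rewrite /E zE => w [[? ?] [_ ?]].
      have kl' : a.1.2 != b.1.2 by rewrite eq_sym.
      rewrite (pr_indep3 (dis2 _ _ iS1 kS2) (dis2 _ _ iS1 lS2) kl')// !exprS expr0 mulr1.
      have /andP[_ h1] := CQ a.1.1 a.2; have /andP[_ h2] := C'Q a.1.2 a.2.
      have /andP[_ h3] := C'Q b.1.2 a.2.
      by apply: ler_pM => //; rewrite ?mulr_ge0 ?pr_ge0//; apply: ler_pM; rewrite ?pr_ge0.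
    by rewrite mulr1n mulr0n addr0 mul1r; have := (c30 0 0 (b == a)).2; lra.
  - have le : pr P (E a `&` E b) <= Q ^+ 3.
      apply: (@le_trans _ _ (pr P (X a.1.1 @^-1` C a.2 `&`
         (X b.1.1 @^-1` C a.2 `&` X a.1.2 @^-1` C' a.2)))).
        apply: le_pr => //; first by do 2 (apply: measurableI; first exact: measurable_event); exact: measurable_event.
        by rewrite /E zE => w [[? ?] [? _]].
      have ij' : a.1.1 != b.1.1 by rewrite eq_sym.
      rewrite (pr_indep3 ij' (dis2 _ _ iS1 kS2) (dis2 _ _ jS1 kS2))// !exprS expr0 mulr1.
      have /andP[_ h1] := CQ a.1.1 a.2; have /andP[_ h2] := C'Q a.1.2 a.2.
      have /andP[_ h3] := CQ b.1.1 a.2.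
      by apply: ler_pM => //; rewrite ?mulr_ge0 ?pr_ge0//; apply: ler_pM; rewrite ?pr_ge0.
    by rewrite mulr1n mulr0n add0r mul1r; have := (c30 0 0 (b == a)).2; lra.
  - by move: share; rewrite (negbTE ij) (negbTE kl).
have sum_pred1 (a : J) : \sum_b (b == a)%:R = 1 :> R.
  by rewrite (bigD1 a)//= eqxx big1 ?addr0// => b /negbTE ->.
have sum_cst (S : {set I}) : \sum_(k : I) (k \in S)%:R = #|S|%:R :> R.
  by rewrite -[RHS]mulr1 -sum_in; apply: eq_bigr => k _; rewrite mulr1.
have sum_fst (a : J) : \sum_(b : J) ((b.1.1 == a.1.1) && (b.2 == a.2))%:R * (b.1.2 \in S2)%:R = #|S2|%:R :> R.
  rewrite -(pair_bigA _ (fun ik z => ((ik.1 == a.1.1) && (z == a.2))%:R * (ik.2 \in S2)%:R))/=.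
  rewrite (eq_bigr (fun ik : I * I => (ik.1 == a.1.1)%:R * (ik.2 \in S2)%:R)); last first.
    move=> ik _; rewrite (bigD1 a.2)//= eqxx andbT big1 ?addr0// => z /negbTE ->.
    by rewrite andbF mul0r.
  rewrite -(pair_bigA _ (fun i k => (i == a.1.1)%:R * (k \in S2)%:R))/=.
  rewrite (bigD1 a.1.1)//= [X in _ + X]big1 ?addr0; last first.
    by move=> i /negbTE ->; rewrite big1// => k _; rewrite mul0r.
  by rewrite -mulr_sumr eqxx mul1r.
have sum_snd (a : J) : \sum_(b : J) ((b.1.2 == a.1.2) && (b.2 == a.2))%:R * (b.1.1 \in S1)%:R = #|S1|%:R :> R.
  rewrite -(pair_bigA _ (fun ik z => ((ik.2 == a.1.2) && (z == a.2))%:R * (ik.1 \in S1)%:R))/=.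
  rewrite (eq_bigr (fun ik : I * I => (ik.2 == a.1.2)%:R * (ik.1 \in S1)%:R)); last first.
    move=> ik _; rewrite (bigD1 a.2)//= eqxx andbT big1 ?addr0// => z /negbTE ->.
    by rewrite andbF mul0r.
  rewrite -(pair_bigA _ (fun i k => (k == a.1.2)%:R * (i \in S1)%:R))/= exchange_big/=.
  rewrite (bigD1 a.1.2)//= [X in _ + X]big1 ?addr0; last first.
    by move=> i /negbTE ->; rewrite big1// => k _; rewrite mul0r.
  by rewrite -mulr_sumr eqxx mul1r.
have tot : \sum_a \sum_b v a * v b * (pr P (E a `&` E b) - pr P (E a) * pr P (E b)) <=
    mu + 2 * n ^+ 3 * zz * Q ^+ 3.
  apply: (@le_trans _ _ (\sum_a (v a * pr P (E a) + (n + n) * (v a * Q ^+ 3)))).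
    apply: ler_sum => a _; apply: le_trans (ler_sum _ (fun b _ => cov a b)) _.
    rewrite big_split/= -!mulr_suml big_split/= sum_pred1 sum_fst ?sum_snd.
    by rewrite mul1r S1N S2N.
  rewrite big_split/= -mulr_sumr -mulr_suml sumv -/mu lerD2l -/n -/zz.
  by rewrite le_eqVlt; apply/orP; left; apply/eqP; ring.
have key : pr P [set w | forall i k z, i \in S1 -> k \in S2 -> ~ (C z (X i w) /\ C' z (X k w))] * mu ^+ 2 <= mu + 2 * n ^+ 3 * zz * Q ^+ 3.
  apply: le_trans tot; apply: le_trans h; rewrite ler_wpM2r ?sqr_ge0//.
  apply: le_pr; last first.
  - move=> w bad /=; rewrite big1; first by rewrite sub0r normrN ger0_norm// ltW.
    move=> a _; have [->|va] := eqVneq (v a) 0; first by rewrite mul0r.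
    move: va; rewrite mulf_eq0 negb_or !pnatr_eq0 !eqb0 !negbK => /andP[iS kS].
    by case: asboolP => [/(bad _ _ a.2 iS kS)//|_]; rewrite mulr0.
  - exact: measurable_event_sum.
  - do 3 (apply: (algebra_forall (algebra_measurable _)) => ?).
    do 2 apply: (algebra_imply (algebra_measurable _)).
    by apply: measurableC; apply: measurableI; exact: measurable_event.
set B := pr P _ in key *.
have B0 : 0 <= B by exact: pr_ge0.
pose lo := n ^+ 2 * zz * q ^+ 2.
have -> : 2 * Q ^+ 3 / (N%:R * #|Z|%:R * q ^+ 4) = 2 * n ^+ 3 * zz * Q ^+ 3 / lo ^+ 2.
  by rewrite /lo -/n -/zz; field; rewrite !gt_eqF.
have -> : (N%:R ^+ 2 * #|Z|%:R * q ^+ 2)^-1 = lo^-1 by [].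
have key1 : B <= mu^-1 + 2 * n ^+ 3 * zz * Q ^+ 3 / mu ^+ 2.
  have -> : mu^-1 + 2 * n ^+ 3 * zz * Q ^+ 3 / mu ^+ 2 = (mu + 2 * n ^+ 3 * zz * Q ^+ 3) / mu ^+ 2.
    by field; rewrite gt_eqF.
  by rewrite ler_pdivlMr ?exprn_gt0.
apply: le_trans key1 _; apply: lerD; first by rewrite lef_pV2.
apply: ler_wpM2l; first by rewrite !mulr_ge0 ?exprn_ge0// ltW.
by rewrite lef_pV2 ?posrE ?exprn_gt0// ler_sqr ?nnegrE// ltW.
Qed.

Lemma triple_le (Z : finType) (C : Z -> set U) (Q : R) :
  (forall z, measurable (C z)) -> (forall i z, pr P (X i @^-1` C z) <= Q) ->
  pr P [set w | exists a : Z * (I * (I * I)), uniq [:: a.2.1; a.2.2.1; a.2.2.2] /\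
      [/\ C a.1 (X a.2.1 w), C a.1 (X a.2.2.1 w) & C a.1 (X a.2.2.2 w)]] <=
  #|Z|%:R * #|I|%:R ^+ 3 * Q ^+ 3.
Proof.
move=> mC CQ.
pose E (a : Z * (I * (I * I))) := [set w | uniq [:: a.2.1; a.2.2.1; a.2.2.2] /\
      [/\ C a.1 (X a.2.1 w), C a.1 (X a.2.2.1 w) & C a.1 (X a.2.2.2 w)]].
have EE a : E a = [set _ | uniq [:: a.2.1; a.2.2.1; a.2.2.2]] `&`
    (X a.2.1 @^-1` C a.1 `&` (X a.2.2.1 @^-1` C a.1 `&` X a.2.2.2 @^-1` C a.1)).
  by apply/seteqP; split => w; [move=> [? [? ? ?]]|move=> [? [? [? ?]]]].
have m3 a : measurable (X a.2.1 @^-1` C a.1 `&` (X a.2.2.1 @^-1` C a.1 `&` X a.2.2.2 @^-1` C a.1)).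
  by do 2 (apply: measurableI; first exact: measurable_event); exact: measurable_event.
have mE a : measurable (E a).
  by rewrite EE; apply: measurableI => //; exact: (algebra_cst (algebra_measurable _)).
apply: (le_trans (pr_exists_le P mE)).
have -> : #|Z|%:R * #|I|%:R ^+ 3 * Q ^+ 3 = \sum_(a : Z * (I * (I * I))) Q ^+ 3.
  rewrite sumr_const !card_prod -[RHS]mulr_natl !natrM; ring.
apply: ler_sum => a _; rewrite EE.
have [us|us] := boolP (uniq [:: a.2.1; a.2.2.1; a.2.2.2]); last first.
  rewrite (_ : _ `&` _ = set0); last by apply/seteqP; split => w // [].
  rewrite pr0 exprn_ge0//; apply: le_trans (CQ a.2.1 a.1); exact: pr_ge0.
rewrite (_ : [set _ | _] = setT) ?setTI; last by apply/seteqP; split.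
move: us; rewrite /= !inE !negb_or => /and3P[/andP[h1 h2] h3 _].
rewrite pr_indep3// !exprS expr0 mulr1.
by apply: ler_pM; rewrite ?mulr_ge0 ?pr_ge0//; apply: ler_pM; rewrite ?pr_ge0.
Qed.

End independent_events.

(** * Avoidable events *)

Section avoidable.
Context d (T : measurableType d) (R : realType) (P : probability T R).
Context d' (U : measurableType d') (m : nat) (X : 'I_m -> T -> U).
Hypothesis mX : forall i, measurable_fun setT (X i).

Lemma sigma_measurable A : g_sigma_preimage X A -> measurable A.
Proof.
move=> GA; have : g_sigma_preimage X `<=` measurable; last exact.
apply: smallest_sub; first exact: sigma_algebra_measurable.
elim/big_ind : _ => // [A1 A2 h1 h2 B [/h1|/h2]//|i _ B [D mD <-]].
by rewrite setTI; exact: measurable_event.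
Qed.

(** The properties [Q] quantify over real vectors and over outcomes of the descent, so a set [Bad]
    containing their failure is measured instead. It lies in the sigma-algebra of the covariates,
    where [independent_of] applies. *)
Definition avoidable (b : R) (Q : T -> Prop) :=
  exists2 Bad, g_sigma_preimage X Bad & pr P Bad <= b /\ forall w, ~ Bad w -> Q w.

Lemma avoidable_le b b' (Q Q' : T -> Prop) : avoidable b Q -> b <= b' ->
  (forall w, Q w -> Q' w) -> avoidable b' Q'.
Proof.
move=> [B GB [Bb BQ]] bb' QQ'; exists B => //; split; first exact: le_trans bb'.
by move=> w /BQ /QQ'.
Qed.

Lemma avoidable_and b b' (Q Q' : T -> Prop) : avoidable b Q -> avoidable b' Q' ->
  avoidable (b + b') (fun w => Q w /\ Q' w).
Proof.
move=> [B GB [Bb BQ]] [B' GB' [Bb' BQ']].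
have [_ _ GU] := algebra_g_sigma_preimage X.
exists (B `|` B'); first exact: GU.
split; last by move=> w nB; split; [apply: BQ|apply: BQ'] => ?; apply: nB; [left|right].
apply: le_trans (pr_setU_le P (sigma_measurable GB) (sigma_measurable GB')) _.
exact: lerD.
Qed.

Lemma avoidable_forall (F : finType) (b : F -> R) (Q : F -> T -> Prop) :
  (forall k, avoidable (b k) (Q k)) -> avoidable (\sum_k b k) (fun w => forall k, Q k w).
Proof.
move=> av; have /choice[B BP] : forall k, exists B, g_sigma_preimage X B /\
    (pr P B <= b k /\ forall w, ~ B w -> Q k w).
  by move=> k; have [B GB h] := av k; exists B.
exists [set w | exists k, B k w].
  by apply: (algebra_exists (algebra_g_sigma_preimage X)) => k; have [] := BP k.
split; last by move=> w nB k; have [_ [_]] := BP k; apply => Bk; apply: nB; exists k.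
apply: le_trans (pr_exists_le P (fun k => sigma_measurable (BP k).1)) _.
by apply: ler_sum => k _; have [_ []] := BP k.
Qed.

Lemma avoidable_trivial (Q : T -> Prop) b : 0 <= b -> (forall w, Q w) -> avoidable b Q.
Proof.
move=> b0 QT; exists set0; first by have [] := algebra_g_sigma_preimage X.
by rewrite pr0.
Qed.

End avoidable.

(** * The conditions hold with high probability for a fixed initial allocation *)

Section events.
Context d (T : measurableType d) (R : realType) (P : probability T R).
Context (m p : nat) (X : 'I_m -> T -> p.-tuple R).
Variables (a : 'I_p -> R) (l c0 F : R).
Hypothesis mX : forall i, measurable_fun setT (X i).
Hypothesis X_indep : mutually_independent P X.
Hypotheses (l0 : 0 < l) (c00 : 0 < c0) (F0 : 0 < F).
Hypothesis same_law : forall D i k, measurable D ->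
  pr P (X i @^-1` D) = pr P (X k @^-1` D).
(** All boxes used below lie within [3 * l] of [a]. *)
Hypothesis box_bounds : forall y h i, 0 <= h ->
  (forall j, a j - 4 * l <= y j) -> (forall j, y j + h <= a j + 4 * l) ->
  c0 * h ^+ p <= pr P (X i @^-1` box y h) <= F * h ^+ p.

Definition covariates (w : T) (i : 'I_m) (j : 'I_p) : R := tnth (X i w) j.

Lemma event_sigma i D : measurable D -> g_sigma_preimage X (X i @^-1` D).
Proof. exact: g_sigma_preimage_preimage. Qed.

Lemma hits_sigma (S : {set 'I_m}) D (Q : nat -> Prop) : measurable D ->
  g_sigma_preimage X [set w | Q (hits X S D w)].
Proof.
move=> mD; pose Q' (c : {ffun 'I_m -> bool}) := Q #|[set i in S | c i]%SET|.
rewrite (_ : [set w | _] = [set w | Q' [ffun i => `[< (X i @^-1` D) w >]]]).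
  exact: (algebra_boolean (algebra_g_sigma_preimage X) Q' (fun i => event_sigma i mD)).
have E w : #|[set i in S | [ffun i => `[< (X i @^-1` D) w >]] i]%SET| = hits X S D w.
  by apply: eq_card => i; rewrite !inE ffunE.
by apply/seteqP; split => w; rewrite /Q' /= E.
Qed.

Lemma hits_deviation (S : {set 'I_m}) (n : nat) D i0 (t : R) : #|S| = n -> measurable D -> 0 < t ->
  pr P [set w | t <= `|(hits X S D w)%:R - n%:R * pr P (X i0 @^-1` D)|] <= n%:R / t ^+ 2.
Proof.
move=> Sn mD t0; rewrite ler_pdivlMr ?exprn_gt0//.
by have := lln mX X_indep S mD (fun i => same_law i i0 mD) (ltW t0); rewrite Sn.
Qed.

(** The doubled window is cut into cells of side [e]. By Chebyshev each cell receives at least half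
    of the guaranteed mean [n * c0 * e ^+ p], and all points of the cell of a target are within [e]
    of it. *)
Lemma dense_event (S : {set 'I_m}) (n : nat) (e : R) : #|S| = n -> (0 < n)%N -> 0 < e -> e <= l ->
  avoidable P X ((4 * l / e + 1) ^+ p * (4 / (n%:R * (c0 * e ^+ p) ^+ 2)))
    (fun w => dense_points (covariates w) a l S e
      (Num.truncn (n%:R * (c0 * e ^+ p) / 4))).
Proof.
move=> Sn n0 e0 el; have l0' := l0.
have [i0 _] : exists i, i \in S by apply/card_gt0P; rewrite Sn.
pose M := (Num.truncn (4 * l / e)).+1.
pose y (z : {ffun 'I_p -> 'I_M}) j := a j - 2 * l + (z j)%:R * e.
pose D z := box (y z) e.
pose c := c0 * e ^+ p.
have c_gt0 : 0 < c by rewrite mulr_gt0// exprn_gt0.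
pose t := n%:R * c / 2.
have nR : 0 < n%:R :> R by rewrite ltr0n.
have t0 : 0 < t by rewrite divr_gt0// mulr_gt0.
pose q z := pr P (X i0 @^-1` D z).
pose B z := [set w | t <= `|(hits X S (D z) w)%:R - n%:R * q z|].
have GB z : g_sigma_preimage X (B z).
  exact: (hits_sigma S (fun k => is_true (t <= `|k%:R - n%:R * q z|)) (measurable_box _ _)).
have zM (z : {ffun 'I_p -> 'I_M}) j : (z j)%:R * e <= 4 * l.
  have h : (z j)%:R <= 4 * l / e.
    have r0 : 0 <= 4 * l / e by rewrite divr_ge0 ?(ltW e0)//; lra.
    have /andP[h _] := truncn_itv r0.
    by apply: le_trans h; rewrite ler_nat -ltnS.
  by move: h; rewrite ler_pdivlMr.
have cq z : c <= q z.
  suff /andP[] : c0 * e ^+ p <= q z <= F * e ^+ p by [].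
  apply: box_bounds => [|j|j]; first exact: ltW.
  - have h : 0 <= (z j)%:R * e by rewrite mulr_ge0// ltW.
    by rewrite /y; lra.
  - by rewrite /y; have := zM z j; lra.
exists [set w | exists z, B z w]; first exact: (algebra_exists (algebra_g_sigma_preimage X)).
split.
  apply: le_trans (pr_exists_le P (fun z => sigma_measurable mX (GB z))) _.
  apply: (@le_trans _ _ (\sum_(z : {ffun 'I_p -> 'I_M}) n%:R / t ^+ 2)).
    by apply: ler_sum => z _; apply: hits_deviation => //; exact: measurable_box.
  rewrite sumr_const card_ffun !card_ord -[leLHS]mulr_natl.
  have -> : n%:R / t ^+ 2 = 4 / (n%:R * c ^+ 2) by rewrite /t; field; rewrite !gt_eqF.
  apply: ler_wpM2r.
    by apply: divr_ge0 => //; apply: mulr_ge0; [exact: ltW|exact: sqr_ge0].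
  have Me : M%:R <= 4 * l / e + 1 by apply: grid_size => //; lra.
  by rewrite natrX lerXn2r// nnegrE// (le_trans _ Me).
move=> w nB y0 Wy.
have ay j : a j - 2 * l <= y0 j by have := Wy j; rewrite ler_norml => /andP[? _]; lra.
pose zz := [ffun j => inord (Num.truncn ((y0 j - (a j - 2 * l)) / e)) : 'I_M].
have zE j : (zz j : nat) = Num.truncn ((y0 j - (a j - 2 * l)) / e).
  rewrite ffunE inordK//; apply: grid_index_lt => //.
  by have := Wy j; rewrite ler_norml => /andP[_ ?]; lra.
apply: (@leq_trans (hits X S (D zz) w)).
  have h : `|(hits X S (D zz) w)%:R - n%:R * q zz| < t.
    by rewrite ltNge; apply/negP => h; apply: nB; exists zz.
  have h1 : n%:R * c / 2 < (hits X S (D zz) w)%:R.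
    move: h; rewrite ltr_norml => /andP[h _].
    have : n%:R * c <= n%:R * q zz by rewrite ler_pM2l.
    by rewrite /t in h; lra.
  have tr : 0 <= n%:R * c / 4 by rewrite divr_ge0// mulr_ge0// ltW.
  have /andP[h2 _] := truncn_itv tr.
  have nc0 : 0 < n%:R * c by rewrite mulr_gt0.
  by rewrite -(ltr_nat R); apply: le_lt_trans h2 _; lra.
apply: subset_leq_card; apply/fintype.subsetP => i; rewrite !inE => /andP[-> /asboolP Di] /=.
apply/asboolP => j; have := Di j; rewrite /y zE => /andP[h1 h2].
have /andP[h3 h4] := grid_index e0 (ay j).
by rewrite ler_norml /covariates; apply/andP; split; lra.
Qed.

(** The 9 counts the slices, and [(2 / l) ^+ p] bounds the inverse number of cells up to [h ^+ p].
    Slices have at least n/18 members, whence 324 = 18^2 and 36 = 2 * 18. *)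
Definition matching_const : R := 9 * (2 / l) ^+ p * (324 / c0 ^+ 2 + 36 * F ^+ 3 / c0 ^+ 4).

Lemma matching_arith (n N k : nat) (h : R) : (N = n %/ 9)%N -> (9 <= n)%N -> 0 < h ->
  l / (2 * h) <= k%:R ->
  9 * ((N%:R ^+ 2 * (k ^ p)%:R * (c0 * h ^+ p) ^+ 2)^-1 +
    2 * (F * h ^+ p) ^+ 3 / (N%:R * (k ^ p)%:R * (c0 * h ^+ p) ^+ 4)) <=
  matching_const * ((n%:R ^+ 2 * h ^+ p)^-1 + n%:R^-1).
Proof.
move=> NE n9 h0 lk; have l0' := l0; have c00' := c00; have F0' := F0.
pose D := h ^+ p; pose K : R := (k ^ p)%:R; pose lp := (l / 2) ^+ p.
have D0 : 0 < D by rewrite exprn_gt0.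
have lp0 : 0 < lp by rewrite exprn_gt0// divr_gt0.
have KD : lp <= K * D.
  rewrite /lp /K /D natrX -exprMn lerXn2r ?nnegrE//; [by pos_ge0|by pos_ge0|].
  by move: lk; rewrite ler_pdivrMr ?mulr_gt0//; lra.
have n0 : 0 < n%:R :> R by rewrite ltr0n; apply: leq_trans n9.
have N0 : (0 < N)%N by rewrite NE divn_gt0.
have N0R : 0 < N%:R :> R by rewrite ltr0n.
have nN : n%:R / 18 <= N%:R :> R.
  by have := leq_ninth n9; rewrite -NE -(ler_nat R) natrM; lra.
have K0 : 0 < K by move: (lt_le_trans lp0 KD); rewrite pmulr_lgt0.
have E1 : (N%:R ^+ 2 * K * (c0 * D) ^+ 2)^-1 = (N%:R ^+ 2 * (K * D) * (c0 ^+ 2 * D))^-1.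
  by congr (_^-1); ring.
have E2 : 2 * (F * D) ^+ 3 / (N%:R * K * (c0 * D) ^+ 4) =
    (2 * F ^+ 3 / c0 ^+ 4) * (N%:R * (K * D))^-1.
  by field; rewrite !gt_eqF.
have lpE : (2 / l) ^+ p = lp^-1 by rewrite /lp -exprVn invf_div.
rewrite /matching_const lpE -/D -/K E1 E2.
have I1 : (N%:R ^+ 2 * (K * D) * (c0 ^+ 2 * D))^-1 <= lp^-1 * (324 / c0 ^+ 2) * (n%:R ^+ 2 * D)^-1.
  have -> : lp^-1 * (324 / c0 ^+ 2) * (n%:R ^+ 2 * D)^-1 =
      ((n%:R / 18) ^+ 2 * lp * (c0 ^+ 2 * D))^-1.
    by field; rewrite !gt_eqF.
  rewrite lef_pV2 ?posrE; [|by pos_gt0|by pos_gt0].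
  apply: ler_pM => //; [by pos_ge0|by pos_ge0|].
  apply: ler_pM => //; first by pos_ge0.
  by rewrite lerXn2r// nnegrE; pos_ge0.
have I2 : (2 * F ^+ 3 / c0 ^+ 4) * (N%:R * (K * D))^-1 <=
    lp^-1 * (36 * F ^+ 3 / c0 ^+ 4) * n%:R^-1.
  have -> : lp^-1 * (36 * F ^+ 3 / c0 ^+ 4) * n%:R^-1 =
      (2 * F ^+ 3 / c0 ^+ 4) * ((n%:R / 18) * lp)^-1.
    by field; rewrite !gt_eqF.
  apply: ler_wpM2l; first by pos_ge0.
  rewrite lef_pV2 ?posrE; [|by pos_gt0|by pos_gt0].
  by apply: ler_pM => //; pos_ge0.
have lpV : 0 <= lp^-1 by rewrite invr_ge0 ltW.
have c1 : 0 <= 324 / c0 ^+ 2 := divr_ge0 (ler0n _ _) (sqr_ge0 _).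
have c2 : 0 <= 36 * F ^+ 3 / c0 ^+ 4.
  exact: divr_ge0 (mulr_ge0 (ler0n _ _) (exprn_ge0 _ (ltW F0))) (exprn_ge0 _ (ltW c00)).
have nV : 0 <= n%:R^-1 :> R by rewrite invr_ge0.
have nDV : 0 <= (n%:R ^+ 2 * D)^-1.
  by rewrite invr_ge0; exact: mulr_ge0 (sqr_ge0 _) (ltW D0).
have pos1 : 0 <= lp^-1 * (324 / c0 ^+ 2) * n%:R^-1 := mulr_ge0 (mulr_ge0 lpV c1) nV.
have pos2 : 0 <= lp^-1 * (36 * F ^+ 3 / c0 ^+ 4) * (n%:R ^+ 2 * D)^-1 :=
  mulr_ge0 (mulr_ge0 lpV c2) nDV.
move: I1 I2 pos1 pos2.
set A := (n%:R ^+ 2 * D)^-1; set B := n%:R^-1; set A1 := (_ * (K * D) * _)^-1.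
set B1 := _ * (N%:R * _)^-1; set C1 := 324 / _; set C2 := 36 * _ / _.
by move=> I1 I2 p1 p2; clear -I1 I2 p1 p2; lra.
Qed.

(** Let [u t] be the lower corner of the mesh cell of [v]. A pair with one member in a cell and the
    other in its translate by [u t] differs from [v] by at most [2 * h]. The union bound runs over
    the mesh vectors and the nine slices; the many cells [z] are what makes such a pair likely. *)
Lemma matching_event (S : {set 'I_m}) (n : nat) (r h : R) :
  #|S| = n -> #|(~: S)%SET| = n -> (9 <= n)%N -> 0 <= r -> r <= l / 2 -> 0 < h -> h <= l ->
  avoidable P X ((2 * r / h + 1) ^+ p *
      (matching_const * ((n%:R ^+ 2 * h ^+ p)^-1 + n%:R^-1)))
    (fun w => matching_pairs (covariates w) a l S r (2 * h)).
Proof.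
move=> Sn Cn n9 r0 rl h0 hl; have l0' := l0.
pose N := (n %/ 9)%N; have N0 : (0 < N)%N by rewrite divn_gt0.
pose K := Num.truncn (l / h); pose M := (Num.truncn (2 * r / h)).+1.
have lh0 : 0 <= l / h by pos_ge0.
have rh0 : 0 <= 2 * r / h by pos_ge0.
have /andP[Kl lK] : K%:R <= l / h < K.+1%:R := truncn_itv lh0.
have K1 : (0 < K)%N by rewrite truncn_gt0 ler_pdivlMr// mul1r.
have K1R : 1 <= K%:R :> R by rewrite ler1n.
rewrite ler_pdivlMr// in Kl; rewrite ltr_pdivrMr// -natr1 mulrDl mul1r in lK.
have lK2 : l / (2 * h) <= K%:R.
  rewrite ler_pdivrMr ?mulr_gt0//; have : h <= K%:R * h by rewrite ler_peMl// ltW.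
  lra.
(* The cells fill only the cube of half-side [l / 2], so that translates by at most [r <= l / 2]
   remain in the window. *)
pose y (z : {ffun 'I_p -> 'I_K}) j := a j - l / 2 + (z j)%:R * h.
pose u (t : {ffun 'I_p -> 'I_M}) j := - r + (t j)%:R * h.
have zK (z : {ffun 'I_p -> 'I_K}) j : 0 <= (z j)%:R * h /\ (z j)%:R * h + h <= l.
  split; first by rewrite mulr_ge0// ltW.
  apply: le_trans Kl; rewrite -[X in _ + X]mul1r -mulrDl natr1 ler_pM2r// ler_nat.
  exact: ltn_ord.
have tM (t : {ffun 'I_p -> 'I_M}) j : 0 <= (t j)%:R * h /\ (t j)%:R * h <= 2 * r.
  split; first by rewrite mulr_ge0// ltW.
  have /andP[t1 _] := truncn_itv rh0.
  by rewrite -ler_pdivlMr//; apply: le_trans t1; rewrite ler_nat -ltnS.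
pose C z := box (y z) h; pose C' t z := box (fun j => y z j + u t j) h.
pose B (t : {ffun 'I_p -> 'I_M}) (g : 'I_9) := [set w | forall i k z, i \in slice S N g ->
   k \in slice (~: S) N g -> ~ (C z (X i w) /\ C' t z (X k w))].
have GB t g : g_sigma_preimage X (B t g).
  have aG := algebra_g_sigma_preimage X; have [_ GC _] := aG.
  do 3 (apply: (algebra_forall aG) => ?); do 2 apply: (algebra_imply aG).
  by apply: GC; apply: (algebraI aG); apply: event_sigma; exact: measurable_box.
pose c := c0 * h ^+ p; pose Q := F * h ^+ p.
have c_gt0 : 0 < c by pos_gt0.
have CQ i z : c <= pr P (X i @^-1` C z) <= Q.
  apply: box_bounds => [|j|j]; first exact: ltW.
    by have [? ?] := zK z j; rewrite /y; lra.
  by have [? ?] := zK z j; rewrite /y; lra.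
have C'Q t i z : c <= pr P (X i @^-1` C' t z) <= Q.
  apply: box_bounds => [|j|j]; first exact: ltW.
    by have [? ?] := zK z j; have [? ?] := tM t j; rewrite /y /u; lra.
  by have [? ?] := zK z j; have [? ?] := tM t j; rewrite /y /u; lra.
have prB t g : pr P (B t g) <= (N%:R ^+ 2 * (K ^ p)%:R * c ^+ 2)^-1 +
    2 * Q ^+ 3 / (N%:R * (K ^ p)%:R * c ^+ 4).
  have ZE : #|{ffun 'I_p -> 'I_K}| = (K ^ p)%N by rewrite card_ffun !card_ord.
  rewrite -ZE; apply: (pair_exists mX X_indep) => //.
  - by move=> z; exact: measurable_box.
  - by move=> z; exact: measurable_box.
  - move=> z z' v vz vz'; apply/ffunP => j; apply: val_inj.
    exact: grid_unique h0 (vz j) (vz' j).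
  - move=> z z' v vz vz'; apply/ffunP => j; apply: val_inj.
    have ye z0 : y z0 j + u t j = a j - l / 2 + u t j + (z0 j)%:R * h by rewrite /y; ring.
    apply: (@grid_unique _ (a j - l / 2 + u t j) h (tnth v j)) => //.
      by rewrite -ye; exact: vz.
    by rewrite -ye; exact: vz'.
  - rewrite disjoint_subset; apply/fintype.subsetP => i iS.
    by apply/negP => /slice_sub; rewrite inE (slice_sub iS).
  - by apply: card_slice; rewrite Sn leq_slice.
  - by apply: card_slice; rewrite Cn leq_slice.
  - by rewrite ZE expn_gt0 K1.
exists [set w | exists tg : {ffun 'I_p -> 'I_M} * 'I_9, B tg.1 tg.2 w].
  by apply: (algebra_exists (algebra_g_sigma_preimage X)) => tg; exact: GB.
split.
  apply: le_trans (pr_exists_le P (fun tg => sigma_measurable mX (GB tg.1 tg.2))) _.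
  apply: le_trans (ler_sum _ (fun tg _ => prB tg.1 tg.2)) _.
  rewrite sumr_const card_prod card_ffun !card_ord -[leLHS]mulr_natl natrM -mulrA.
  have Me : M%:R <= 2 * r / h + 1 by apply: grid_size => //; lra.
  have Mc : (M ^ p)%:R <= (2 * r / h + 1) ^+ p.
    by rewrite natrX lerXn2r// nnegrE// (le_trans _ Me).
  apply: ler_pM => //; last exact: matching_arith.
  apply: mulr_ge0; first exact: ler0n.
  apply: addr_ge0; first by rewrite invr_ge0; pos_ge0.
  have : 0 <= Q by rewrite /Q; pos_ge0.
  by move=> ?; pos_ge0.
move=> w nB v D D8 vr.
have vr' j : - r <= v j by have := vr j; rewrite ler_norml => /andP[].
pose t := [ffun j => inord (Num.truncn ((v j - - r) / h)) : 'I_M].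
have tE j : (t j : nat) = Num.truncn ((v j - - r) / h).
  rewrite ffunE inordK//; apply: grid_index_lt => //.
  by have := vr j; rewrite ler_norml => /andP[_ ?]; lra.
have [g gD] := @untouched_slice _ S N D D8.
have [i [k [z [iS kS Ci Ck]]]] : exists i k z, [/\ i \in slice S N g,
    k \in slice (~: S) N g, C z (X i w) & C' t z (X k w)].
  apply: contrapT => no; apply: nB; exists (t, g) => i k z iS kS [Ci Ck].
  by apply: no; exists i, k, z.
exists i, k; rewrite finset.in_setD finset.in_setU (slice_sub iS) gD; last by left.
have := slice_sub kS; rewrite inE => kS'.
rewrite negb_or kS' gD; last by right.
split=> // j; rewrite /covariates; have := Ci j; have := Ck j; have [z1 z2] := zK z j;
  have [t1 t2] := tM t j; rewrite /y /u.
- by move=> /andP[_ _] /andP[h1 h2]; rewrite ler_norml; apply/andP; split; lra.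
- by move=> /andP[h1 h2] _; rewrite ler_norml; apply/andP; split; lra.
- have /andP[h3 h4] := grid_index h0 (vr' j); rewrite -tE in h3 h4.
  by move=> /andP[h1 h2] /andP[h5 h6]; rewrite ler_norml; apply/andP; split; lra.
Qed.

(** All points within [r] of a point of a cell of side [r] lie in the concentric box of side
    [3 * r]. Two neighbours of one individual thus put three individuals in one such box. *)
Lemma isolated_event (r : R) : 0 < r -> r <= l ->
  avoidable P X ((2 * l / r + 1) ^+ p * m%:R ^+ 3 * (F * (3 * r) ^+ p) ^+ 3)
    (fun w => isolated_pairs (covariates w) a l r).
Proof.
move=> r0 rl; have l0' := l0.
pose M := (Num.truncn (2 * l / r)).+1.
have lr0 : 0 <= 2 * l / r by pos_ge0.
pose y (z : {ffun 'I_p -> 'I_M}) j := a j - l + (z j)%:R * r - r.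
pose C z := box (y z) (3 * r).
have zM (z : {ffun 'I_p -> 'I_M}) j : 0 <= (z j)%:R * r /\ (z j)%:R * r <= 2 * l.
  split; first by rewrite mulr_ge0// ltW.
  have /andP[t1 _] := truncn_itv lr0.
  by rewrite -ler_pdivlMr//; apply: le_trans t1; rewrite ler_nat -ltnS.
have CQ i z : pr P (X i @^-1` C z) <= F * (3 * r) ^+ p.
  suff /andP[] : c0 * (3 * r) ^+ p <= pr P (X i @^-1` C z) <= F * (3 * r) ^+ p by [].
  apply: box_bounds => [|j|j]; first by pos_ge0.
    by have [? ?] := zM z j; rewrite /y; lra.
  by have [? ?] := zM z j; rewrite /y; lra.
pose B := [set w | exists b : {ffun 'I_p -> 'I_M} * ('I_m * ('I_m * 'I_m)),
  uniq [:: b.2.1; b.2.2.1; b.2.2.2] /\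
  [/\ C b.1 (X b.2.1 w), C b.1 (X b.2.2.1 w) & C b.1 (X b.2.2.2 w)]].
exists B.
  have aG := algebra_g_sigma_preimage X; apply: (algebra_exists aG) => b.
  have sC i : g_sigma_preimage X (X i @^-1` C b.1).
    by apply: event_sigma; exact: measurable_box.
  rewrite (_ : (fun w => _) = [set _ | uniq [:: b.2.1; b.2.2.1; b.2.2.2]] `&`
    (X b.2.1 @^-1` C b.1 `&` (X b.2.2.1 @^-1` C b.1 `&` X b.2.2.2 @^-1` C b.1))).
    apply: (algebraI aG); first exact: (algebra_cst aG).
    by apply: (algebraI aG) => //; exact: (algebraI aG).
  by apply/seteqP; split => w; [move=> [? [? ? ?]]|move=> [? [? [? ?]]]].
split.
  apply: le_trans (triple_le mX X_indep (fun z => measurable_box (y z) (3 * r)) CQ) _.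
  rewrite card_ffun !card_ord.
  have Me : M%:R <= 2 * l / r + 1 by apply: grid_size => //; lra.
  have Mc : (M ^ p)%:R <= (2 * l / r + 1) ^+ p.
    by rewrite natrX lerXn2r// nnegrE// (le_trans _ Me).
  have Q0 : 0 <= (F * (3 * r) ^+ p) ^+ 3 by pos_ge0.
  have m0 : 0 <= m%:R ^+ 3 :> R by exact: exprn_ge0.
  by apply: ler_wpM2r => //; apply: ler_wpM2r.
move=> w nB i k k' Wi ik ik' ik0 ik0'; apply/eqP; apply: contrapT => /negP kk'.
have xl j : a j - l <= covariates w i j.
  by have := Wi j; rewrite ler_norml => /andP[? _]; lra.
pose z := [ffun j => inord (Num.truncn ((covariates w i j - (a j - l)) / r)) : 'I_M].
have zE j : (z j : nat) = Num.truncn ((covariates w i j - (a j - l)) / r).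
  rewrite ffunE inordK//; apply: grid_index_lt => //.
  by have := Wi j; rewrite ler_norml => /andP[_ ?]; lra.
have xz j : a j - l + (z j)%:R * r <= covariates w i j < a j - l + (z j)%:R * r + r.
  by rewrite zE; exact: grid_index.
have near b : close_to r (covariates w b) (covariates w i) -> C z (X b w).
  move=> wb j; have := wb j; have /andP[h1 h2] := xz j; rewrite /y -/(covariates w b j).
  by rewrite ler_norml => /andP[h3 h4]; apply/andP; split; lra.
apply: nB; exists (z, (i, (k, k'))); split; last first.
  by split; apply: near => // j; rewrite subrr normr0 ltW.
by rewrite /= !inE negb_or ik0 ik0' kk'.
Qed.

End events.

(** * Law of large numbers for the initial imbalance *)

Section imbalance_event.
Context d (T : measurableType d) (R : realType) (P : probability T R).
Context (m p : nat) (X : 'I_m -> T -> p.-tuple R).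
Hypothesis mX : forall i, measurable_fun setT (X i).
Hypothesis X_indep : mutually_independent P X.
Hypothesis same_law : forall D i k, measurable D ->
  pr P (X i @^-1` D) = pr P (X k @^-1` D).

(** In each slab the counts of both groups are within [t * n] of the same mean, hence within
    [2 * t * n] of each other. The moment bound [M] stays a premise inside the event, because it is
    obtained separately from Markov's inequality. *)
Lemma imbalance_event (S : {set 'I_m}) (n N : nat) (c : 'I_p -> R) (h t : R) :
  m = (2 * n)%N -> #|S| = n -> #|(~: S)%SET| = n -> (0 < n)%N -> (0 < N)%N -> 0 < h -> 0 < t ->
  avoidable P X (4 * p%:R * N%:R / (t ^+ 2 * n%:R))
    (fun w => forall M j, sum_dev (fun i => X i w) (c j) j <= M ->
      `|imbalance (covariates X w) (sample_mean (fun i => X i w)) S j| <=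
      (2 * N%:R ^+ 2 * h * (2 * (t * n%:R)) + 2 * n%:R * h + M / (N%:R * h)) / 2).
Proof.
move=> mE Sn Cn n0 N0 h0 t0.
have [i0 _] : exists i, i \in S by apply/card_gt0P; rewrite Sn.
have nR : 0 < n%:R :> R by rewrite ltr0n.
pose D j k := [set v : p.-tuple R | in_slab h N k (tnth v j - c j)].
have mD j k : measurable (D j k).
  pose b := c j - N%:R * h + k%:R * h.
  have := @measurable_tnth_itv R p j `[b, b + h[%R.
  congr measurable; apply/seteqP; split => v; rewrite /D /in_slab /= in_itv/= /b.
    by move=> /andP[? ?]; apply/andP; split; lra.
  by move=> /andP[? ?]; apply/andP; split; lra.
pose SS (b : bool) := if b then S else (~: S)%SET.
have SSn b : #|SS b| = n by case: b.
pose q j k := pr P (X i0 @^-1` D j k).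
pose B (a : 'I_p * 'I_(2 * N) * bool) := [set w |
  t * n%:R <= `|(hits X (SS a.2) (D a.1.1 a.1.2) w)%:R - n%:R * q a.1.1 a.1.2|].
have GB a : g_sigma_preimage X (B a).
  exact: (hits_sigma (SS a.2) (fun k => is_true (t * n%:R <= `|k%:R - n%:R * q a.1.1 a.1.2|)) (mD _ _)).
exists [set w | exists a, B a w].
  exact: (algebra_exists (algebra_g_sigma_preimage X)).
split.
  apply: le_trans (pr_exists_le P (fun a => sigma_measurable mX (GB a))) _.
  apply: (@le_trans _ _ (\sum_(a : 'I_p * 'I_(2 * N) * bool) n%:R / (t * n%:R) ^+ 2)).
    apply: ler_sum => a _; apply: hits_deviation => //; exact: mulr_gt0.
  rewrite sumr_const !card_prod !card_ord card_bool -[leLHS]mulr_natl !natrM.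
  by rewrite le_eqVlt; apply/orP; left; apply/eqP; field; rewrite !gt_eqF.
move=> w nB M j cM; rewrite (imbalance_half _ (c j) _ mE n0 Sn Cn).
rewrite normrM [`|2^-1|]ger0_norm ?invr_ge0// ler_pM2r ?invr_gt0//.
apply: (slab_imbalance h0 N0 Sn Cn) => //; first by rewrite !mulr_ge0// ltW.
move=> k.
have dev b : `|(hits X (SS b) (D j k) w)%:R - n%:R * q j k| < t * n%:R.
  by rewrite ltNge; apply/negP => h1; apply: nB; exists (j, k, b).
have E b : #|[set i in SS b | in_slab h N k (tnth (X i w) j - c j)]%SET| = hits X (SS b) (D j k) w.
  by apply: eq_card => i; rewrite !inE; congr (_ && _); apply/idP/asboolP.
have := dev true; have := dev false; rewrite -!E /SS.
set u := _%:R; set v := _%:R; set r := n%:R * _; rewrite !ltr_norml.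
by move=> /andP[? ?] /andP[? ?]; rewrite ler_norml; apply/andP; split; lra.
Qed.

End imbalance_event.

Lemma matching_pairs_le (R : realType) (I : finType) p (x : I -> 'I_p -> R) a l (S : {set I}) r r' e e' :
  r <= r' -> e' <= e -> matching_pairs x a l S r' e' -> matching_pairs x a l S r e.
Proof.
move=> rr ee mp v D D8 vr; have [|i [k [iS kS Wi Wk ik]]] := mp v D D8.
  by move=> j; exact: le_trans rr.
by exists i, k; split=> // j; exact: le_trans ee.
Qed.

(** * The events at the scales given by powers of [u] *)

Section conditional_events.
Context d (T : measurableType d) (R : realType) (P : probability T R).
Context (p n : nat) (u : R) (X : 'I_(2 * n) -> T -> p.-tuple R) (S : {set 'I_(2 * n)}).
Variables (a : 'I_p -> R) (l c0 F : R).
Hypothesis mX : forall i, measurable_fun setT (X i).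
Hypothesis X_indep : mutually_independent P X.
Hypotheses (l0 : 0 < l) (c00 : 0 < c0) (F0 : 0 < F).
Hypothesis same_law : forall D i k, measurable D ->
  pr P (X i @^-1` D) = pr P (X k @^-1` D).
Hypothesis box_bounds : forall y h i, 0 <= h ->
  (forall j, a j - 4 * l <= y j) -> (forall j, y j + h <= a j + 4 * l) ->
  c0 * h ^+ p <= pr P (X i @^-1` box y h) <= F * h ^+ p.
Hypotheses (p0 : (0 < p)%N) (u0 : 0 < u) (u1 : u <= 1) (nu : n%:R * u ^+ (8 * p) = 1).
Hypotheses (Sn : #|S| = n) (Cn : #|(~: S)%SET| = n) (n9 : (9 <= n)%N).

Let Cm := matching_const p l c0 F.

Lemma matching_const_ge0 : 0 <= Cm.
Proof.
rewrite /Cm /matching_const; apply: mulr_ge0.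
  by rewrite mulr_ge0// exprn_ge0// divr_ge0// ltW.
apply: addr_ge0; first exact: divr_ge0 (ler0n _ _) (sqr_ge0 _).
exact: divr_ge0 (mulr_ge0 (ler0n _ _) (exprn_ge0 _ (ltW F0))) (exprn_ge0 _ (ltW c00)).
Qed.

Lemma jump_event (b1 b2 : nat) (rho : R) : 0 <= rho -> (b1 <= b2)%N ->
  (2 * b2 + 1 <= 16 + b1)%N -> (b2 <= b1 + 7)%N ->
  rho * u ^+ b1 <= l / 2 -> u ^+ b2 <= l ->
  avoidable P X ((4 * rho + 1) ^+ p * (Cm * (2 ^+ p + 1)) * u)
    (fun w => matching_pairs (covariates X w) a l S (rho * u ^+ b1) (u ^+ b2)).
Proof.
move=> rho0 b12 h1 h2 rl ul.
have ub : 0 < u ^+ b2 by exact: exprn_gt0.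
apply: (avoidable_le (matching_event mX X_indep l0 c00 F0 box_bounds
  (r := rho * u ^+ b1) (h := u ^+ b2 / 2) Sn Cn n9 _ rl _ _)).
- by rewrite mulr_ge0// exprn_ge0// ltW.
- exact: divr_gt0.
- by apply: le_trans ul; lra.
- exact: (scale_jump p0 u0 u1 nu rho0 matching_const_ge0).
- by move=> w; apply: matching_pairs_le => //; lra.
Qed.

(** On a dyadic shell, matching vectors up to its upper end with an accuracy proportional to its
    lower end serves every [r] of the shell. The failure probabilities form a geometric series with
    sum at most twice the first term. *)
Lemma levels_event (Lam g Mf : R) : 0 < g -> 4 * (g * Lam) = 1 -> 0 < Mf -> 2 <= g * Mf ->
  4 * Lam * u <= l -> u <= l ->
  avoidable P X ((8 / g + 1) ^+ p * Cm * (8 / g) / Mf) (fun w => forall r,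
    Mf * u ^+ 16 <= r <= Lam * u ^+ 13 -> matching_pairs (covariates X w) a l S r (g * r)).
Proof.
move=> g0 gL Mf0 gM Lu ul.
pose r0 := Mf * u ^+ 16; have r00 : 0 < r0 by rewrite mulr_gt0// exprn_gt0.
have u13 : 0 < u ^+ 13 by exact: exprn_gt0.
have u13u : u ^+ 13 <= u by rewrite -[leRHS]expr1; apply: ler_wiXn2l => //; exact: ltW.
have Lam0 : 0 < Lam.
  have gL0 : 0 < g * Lam by lra.
  by rewrite -(pmulr_rgt0 _ g0).
pose NL := (Num.truncn (Lam * u ^+ 13 / r0)).+1.
pose b (k : 'I_NL) : R := (8 / g + 1) ^+ p * Cm * (4 / (g * Mf)) * 2^-1 ^+ k.
pose Q (k : 'I_NL) w := r0 * 2 ^+ k <= Lam * u ^+ 13 ->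
  matching_pairs (covariates X w) a l S (r0 * 2 ^+ k.+1) (g * (r0 * 2 ^+ k)).
have Cm0 := matching_const_ge0.
have c1 : 0 <= (8 / g + 1) ^+ p * Cm.
  by apply: mulr_ge0 => //; pos_ge0.
have c2 : 0 <= (8 / g + 1) ^+ p * Cm * (4 / (g * Mf)).
  by apply: mulr_ge0 => //; pos_ge0.
have avk k : avoidable P X (b k) (Q k).
  (* The crude range of [k] also contains shells above [Lam * u ^+ 13], of which nothing is
     asked. *)
  have [cond|cond] := leP (r0 * 2 ^+ k) (Lam * u ^+ 13); last first.
    apply: avoidable_trivial; first by rewrite mulr_ge0// exprn_ge0// invr_ge0.
    by move=> w h; move: cond; rewrite ltNge h.
  have q0 : 0 < r0 * 2 ^+ k by rewrite mulr_gt0// exprn_gt0.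
  have gq : g * (r0 * 2 ^+ k) <= u ^+ 13 / 4.
    have : g * (r0 * 2 ^+ k) <= g * (Lam * u ^+ 13) by rewrite ler_pM2l.
    have -> : g * (Lam * u ^+ 13) = 4 * (g * Lam) * u ^+ 13 / 4.
      by move: (u ^+ 13) => y; field.
    by rewrite gL mul1r.
  apply: (avoidable_le (matching_event mX X_indep l0 c00 F0 box_bounds
    (r := r0 * 2 ^+ k.+1) (h := g * (r0 * 2 ^+ k) / 2) Sn Cn n9 _ _ _ _)).
  - by rewrite mulr_ge0 ?(ltW r00)// exprn_ge0.
  - rewrite exprS mulrCA; have : Lam * u ^+ 13 <= Lam * u by rewrite ler_pM2l.
    by move: cond; move: (r0 * 2 ^+ k) (Lam * u ^+ 13) => y z; lra.
  - by rewrite divr_gt0// mulr_gt0.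
  - by move: gq u13u ul u13; move: (g * _) (u ^+ 13) => y z; lra.
  - exact: (scale_level p0 u0 u1 nu g0 gL Mf0 gM Cm0 cond).
  - move=> w mp _; apply: matching_pairs_le mp => //.
    by move: (g * _) => y; lra.
apply: (avoidable_le (avoidable_forall mX avk)).
  rewrite /b -mulr_sumr; apply: (@le_trans _ _ ((8 / g + 1) ^+ p * Cm * (4 / (g * Mf)) * 2)).
    by rewrite ler_wpM2l// half_sum.
  rewrite le_eqVlt; apply/orP; left; apply/eqP.
  by move: ((8 / g + 1) ^+ p) => y; field; rewrite !gt_eqF.
move=> w Qw r /andP[r1 r2].
have [k kN /andP[k1 k2]] := dyadic r00 r1.
have kN' : (k < NL)%N.
  apply: leq_trans kN _; rewrite ltnS; apply: le_truncn.
  by rewrite ler_pM2r ?invr_gt0.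
have := Qw (Ordinal kN') (le_trans k1 r2); apply: matching_pairs_le; first exact: ltW.
by rewrite ler_pM2l.
Qed.

Lemma isolated_scale_event (rho : R) : 0 < rho -> rho * u <= l ->
  avoidable P X (8 * F ^+ 3 * (81 * l * rho ^+ 2) ^+ p * u)
    (fun w => isolated_pairs (covariates X w) a l (rho * u ^+ 13)).
Proof.
move=> rho0 rl.
have u13u : u ^+ 13 <= u by rewrite -[leRHS]expr1; apply: ler_wiXn2l => //; exact: ltW.
have rl' : rho * u ^+ 13 <= l by apply: le_trans rl; rewrite ler_pM2l.
have r0 : 0 < rho * u ^+ 13 by rewrite mulr_gt0// exprn_gt0.
apply: (avoidable_le (isolated_event mX X_indep l0 F0 box_bounds r0 rl')) => //.
exact: (scale_isolated p0 u0 u1 nu).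
Qed.

End conditional_events.

(** * Density and moments *)

Section density.
Context d (T : measurableType d) (R : realType) (P : probability T R) (p : nat).
Variables (f : 'rV[R]_p -> R).
Hypothesis f_ge0 : forall t, 0 <= f t.

(** [f] integrates to 1, so it is positive at some point, and by continuity it stays comparable to
    its value there on a cube. *)
Lemma density_positive_cube (X : T -> p.-tuple R) : unif_continuous f ->
  has_joint_density P X f ->
  exists (a : 'I_p -> R) (l c0 F : R), [/\ 0 < l, 0 < c0, 0 < F &
    forall t : p.-tuple R, (forall j, `|tnth t j - a j| <= 4 * l) ->
      c0 <= f (\row_j tnth t j) <= F].
Proof.
move=> fu Xf.
have [t ft] : exists t, 0 < f t.
  apply: contrapT => no.
  have f0 t : f t = 0.
    apply/eqP; rewrite eq_le f_ge0 andbT leNgt; apply/negP => ft; apply: no; by exists t.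
  have := Xf setT measurableT; rewrite preimage_setT probability_setT.
  rewrite (eq_integral (cst 0%E)); last by move=> t _; rewrite f0.
  by rewrite integral0 => /eqP; rewrite onee_eq0.
have [e e0 fe] := (unif_continuousP f).1 fu (f t / 2) (divr_gt0 ft (ltr0Sn _ 1)).
(* Now [4 * l] is [e / 2], so the closed cube lies in the open ball of radius [e] for the sup norm,
   where [f] is within [f t / 2] of [f t]. *)
exists (fun j => t ord0 j), (e / 8), (f t / 2), (3 * f t / 2).
have e0' : 0 < e := e0.
split; try by lra.
move=> s st; have : ball t e (\row_j tnth s j).
  rewrite mx_norm_ball /ball_ /=.
  rewrite /Num.norm/= mx_normrE; apply/bigmax_ltP; split=> // -[i j] _ /=.
  rewrite !mxE (ord1 i) distrC; apply: le_lt_trans (st j) _.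
  by lra.
move=> /(fe (t, _)) /=; rewrite -ball_normE /ball_ /= ltr_norml => /andP[h1 h2].
by apply/andP; split; lra.
Qed.

Lemma density_same_law (X Y : T -> p.-tuple R) D : has_joint_density P X f ->
  has_joint_density P Y f -> measurable D -> P (X @^-1` D) = P (Y @^-1` D).
Proof. by move=> Xf Yf mD; rewrite Xf// Yf. Qed.

Lemma density_same_integral (X Y : {RV P >-> p.-tuple R}) (g : p.-tuple R -> R) :
  has_joint_density P X f -> has_joint_density P Y f ->
  measurable_fun [set: p.-tuple R] g -> (forall t, 0 <= g t) ->
  (\int[P]_w (g (X w))%:E = \int[P]_w (g (Y w))%:E)%E.
Proof.
move=> Xf Yf mg g0.
have pf (Z : {RV P >-> p.-tuple R}) :
    (\int[P]_w (g (Z w))%:E = \int[pushforward P Z]_t (g t)%:E)%E.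
  rewrite ge0_integral_pushforward//; first exact/measurable_EFinP.
  by move=> t _; rewrite lee_fin.
rewrite !pf; apply: eq_measure_integral => A mA _.
exact: (density_same_law Xf Yf mA).
Qed.

End density.

Section moments.
Context d (T : measurableType d) (R : realType) (P : probability T R).

Lemma markov_pr (g : T -> R) (K v : R) : measurable_fun setT g -> (forall w, 0 <= g w) ->
  (\int[P]_w (g w)%:E <= v%:E)%E -> 0 < K -> pr P [set w | K < g w] <= v / K.
Proof.
move=> mg g0 gv K0; rewrite ler_pdivlMr//.
have mA : measurable [set w | K < g w].
  rewrite -[X in measurable X]setTI (_ : [set w | _] = g @^-1` `]K, +oo[).
    exact: mg.
  by apply/seteqP; split => w; rewrite /= in_itv/= andbT.
rewrite -lee_fin; apply: le_trans gv; rewrite EFinM -prE// muleC -integral_cst//.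
apply: (@le_trans _ _ (\int[P]_(w in [set w | (K < g w)%R]) (g w)%:E)%E).
  apply: ge0_le_integral_nomeas => w /=; first by move=> _; rewrite lee_fin ltW.
  by move=> Kg; rewrite lee_fin ltW.
apply: ge0_subset_integral => //; first exact/measurable_EFinP.
by move=> w _; rewrite lee_fin.
Qed.

Lemma variance_moment (Y : T -> R) : ('V_P[Y] < +oo)%E ->
  (\int[P]_w ((Y w - fine 'E_P[Y]) ^+ 2)%:E < +oo)%E.
Proof.
rewrite /variance !unlock.
by under eq_integral do rewrite /= -expr2.
Qed.

End moments.

(** * Measurability of the balance of a fixed allocation *)

Section measurability.
Context d (T : measurableType d) (R : realType) (m p : nat) (X : 'I_m -> T -> p.-tuple R).
Hypothesis mX : forall i, measurable_fun setT (X i).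

Lemma measurable_coordinate i j : measurable_fun setT (fun w => tnth (X i w) j).
Proof. by apply: (measurableT_comp (@measurable_tnth _ R p j)); exact: mX. Qed.

Lemma measurable_sample_mean j : measurable_fun setT (fun w => sample_mean (fun i => X i w) j).
Proof.
apply: measurable_funM => //; apply: measurable_sum => i; exact: measurable_coordinate.
Qed.

Lemma measurable_sum_dev c j : measurable_fun setT (fun w => sum_dev (fun i => X i w) c j).
Proof.
apply: measurable_sum => i; apply: measurable_funX; apply: measurable_funB => //.
exact: measurable_coordinate.
Qed.

Lemma measurable_sample_sd j : measurable_fun setT (fun w => sample_sd (fun i => X i w) j).
Proof.
apply: measurableT_comp; first by apply: continuous_measurable_fun; exact: sqrt_continuous.
apply: measurable_funM => //; apply: measurable_sum => i; apply: measurable_funX.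
by apply: measurable_funB; [exact: measurable_coordinate|exact: measurable_sample_mean].
Qed.

Lemma measurable_standardized i j : measurable_fun setT (fun w => standardized (fun i => X i w) i j).
Proof.
apply: measurable_funM.
  by apply: measurable_funB; [exact: measurable_coordinate|exact: measurable_sample_mean].
(* Inverse and power agree on all nonnegative reals: at a vanishing standard deviation both are
   0. *)
rewrite (_ : (fun _ => _) = (fun w => sample_sd (fun i => X i w) j `^ (-1))); last first.
  by apply/funext => w; rewrite powR_inv1// sqrtr_ge0.
exact: (measurableT_comp (measurable_powR (-1)) (measurable_sample_sd j)).
Qed.

End measurability.

Lemma measurable_balance d (T : measurableType d) (R : realType) (n p : nat)
    (X : 'I_(2 * n) -> T -> p.-tuple R) (S : {set 'I_(2 * n)}) :
  (forall i, measurable_fun setT (X i)) ->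
  measurable_fun setT (fun w => balance (fun i => X i w) S).
Proof.
move=> mX; apply: measurable_funM => //; apply: measurable_sum => j.
apply: measurableT_comp => //; under eq_fun do rewrite big_mkcond/=.
apply: measurable_sum => i; case: (i \in S) => //; exact: measurable_standardized.
Qed.

(** * The rate *)

Lemma small_scale (R : realType) (u B x : R) : 0 < u -> u * B <= 1 -> 0 <= x -> x <= B -> u * x <= 1.
Proof. by move=> u0 uB x0 xB; apply: le_trans uB; rewrite ler_pM2l. Qed.

Lemma le_sum5 (R : realType) (x1 x2 x3 x4 x5 : R) :
  0 <= x1 -> 0 <= x2 -> 0 <= x3 -> 0 <= x4 -> 0 <= x5 ->
  [/\ x1 <= x1 + x2 + x3 + x4 + x5, x2 <= x1 + x2 + x3 + x4 + x5,
    x3 <= x1 + x2 + x3 + x4 + x5, x4 <= x1 + x2 + x3 + x4 + x5 & x5 <= x1 + x2 + x3 + x4 + x5].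
Proof. by move=> *; split; lra. Qed.

Lemma eighth_le (R : realType) (x y : R) : 8 <= x -> x / 4 < y + 1 -> x / 8 <= y.
Proof. by move=> h1 h2; lra. Qed.

Lemma div_scale_le (R : realType) (A b m u : R) : 0 <= A -> 0 < b -> 0 < m -> m^-1 <= u ->
  A * (4 / (m * b)) <= A * (4 / b) * u.
Proof.
move=> A0 b0 m0 mu; have -> : A * (4 / (m * b)) = A * (4 / b) * m^-1 by field; rewrite !gt_eqF.
by rewrite ler_wpM2l// mulr_ge0// divr_ge0// ltW.
Qed.

Lemma imbalance_arith (R : realType) (N h t m M theta : R) : 0 < m ->
  h = theta / 4 -> 2 * N ^+ 2 * h * t = theta / 4 -> M / (N * h) <= theta / 2 -> 0 <= theta ->
  (2 * N ^+ 2 * h * (2 * (t * m)) + 2 * m * h + M * m / (N * h)) / 2 <= theta * m.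
Proof.
move=> m0 hE tE NM th0.
have -> : (2 * N ^+ 2 * h * (2 * (t * m)) + 2 * m * h + M * m / (N * h)) / 2 =
    (2 * N ^+ 2 * h * t + h + M / (N * h) / 2) * m.
  by move: (N * h)^-1 => y; field.
by rewrite ler_pM2r// tE hE; rewrite hE in NM; lra.
Qed.

Lemma sum_arith (R : realType) (x1 x2 x3 x4 x5 x6 x7 u : R) :
  x1 * u + (x1 * u + (x2 * u + (x3 * u + (x4 * u + (x5 * u + (x5 * u + (x7 + x6 * u))))))) =
  (x1 + x1 + x2 + x3 + x4 + x5 + x5 + x6) * u + x7.
Proof. ring. Qed.

Lemma double_le (R : realType) (x y : R) : 2 * x <= y -> x <= y / 2.
Proof. by move=> h; lra. Qed.

(** The constants are chosen before [n], [u] and [S], so the bound is uniform in them. All failure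
    probabilities are of order [u], hence small through [u0], except that of the dyadic shells: it
    is made small by [Mf], which fixes the constant of the rate. *)
Lemma conditional_balance d (T : measurableType d) (R : realType) (P : probability T R)
    (p : nat) (a c : 'I_p -> R) (l c0 F M eps : R) :
  (0 < p)%N -> 0 < l -> 0 < c0 -> 0 < F -> 0 < M -> 0 < eps ->
  exists K0 u0 : R, [/\ 0 < K0, 0 < u0 & forall (n : nat) (u : R) (X : 'I_(2 * n) -> T -> p.-tuple R),
    (forall i, measurable_fun setT (X i)) -> mutually_independent P X ->
    (forall D i k, measurable D -> pr P (X i @^-1` D) = pr P (X k @^-1` D)) ->
    (forall y h i, 0 <= h -> (forall j, a j - 4 * l <= y j) -> (forall j, y j + h <= a j + 4 * l) ->
       c0 * h ^+ p <= pr P (X i @^-1` box y h) <= F * h ^+ p) ->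
    0 < u -> u <= u0 -> n%:R * u ^+ (8 * p) = 1 ->
    forall S : {set 'I_(2 * n)}, #|S| = n ->
    avoidable P X eps (fun w => (forall j, sum_dev (fun i => X i w) (c j) j <= M * n%:R) ->
      forall C, greedy (balance (fun i => X i w)) S C ->
        balance (fun i => X i w) C <= 2 / n%:R * (K0 * u ^+ 16))].
Proof.
move=> p0 l0 c00 F0 M0 eps0.
pose k := c0 * (l / 2) ^+ p / 4.
have k0 : 0 < k by rewrite divr_gt0// mulr_gt0// exprn_gt0// divr_gt0.
pose s := Num.sqrt (k * l ^+ 2 / 8).
have s0 : 0 < s by rewrite sqrtr_gt0 divr_gt0// mulr_gt0// exprn_gt0.
pose wl := (Num.sqrt M)^-1; have wl0 : 0 < wl by rewrite invr_gt0 sqrtr_gt0.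
pose K := p%:R / s; have K0 : 0 < K by rewrite divr_gt0// ltr0n.
pose Lam := K / wl; have Lam0 : 0 < Lam by rewrite divr_gt0.
pose g := wl / (4 * K); have g0 : 0 < g by rewrite divr_gt0// mulr_gt0.
have gL : 4 * (g * Lam) = 1 by rewrite /g /Lam; field; rewrite !gt_eqF.
pose eta := l / 2; have eta0 : 0 < eta by rewrite divr_gt0.
pose e := Num.min (l / 2) (wl * eta / (8 * K)).
have e0 : 0 < e by rewrite lt_min; apply/andP; split; pos_gt0.
have el : e <= l by rewrite ge_min; apply/orP; left; lra.
have Ke : 4 * (K * (2 * e)) <= wl * eta.
  have K8 : 0 < 8 * K by rewrite mulr_gt0.
  have he : e * (8 * K) <= wl * eta by rewrite -(ler_pdivlMr _ _ K8) ge_min lexx orbT.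
  by rewrite (_ : 4 * (K * (2 * e)) = e * (8 * K))//; ring.
pose ce := c0 * e ^+ p; have ce0 : 0 < ce by rewrite mulr_gt0// exprn_gt0.
(* Chosen so that [K * (theta * n)], a bound on the initial potential, equals the gain of
   [n * ce / 8] switches, a number that the clusters survive. *)
pose theta := ce / 8 * (wl * eta / 4) / K.
have th0 : 0 < theta by rewrite /theta; pos_gt0.
(* With [h], [N] and [t] so chosen, each of the three errors of [slab_imbalance] is at most
   [theta / 4] per individual after halving. *)
pose h := theta / 4; have h0 : 0 < h by rewrite divr_gt0.
pose N := (Num.truncn (2 * M / (theta * h))).+1.
have N0 : 0 < N%:R :> R by rewrite ltr0n.
pose t := theta / (8 * N%:R ^+ 2 * h).
have t0 : 0 < t by rewrite /t; pos_gt0.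
have NM : M / (N%:R * h) <= theta / 2.
  have q : 2 * M / (theta * h) < N%:R by exact: truncnS_gt.
  have th : 0 < theta * h by exact: mulr_gt0.
  have Nh : 0 < N%:R * h by exact: mulr_gt0.
  rewrite (ltr_pdivrMr _ _ th) in q; rewrite (ler_pdivrMr _ _ Nh).
  have -> : theta / 2 * (N%:R * h) = N%:R * (theta * h) / 2 by ring.
  by move: q; move: (N%:R * _) => y; lra.
have tE : 2 * N%:R ^+ 2 * h * t = theta / 4.
  by rewrite /t; field; rewrite !gt_eqF.
pose Cm := matching_const p l c0 F.
have Cm0 : 0 <= Cm by exact: matching_const_ge0.
pose D1 := (4 * l / e + 1) ^+ p * (4 / ce ^+ 2).
pose D2 := (4 * l / (l / 2) + 1) ^+ p * (4 / (c0 * (l / 2) ^+ p) ^+ 2).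
pose D3 := 4 * p%:R * N%:R / t ^+ 2.
pose J (rho : R) := (4 * rho + 1) ^+ p * (Cm * (2 ^+ p + 1)).
pose D4 := 8 * F ^+ 3 * (81 * l * (3 * Lam) ^+ 2) ^+ p.
pose D5 := (8 / g + 1) ^+ p * Cm * (8 / g).
have D10 : 0 <= D1 by rewrite /D1; pos_ge0.
have D20 : 0 <= D2 by rewrite /D2; pos_ge0.
have D30 : 0 <= D3 by rewrite /D3; pos_ge0.
have J0 rho : 0 <= rho -> 0 <= J rho by move=> ?; rewrite /J; pos_ge0.
have D40 : 0 <= D4 by rewrite /D4; pos_ge0.
have D50 : 0 <= D5 by rewrite /D5; pos_ge0.
pose Dt := (D1 + D1 + D2 + D3 + J eta + J Lam + J Lam + D4).
have Je := J0 eta (ltW eta0); have JL := J0 Lam (ltW Lam0).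
have Dt0 : 0 <= Dt by rewrite /Dt !addr_ge0.
(* The first bound makes the geometric series of [scale_level] available, the second leaves at most
   [eps / 2] for the shells. *)
pose Mf := Num.max (2 / g) (2 * D5 / eps).
have Mf0 : 0 < Mf by rewrite lt_max divr_gt0.
have gM : 2 <= g * Mf.
  by rewrite mulrC -ler_pdivrMr// le_max lexx.
have D5M : D5 / Mf <= eps / 2.
  have h1 : 2 * D5 <= Mf * eps by rewrite -(ler_pdivrMr _ _ eps0) le_max lexx orbT.
  rewrite (ler_pdivrMr _ _ Mf0) (_ : eps / 2 * Mf = Mf * eps / 2); last by ring.
  exact: double_le.
(* Each summand is the inverse of an upper bound required of [u]; the 9 yields [9 <= n], as [n * u]
   is at least 1. *)
pose B := 9 + l^-1 + 2 * Dt / eps + 4 * Lam / l + 8 / ce.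
have p1 : 0 <= l^-1 by rewrite invr_ge0 ltW.
have p2 : 0 <= 2 * Dt / eps by rewrite divr_ge0 ?(ltW eps0)// mulr_ge0.
have p3 : 0 <= 4 * Lam / l by rewrite divr_ge0 ?(ltW l0)// mulr_ge0// ltW.
have p4 : 0 <= 8 / ce by rewrite divr_ge0// ltW.
have [b1 b2 b3 b4 b5] := le_sum5 (ler0n R 9) p1 p2 p3 p4.
have B0 : 0 < B by apply: lt_le_trans b1.
exists (wl * Mf), B^-1; split; [exact: mulr_gt0|by rewrite invr_gt0|].
move=> n u X mX X_indep same_law box_bounds u0 uB nu S Sn.
have uB1 : u * B <= 1 by rewrite -ler_pdivlMr// mul1r.
have u9 : u * 9 <= 1 := small_scale u0 uB1 (ler0n R 9) b1.
have ul : u * l^-1 <= 1 := small_scale u0 uB1 p1 b2.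
have uD : u * (2 * Dt / eps) <= 1 := small_scale u0 uB1 p2 b3.
have uL : u * (4 * Lam / l) <= 1 := small_scale u0 uB1 p3 b4.
have uc : u * (8 / ce) <= 1 := small_scale u0 uB1 p4 b5.
have u1 : u <= 1 by apply: le_trans u9; rewrite ler_peMr ?ler1n// ltW.
have ul' : u <= l by move: ul; rewrite ler_pdivrMr// mul1r.
have uD' : Dt * u <= eps / 2.
  apply: double_le; move: uD; rewrite mulrA (ler_pdivrMr _ _ eps0) mul1r.
  by rewrite (_ : u * (2 * Dt) = 2 * (Dt * u))//; ring.
have uL' : 4 * Lam * u <= l.
  move: uL; rewrite mulrA (ler_pdivrMr _ _ l0) mul1r.
  by rewrite (_ : u * (4 * Lam) = 4 * Lam * u)//; ring.
have uc' : 8 * u <= ce by move: uc; rewrite mulrA (ler_pdivrMr _ _ ce0) mul1r mulrC.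
have nV : n%:R^-1 <= u by exact: (scale_inv p0 u0 u1 nu).
have n0 : (0 < n)%N.
  by rewrite lt0n; apply/eqP => n0; move: nu; rewrite n0 mul0r => /eqP; rewrite eq_sym oner_eq0.
have nR : 0 < n%:R :> R by rewrite ltr0n.
have nu1 : 1 <= n%:R * u by rewrite mulrC -ler_pdivrMr// mul1r.
have n9 : (9 <= n)%N.
  rewrite -(ler_nat R); apply: (@le_trans _ _ (9 * (n%:R * u))); first by rewrite ler_peMr.
  rewrite (_ : 9 * (n%:R * u) = n%:R * (u * 9)); last by ring.
  by rewrite -[leRHS]mulr1 ler_pM2l.
have nce : 8 <= n%:R * ce.
  apply: (@le_trans _ _ (n%:R * (8 * u))); last by rewrite ler_pM2l.
  by rewrite mulrCA ler_peMr.
have Cn : #|(~: S)%SET| = n.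
  by apply: (@addnI n); rewrite -[X in (X + _)%N]Sn cardsC card_ord addnn mul2n.
have uk j : (0 < j)%N -> u ^+ j <= u.
  by move=> j0; rewrite -[leRHS]expr1; apply: ler_wiXn2l => //; exact: ltW.
have Lu j : (0 < j)%N -> Lam * u ^+ j <= l / 2.
  move=> j0; apply: double_le; apply: le_trans uL'.
  apply: (@le_trans _ _ (2 * (Lam * u))); first by rewrite ler_pM2l// ler_pM2l// uk.
  by rewrite mulrA ler_pM2r// ler_pM2r// ler_nat.
have ulj j : (0 < j)%N -> u ^+ j <= l by move=> j0; exact: le_trans (uk j j0) ul'.
have L3 : 3 * Lam * u <= l.
  by apply: le_trans uL'; rewrite ler_pM2r// ler_pM2r// ler_nat.
pose L := Num.truncn (n%:R * ce / 4); pose L1 := Num.truncn (n%:R * (c0 * (l / 2) ^+ p) / 4).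
have LE : n%:R * ce / 8 <= L%:R.
  by apply: (eighth_le nce); rewrite natr1; exact: truncnS_gt.
have KL : K * (theta * n%:R) <= L%:R * (wl * eta / 4).
  have -> : K * (theta * n%:R) = n%:R * ce / 8 * (wl * eta / 4).
    by rewrite /theta; field; rewrite gt_eqF.
  by rewrite ler_wpM2r// divr_ge0// mulr_ge0// ltW.
have kL1 : k * n%:R <= L1.+1%:R.
  have -> : k * n%:R = n%:R * (c0 * (l / 2) ^+ p) / 4 by rewrite /k; ring.
  exact: ltW (truncnS_gt _).
have av1 (S' : {set 'I_(2 * n)}) : #|S'| = n -> avoidable P X (D1 * u)
    (fun w => dense_points (covariates X w) a l S' e L).
  move=> S'n; apply: (avoidable_le (dense_event mX X_indep l0 c00 same_law box_bounds S'n n0 e0 el)) => //.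
  apply: div_scale_le => //; [by pos_ge0|exact: exprn_gt0].
have av3 : avoidable P X (D2 * u)
    (fun w => dense_points (covariates X w) a l S (l / 2) L1).
  have l2 : l / 2 <= l by rewrite ler_piMr ?(ltW l0)// invf_le1// ler1n.
  have ck0 : 0 < c0 * (l / 2) ^+ p by pos_gt0.
  apply: (avoidable_le (dense_event mX X_indep l0 c00 same_law box_bounds Sn n0 eta0 l2)) => //.
  apply: div_scale_le => //; [by pos_ge0|exact: exprn_gt0].
have av4 : avoidable P X (D3 * u) (fun w =>
    (forall j, sum_dev (fun i => X i w) (c j) j <= M * n%:R) -> forall j,
    `|imbalance (covariates X w) (sample_mean (fun i => X i w)) S j| <= theta * n%:R).
  apply: (avoidable_le (imbalance_event mX X_indep same_law c erefl Sn Cn n0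
    (ltn0Sn _ : (0 < N)%N) h0 t0)).
    by rewrite invfM mulrA ler_wpM2l.
  move=> w im dev j; apply: le_trans (im _ j (dev j)) _.
  by apply: imbalance_arith => //; exact: ltW.
have eta_l2 : eta * u ^+ 0 <= l / 2 by rewrite expr0 mulr1.
have av5 := jump_event mX X_indep l0 c00 F0 box_bounds p0 u0 u1 nu Sn Cn n9
  (b1 := 0) (b2 := 7) (ltW eta0) isT isT isT eta_l2 (ulj 7%N isT).
have av6 := jump_event mX X_indep l0 c00 F0 box_bounds p0 u0 u1 nu Sn Cn n9
  (b1 := 7) (b2 := 11) (ltW Lam0) isT isT isT (Lu 7%N isT) (ulj 11%N isT).
have av7 := jump_event mX X_indep l0 c00 F0 box_bounds p0 u0 u1 nu Sn Cn n9
  (b1 := 11) (b2 := 13) (ltW Lam0) isT isT isT (Lu 11%N isT) (ulj 13%N isT).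
have av8 := levels_event mX X_indep l0 c00 F0 box_bounds p0 u0 u1 nu Sn Cn n9 g0 gL Mf0 gM uL' ul'.
have av9 := isolated_scale_event mX X_indep l0 F0 box_bounds p0 u0 u1 nu (mulr_gt0 (ltr0n R 3 : 0 < 3) Lam0) L3.
apply: (avoidable_le (avoidable_and mX (av1 S Sn) (avoidable_and mX (av1 (~: S)%SET Cn)
  (avoidable_and mX av3 (avoidable_and mX av4 (avoidable_and mX av5 (avoidable_and mX av6
  (avoidable_and mX av7 (avoidable_and mX av8 av9))))))))).
  suff : D1 * u + (D1 * u + (D2 * u + (D3 * u + (J eta * u + (J Lam * u +
    (J Lam * u + (D5 / Mf + D4 * u))))))) <= eps by [].
  apply: (@le_trans _ _ (Dt * u + D5 / Mf)); last by rewrite [leRHS]splitr lerD.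
  rewrite le_eqVlt; apply/orP; left; apply/eqP; rewrite /Dt.
  exact: sum_arith.
move=> w [dS [dC [d1 [im [m5 [m6 [m7 [lev iso]]]]]]]] dev C gC.
rewrite -[wl * Mf * _]mulrA; apply: (greedy_balance_le (a := a) (c := c) (l := l) (M := M) (k := k) (s := s)
  (L1 := L1) (L := L) (eta := eta) (e := e) (theta := theta) (e1 := u ^+ 7) (e2 := u ^+ 11)
  (e3 := u ^+ 13) p0 n0 Sn l0 M0 k0 erefl dev d1 kL1 (im dev) (ltW th0) KL _ _ _ eta0 _ e0 Ke
  dS dC _ m6 m7 _ lev _ gC).
- by rewrite exprn_ge0// ltW.
- by rewrite exprn_ge0// ltW.
- by rewrite exprn_ge0// ltW.
- by rewrite /eta ler_piMr ?(ltW l0)// invf_le1// ler1n.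
- by move: m5; rewrite expr0 mulr1.
- by rewrite mulr_gt0// exprn_gt0.
- by rewrite (_ : 3 * _ = 3 * Lam * u ^+ 13)// mulrA.
Qed.

(** * Averaging over the random initial allocation *)

Section random_allocation.
Context d (T : measurableType d) (R : realType) (P : probability T R).
Context d' (U : measurableType d') (n : nat) (X : 'I_(2 * n) -> T -> U).
Hypothesis mX : forall i, measurable_fun setT (X i).
Variable A0 : T -> {set 'I_(2 * n)}.
Hypothesis A0_meas : fin_measurable A0.
Hypothesis A0_unif : forall S : {set 'I_(2 * n)}, #|S| = n ->
  P (A0 @^-1` classical_sets.set1 S)%classic = (('C(2 * n, n)%:R)^-1)%:E.
Hypothesis A0_indep : independent_of P X A0.

Let q (S : {set 'I_(2 * n)}) := pr P (A0 @^-1` classical_sets.set1 S)%classic.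

Lemma sum_allocation : \sum_S q S = 1.
Proof.
rewrite -(prT P) (@pr_partition _ _ _ P _ (fun S => A0 @^-1` classical_sets.set1 S)%classic)//.
- by apply: eq_bigr => S _; rewrite setTI.
- by move=> S S' w /= -> ->.
- by move=> w; exists (A0 w).
Qed.

(** The ['C(2 * n, n)] sets of size [n] already carry the total mass 1. *)
Lemma allocation_size : \sum_(S : {set 'I_(2 * n)} | #|S| != n) q S = 0.
Proof.
have := sum_allocation; rewrite (bigID (fun S : {set 'I_(2 * n)} => #|S| == n))/=.
rewrite (eq_bigr (fun=> ('C(2 * n, n)%:R)^-1)); last first.
  by move=> S /eqP Sn; rewrite /q /pr A0_unif.
rewrite sumr_const (_ : #|_| = 'C(2 * n, n)); last first.
  rewrite -[X in 'C(X, _)](card_ord (2 * n)) -card_draws.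
  by apply: eq_card => S; rewrite !inE.
rewrite -[_ *+ _]mulr_natl divff; last by rewrite pnatr_eq0 -lt0n bin_gt0 leq_pmull.
by move=> h; lra.
Qed.

(* Conditioning on the initial allocation: it has the right size almost surely
   and is independent of the covariates. *)
Lemma random_allocation_le (eps : R) (Q : {set 'I_(2 * n)} -> T -> Prop) (B : set T) :
  0 <= eps -> measurable B ->
  (forall S : {set 'I_(2 * n)}, #|S| = n -> avoidable P X eps (Q S)) ->
  (forall w, Q (A0 w) w -> ~ B w) -> pr P B <= eps.
Proof.
move=> eps0 mB avQ QB.
have /choice[Bad BadP] : forall S : {set 'I_(2 * n)}, exists Bad, g_sigma_preimage X Bad /\
    (pr P Bad <= eps /\ (#|S| = n -> forall w, ~ Bad w -> Q S w)).
  move=> S; have [Sn|Sn] := eqVneq #|S| n.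
    by have [Bad GB [h1 h2]] := avQ S Sn; exists Bad.
  exists set0; split; first by have [] := algebra_g_sigma_preimage X.
  by rewrite pr0; split=> // Sn'; rewrite Sn' eqxx in Sn.
(* Initial sets of the wrong size count as failures as a whole; together they have probability 0. *)
pose E (S : {set 'I_(2 * n)}) := A0 @^-1` [set S] `&` ([set _ | #|S| <> n] `|` Bad S).
have mBad S : measurable (Bad S) by apply: (sigma_measurable mX); have [] := BadP S.
have mcst (Qp : Prop) : measurable [set _ : T | Qp].
  exact: (algebra_cst (algebra_measurable _)).
have mE S : measurable (E S).
  by apply: measurableI; [exact: A0_meas|apply: measurableU => //; exact: mcst].
apply: (@le_trans _ _ (pr P [set w | exists S, E S w])).
  apply: le_pr => //; first exact: (algebra_exists (algebra_measurable _)).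
  move=> w Bw; exists (A0 w); split=> //.
  have [An|An] := eqVneq #|A0 w| n; last by left; apply/eqP.
  right; apply: contrapT => nb; apply: (QB w) => //.
  by have [_ [_ h]] := BadP (A0 w); exact: h.
apply: (le_trans (pr_exists_le P mE)).
apply: (@le_trans _ _ (\sum_(S : {set 'I_(2 * n)}) ((#|S| != n)%:R * q S + q S * eps))).
  apply: ler_sum => S _.
  have qB : pr P (A0 @^-1` [set S] `&` Bad S) <= q S * eps.
    have [GB [Be _]] := BadP S.
    rewrite {1}/pr (A0_indep S GB) fineM ?fin_num_measure//.
    by rewrite ler_wpM2l ?pr_ge0.
  have [Sn|Sn] := eqVneq #|S| n.
    rewrite mul0r add0r; apply: le_trans qB; apply: le_pr => //.
      by apply: measurableI => //; exact: A0_meas.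
    by move=> w [Aw [//|Bw]].
  rewrite mul1r; apply: (@le_trans _ _ (q S)).
    by apply: le_pr => //; (exact: A0_meas || by move=> w []).
  by rewrite lerDl mulr_ge0 ?pr_ge0.
rewrite big_split/= -mulr_suml sum_allocation mul1r.
rewrite (_ : \sum_S _ = 0) ?add0r// -[RHS]allocation_size [RHS]big_mkcond/=.
by apply: eq_bigr => S _; case: (_ != _); rewrite ?mul1r ?mul0r.
Qed.

End random_allocation.

(** * The scale n^(-1/(8p)) and the rate *)

Section rate.
Context (R : realType) (p n : nat).
Hypotheses (p0 : (0 < p)%N) (n0 : (0 < n)%N).

Definition scale : R := (n%:R^-1) `^ (8 * p)%:R^-1.

Lemma scale_gt0 : 0 < scale.
Proof. by rewrite powR_gt0// invr_gt0 ltr0n. Qed.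

Lemma scaleX : n%:R * scale ^+ (8 * p) = 1.
Proof.
rewrite /scale -powR_mulrn ?powR_ge0// -powRrM mulVf; last first.
  by rewrite pnatr_eq0 -lt0n muln_gt0.
by rewrite powRr1 ?invr_ge0// divff// pnatr_eq0 -lt0n.
Qed.

Lemma scale_le (u : R) : 0 < u -> (u ^+ (8 * p))^-1 <= n%:R -> scale <= u.
Proof.
move=> u0 un.
have nR : 0 < n%:R :> R by rewrite ltr0n.
have e0 : (0 < 8 * p)%N by rewrite muln_gt0.
rewrite -(ler_pXn2r e0) ?nnegrE ?(ltW scale_gt0) ?(ltW u0)//.
have -> : scale ^+ (8 * p) = n%:R^-1.
  by apply: (mulfI (lt0r_neq0 nR)); rewrite scaleX divff// gt_eqF.
by rewrite -[leRHS]invrK lef_pV2 ?posrE ?invr_gt0 ?exprn_gt0.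
Qed.

(** The factor 1/n is that of the definition of the balance, and [scale ^+ 16] is n^(-2/p), the size
    of the final imbalance. *)
Lemma rateE : (n%:R : R) `^ (- (1 + 2 / p%:R)) = n%:R^-1 * scale ^+ 16.
Proof.
have nR : 0 < n%:R :> R by rewrite ltr0n.
have pR : p%:R != 0 :> R by rewrite pnatr_eq0 -lt0n.
rewrite /scale -powR_mulrn ?powR_ge0// -[n%:R^-1]powR_inv1 ?ler0n// -!powRrM -powRD; last first.
  by rewrite (gt_eqF nR) implybT.
by congr (_ `^ _); rewrite natrM; field.
Qed.

End rate.

Lemma box_bounds_of_density d (T : measurableType d) (R : realType) (P : probability T R)
    (p : nat) (f : 'rV[R]_p -> R) (X : T -> p.-tuple R) (a : 'I_p -> R) (l c0 F : R) :
  has_joint_density P X f -> 0 < c0 ->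
  (forall t : p.-tuple R, (forall j, `|tnth t j - a j| <= 4 * l) ->
     c0 <= f (\row_j tnth t j) <= F) ->
  forall y h, 0 <= h -> (forall j, a j - 4 * l <= y j) -> (forall j, y j + h <= a j + 4 * l) ->
  c0 * h ^+ p <= pr P (X @^-1` box y h) <= F * h ^+ p.
Proof.
move=> Xf c00 cF y h h0 y1 y2; apply: (box_prob Xf h0 (ltW c00)) => t yt.
apply: cF => j; have /andP[t1 t2] := yt j; have := y1 j; have := y2 j.
by move=> h1 h2; rewrite ler_norml; apply/andP; split; lra.
Qed.

(** * Markov bound for the sums of squared deviations *)

Section moment_event.
Context d (T : measurableType d) (R : realType) (P : probability T R).
Context (m p : nat) (X : 'I_m -> T -> p.-tuple R) (c V : 'I_p -> R).
Hypothesis mX : forall i, measurable_fun setT (X i).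
Hypothesis XV : forall i j, (\int[P]_w ((tnth (X i w) j - c j) ^+ 2)%:E <= (V j)%:E)%E.

Definition large_deviation (K : R) : set T :=
  [set w | exists j, K < sum_dev (fun i => X i w) (c j) j].

Lemma measurable_large_deviation_at K j :
  measurable [set w | K < sum_dev (fun i => X i w) (c j) j].
Proof.
rewrite -[X in measurable X]setTI.
rewrite (_ : [set w | _] = (fun w => sum_dev (fun i => X i w) (c j) j) @^-1` `]K, +oo[).
  exact: measurable_sum_dev.
by apply/seteqP; split => w; rewrite /= in_itv/= andbT.
Qed.

Lemma measurable_large_deviation K : measurable (large_deviation K).
Proof.
by apply: (algebra_exists (algebra_measurable _)) => j; exact: measurable_large_deviation_at.
Qed.

Lemma large_deviation_le K : 0 < K -> pr P (large_deviation K) <= \sum_j m%:R * V j / K.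
Proof.
move=> K0; apply: le_trans (pr_exists_le P (measurable_large_deviation_at K)) _.
apply: ler_sum => j _; apply: markov_pr => //; first exact: measurable_sum_dev.
  by move=> w; apply: sumr_ge0 => i _; exact: sqr_ge0.
under eq_integral do rewrite -sumEFin.
rewrite ge0_integral_sum//.
- apply: (@le_trans _ _ (\sum_(i < m) (V j)%:E)%E).
    by apply: lee_sum => i _; exact: XV.
  by rewrite sumEFin lee_fin sumr_const card_ord mulr_natl.
- move=> i; apply/measurable_EFinP; apply: measurable_funX; apply: measurable_funB => //.
  exact: measurable_coordinate.
- by move=> i w _; rewrite lee_fin sqr_ge0.
Qed.

End moment_event.

(* For each n, [X n i] is the covariate vector of individual i among the 2n
   individuals, [A0 n] the initial allocation and [A n] the final one. *)
Theorem mainTheorem5 (R : realType) (d : measure_display)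
    (T : measurableType d) (P : probability T R)
    (p : nat) (hp : (1 <= p)%N)
    (f : 'rV[R]_p -> R) (f_ge0 : forall t, 0 <= f t)
    (f_unif : unif_continuous f)
    (X : forall n : nat, 'I_(2 * n) -> {RV P >-> p.-tuple R})
    (X_density : forall n i, has_joint_density P (X n i) f)
    (X_indep : forall n, mutually_independent P (fun i => X n i : T -> p.-tuple R))
    (X_var : forall n i j, ('V_P[fun w => tnth (X n i w) j] < +oo)%E)
    (A0 : forall n : nat, T -> {set 'I_(2 * n)})
    (A0_meas : forall n, fin_measurable (A0 n))
    (A0_unif : forall n (S : {set 'I_(2 * n)}), #|S| = n ->
       P (A0 n @^-1` [set S]) = (('C(2 * n, n)%:R)^-1)%:E)
    (A0_indep : forall n,
       independent_of P (fun i => X n i : T -> p.-tuple R) (A0 n))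
    (A : forall n : nat, T -> {set 'I_(2 * n)})
    (A_meas : forall n, fin_measurable (A n))
    (A_greedy : forall n w,
       greedy (balance (fun i => X n i w)) (A0 n w) (A n w)) :
  bigO_in_probability P (fun n w => balance (fun i => X n i w) (A n w))
          (fun n => n%:R `^ (- (1 + 2 / p%:R))).
Proof.
move=> eps eps0.
(* All covariate vectors have density [f], so constants read off from one of them serve every [n]
   and every individual. *)
pose X0 : {RV P >-> p.-tuple R} := X 1%N ord0.
have X0f : has_joint_density P X0 f := X_density 1%N ord0.
have [a [l [c0 [F [l0 c00 F0 cF]]]]] := density_positive_cube f_ge0 f_unif X0f.
pose c j := fine 'E_P[fun w => tnth (X0 w) j].
pose Vo j := (\int[P]_w ((tnth (X0 w) j - c j) ^+ 2)%:E)%E.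
pose V j := fine (Vo j).
have Vo0 j : (0 <= Vo j)%E by apply: integral_ge0 => w _; rewrite lee_fin sqr_ge0.
have VE j : Vo j = (V j)%:E.
  by rewrite /V fineK// ge0_fin_numE//; exact: variance_moment (X_var 1%N ord0 j).
have V0 j : 0 <= V j by exact: fine_ge0.
have mX n i : measurable_fun setT (X n i) by exact: measurable_funPT.
have mcoord j : measurable_fun [set: p.-tuple R] (fun t : p.-tuple R => (tnth t j - c j) ^+ 2).
  by apply: measurable_funX; apply: measurable_funB => //; exact: measurable_tnth.
have XV n i j : (\int[P]_w ((tnth (X n i w) j - c j) ^+ 2)%:E <= (V j)%:E)%E.
  rewrite -VE /Vo (density_same_integral (X_density n i) X0f (mcoord j))// => t.
  exact: sqr_ge0.
pose W := \sum_j V j; have W0 : 0 <= W by apply: sumr_ge0.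
(* Markov's inequality then gives [eps / 2 * (W / (W + 1))]; the added 1 keeps [M] positive when all
   variances vanish. *)
pose M := 4 * (W + 1) / eps.
have M0 : 0 < M by rewrite divr_gt0// mulr_gt0// ltr_wpDl.
have [K0 [u0 [K00 u00 cond]]] := @conditional_balance d T R P p a c l c0 F M (eps / 2)
  hp l0 c00 F0 M0 (divr_gt0 eps0 (ltr0n R 2)).
exists (2 * K0); first by rewrite mulr_gt0.
pose n1 := (Num.truncn (u0 ^+ (8 * p))^-1).+1.
exists n1 => // n /= n1n.
have n0 : (0 < n)%N by apply: leq_trans n1n.
have nR : 0 < n%:R :> R by rewrite ltr0n.
pose u := scale R p n.
have uu0 : u <= u0.
  apply: scale_le => //; apply: ltW; apply: (lt_le_trans (truncnS_gt _)).
  by rewrite ler_nat.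
have rE := rateE R hp n0; rewrite -/u in rE.
set rate := n%:R `^ _ in rE *.
have rate0 : 0 < rate by rewrite /rate powR_gt0.
pose Z w := balance (fun i => X n i w) (A n w).
pose B : set T := [set w | 2 * K0 < `|Z w / rate|].
(* The final allocation takes finitely many values, and on each of them the balance is that of a
   fixed set. *)
have mB : measurable B.
  rewrite (_ : B = [set w | exists S, (A n @^-1` [set S] `&`
      [set w | 2 * K0 < `|balance (fun i => X n i w) S / rate|]) w]); last first.
    apply/seteqP; split => w; first by move=> Bw; exists (A n w).
    by move=> [S [<-]].
  apply: (algebra_exists (algebra_measurable _)) => S; apply: measurableI; first exact: A_meas.
  rewrite -[X in measurable X]setTI.
  rewrite (_ : [set w | _] = (fun w => `|balance (fun i => X n i w) S / rate|) @^-1` `]2 * K0, +oo[).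
    have mb : measurable_fun setT (fun w => `|balance (fun i => X n i w) S / rate|).
      apply: measurableT_comp => //; apply: measurable_funM => //.
      exact: (measurable_balance S (mX n)).
    exact: mb.
  by apply/seteqP; split => w; rewrite /= in_itv/= andbT.
pose D := large_deviation (X n) c (M * n%:R).
have mD : measurable D by exact: measurable_large_deviation.
have prD : pr P D <= eps / 2.
  have Mn : 0 < M * n%:R by exact: mulr_gt0.
  apply: le_trans (large_deviation_le (mX n) (XV n) Mn) _.
  rewrite -mulr_suml -mulr_sumr -/W natrM.
  have -> : 2 * n%:R * W / (M * n%:R) = eps / 2 * (W / (W + 1)).
    by rewrite /M; field; rewrite !gt_eqF// ltr_wpDl.
  rewrite ler_piMr ?divr_ge0 ?(ltW eps0)// ler_pdivrMr ?ltr_wpDl// mul1r.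
  by rewrite lerDl.
(* Off [D] the premise of [conditional_balance] holds, so a large balance can only come from the bad
   events of the covariates given the initial allocation. *)
have prBD : pr P (B `\` D) <= eps / 2.
  have same_law D' i k : measurable D' -> pr P (X n i @^-1` D') = pr P (X n k @^-1` D').
    by move=> mD'; rewrite /pr (density_same_law (X_density n i) (X_density n k)).
  have bb y h i : 0 <= h -> (forall j, a j - 4 * l <= y j) -> (forall j, y j + h <= a j + 4 * l) ->
      c0 * h ^+ p <= pr P (X n i @^-1` box y h) <= F * h ^+ p.
    exact: (box_bounds_of_density (X_density n i) c00 cF).
  have av := cond n u (fun i => X n i) (mX n) (X_indep n) same_law bb (scale_gt0 R p n0) uu0
    (scaleX R hp n0).
  apply: (random_allocation_le (mX n) (A0_meas n) (A0_unif n) (A0_indep n) _ _ av).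
  - by rewrite divr_ge0// ltW.
  - exact: measurableD.
  - move=> w Qw [Bw Dw].
    have dev j : sum_dev (fun i => X n i w) (c j) j <= M * n%:R.
      by rewrite leNgt; apply/negP => h; apply: Dw; exists j.
    have := Qw dev _ (A_greedy n w); rewrite -/(Z w) => Zle.
    move: Bw; rewrite /B /= ltNge => /negP; apply.
    have Z0 : 0 <= Z w.
      rewrite /Z /balance mulr_ge0 ?divr_ge0//.
      by apply: sumr_ge0.
    rewrite ger0_norm ?divr_ge0 ?(ltW rate0)// ler_pdivrMr//.
    apply: le_trans Zle _; rewrite rE le_eqVlt; apply/orP; left; apply/eqP.
    by move: (n%:R^-1) (u ^+ 16) => y z; ring.
have BE : B `<=` D `|` (B `\` D).
  by move=> w Bw; have [Dw|Dw] := pselect (D w); [left|right].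
have mBD : measurable (B `\` D) by exact: measurableD.
rewrite -/B prE// lee_fin.
apply: (@le_trans _ _ (pr P (D `|` (B `\` D)))).
  by apply: le_pr => //; exact: measurableU.
by apply: le_trans (pr_setU_le P mD mBD) _; rewrite [leRHS]splitr lerD.
Qed.
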